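(* Let $0\le\beta\le 1$ and let $r$ range over $(0,1)$. (i) If $\alpha\in (-\infty,-3)$, then there exist $f, g\in H(\mathbb D)$ such that $\log r\mapsto\log\mathsf{A}_{\alpha,\beta}(f,r)$ is not convex and $\log r\mapsto\log \mathsf{A}_{\alpha,\beta}(g,r)$ is not concave. (ii) If $\alpha\in [-3,0]$, then $\log r\mapsto \log\mathsf{A}_{\alpha,1}(a_nz^n,r)$ is convex for every $a_n\in\mathbb C$ with $a_n\not=0$ and every $n\in\mathbb N$. Consequently, $\log r\mapsto \log\mathsf{A}_{\alpha,1}(f,r)$ is convex for all $f\in U(\mathbb D)$. (iii) If $\alpha\in (0,\infty)$, then $\log r\mapsto\log\mathsf{A}_{\alpha,\beta}(a_nz^n,r)$ is not convex for $a_n\not=0$ and $n\in \mathbb N$.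
   Context: $\mathbb D$ is the open unit disk in $\mathbb C$, $r\mathbb D=\{z:|z|<r\}$, $H(\mathbb D)$ is the space of holomorphic maps $f:\mathbb D\to\mathbb C$, $U(\mathbb D)$ is the set of univalent (injective) functions in $H(\mathbb D)$, and $\mathbb N=\{1,2,3,\dots\}$. For $f\in H(\mathbb D)$ and $r\in(0,1)$, $A(f,r)$ is the Euclidean area of the image set $f(r\mathbb D)$ (i.e. of the projection to $\mathbb C$ of the Riemannian image, not counting multiplicity). For real $\alpha$, $d\mu_\alpha(t)=(1-t^2)^\alpha\,dt^2=(1-t^2)^\alpha\,2t\,dt$ on $(0,1)$. For $0\le\beta\le1$, $$\Phi_{A,\beta}(f,t)=\frac{A(f,t)}{(\pi t^2)^\beta},\qquad \mathsf{A}_{\alpha,\beta}(f,r)=\frac{\int_0^r\Phi_{A,\beta}(f,t)\,d\mu_\alpha(t)}{\int_0^r d\mu_\alpha(t)}.$$ $\mathsf{A}_{\alpha,\beta}(a_nz^n,r)$ denotes $\mathsf{A}_{\alpha,\beta}(f,r)$ for $f(z)=a_nz^n$. For a positive function $F$ on $(0,1)$, ''$\log r\mapsto\log F(r)$ is convex (concave)'' means that $u\mapsto\log F(e^u)$ is convex (concave) on $(-\infty,0)$.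
   Formalization: In (iii) the case n = 1, β = 1 is excluded: there Φ_{A,1}(a_1 z, t) = |a_1|² is constant, so the mean is constant in r and its logarithm is convex, contrary to the claim. *)

(* Defs.v *)
From HB Require Import structures.
From mathcomp Require Import all_boot all_order all_algebra.
From mathcomp Require Import all_classical all_reals all_analysis.
From mathcomp Require Export complex.

Set Implicit Arguments.
Unset Strict Implicit.
Unset Printing Implicit Defensive.

Import Order.TTheory GRing.Theory Num.Theory.
Import numFieldNormedType.Exports.

Local Open Scope classical_set_scope.
Local Open Scope complex_scope.
Local Open Scope ring_scope.

Section Defs.
Context {R : realType}.
Implicit Types (f : R[i] -> R[i]) (F : R -> R) (alpha beta t r : R).

Definition disk r : set R[i] := [set z | `|z| < r%:C].

(* Elements of H(D) and U(D) are represented by total functions; their values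
   outside the open unit disk are irrelevant. The derivative is taken over the
   field R[i], so this is complex differentiability. *)
Definition holomorphic_on_disk f : Prop :=
  forall z, disk 1 z -> derivable (f : R[i]^o -> R[i]^o) z 1.

Definition univalent_on_disk f : Prop :=
  holomorphic_on_disk f /\ {in disk 1 &, injective f}.

(* Two-dimensional Lebesgue measure of the image set f(tD), with C identified
   with the plane; the image is a plain set, so multiplicity is not counted. *)
Definition area f t : R :=
  fine ((lebesgue_measure \x lebesgue_measure)%E
    [set (complex.Re (f z), complex.Im (f z)) | z in disk t]).

Definition Phi_A beta f t : R := area f t / (pi * t ^+ 2) `^ beta.

(* Density of mu_alpha with respect to dt: dmu_alpha(t) = (1 - t^2)^alpha 2t dt. *)
Definition mu_density alpha t : R := (1 - t ^+ 2) `^ alpha * (2 * t).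

Definition area_mean alpha beta f r : R :=
  (\int[lebesgue_measure]_(t in `]0, r[) (Phi_A beta f t * mu_density alpha t)) /
  (\int[lebesgue_measure]_(t in `]0, r[) mu_density alpha t).

Definition positive_on01 F : Prop := forall r, 0 < r < 1 -> 0 < F r.

(* For F positive on (0,1): log r |-> log F(r) is convex (resp. concave). *)
Definition loglog_convex F : Prop :=
  convex_function [set u : R^o | u < 0] (fun u => ln (F (expR u))).

Definition loglog_concave F : Prop :=
  convex_function [set u : R^o | u < 0] (fun u => - ln (F (expR u))).

End Defs.

(* Main.v *)
Require Import Defs.
From HB Require Import structures.
From mathcomp Require Import all_boot all_order all_algebra.
From mathcomp Require Import all_classical all_reals all_analysis.
From mathcomp Require Import measurable_realfun.
From mathcomp Require Import ring lra.
Set Implicit Arguments.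
Unset Strict Implicit.
Unset Printing Implicit Defensive.
Import Order.TTheory GRing.Theory Num.Theory.
Import numFieldNormedType.Exports.

(* For univalent [f] the area of [f(tD)] is [pi * sum_n n |a_n|^2 t^(2n)]: cut a thin annulus into cells that
   are squares in logarithmic coordinates, on which [f] is linear up to second order, and sum the areas of the
   image squares by a discrete Parseval identity. With [x = r^2] and [F_l x] the integral of
   [s^l (1 - s)^alpha] over [0, x], the mean of [a z^n] is a constant times [F_l / F_0], [l = n - beta].
   (ii) For integral [l], [F_l / F_0] is a product of ratios [F_(j+1) / F_j], each of which is log-convex in
   [log x] when [-3 <= alpha <= 0]; log-convexity is preserved by nonnegative series.
   (iii) [log (F_l / F_0) <= l log x] tends to -oo as [x -> 0], while its slope tends to 0 as [x -> 1], which
   a convex function cannot do.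
   (i) Put [b = - alpha - 1] and [k = l b / (b - 1)]. The slope of [log (F_l / F_0)] is [l] near [x = 0], and
   [F_l - x^k F_0] tends to -oo as [x -> 1]; so the graph goes below the line of slope [k > l] through the
   origin, which excludes concavity, while convexity would keep it below a line of some slope [k2 > k],
   although [F_l - x^k2 F_0] tends to +oo. *)

(** * Planar Lebesgue measure: shears, isometries, squares *)

Section PlanarMeasure.
Context {R : realType}.
Local Open Scope classical_set_scope.
Local Open Scope ring_scope.
Local Notation leb := (@lebesgue_measure R).
Local Notation leb2 := (leb \x leb)%E.
Local Notation RT := (measurableTypeR R).

(** Holomorphy means only pointwise differentiability, so the coefficients [a_n] must be produced
    before any area can be summed. Goursat's lemma is proved for rectangles in the coordinate
    [log z]: circles become vertical segments, and Cauchy's formula becomes a statement about means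
    of periodic functions. The same coordinate turns the sectors of a thin annulus into congruent
    squares. The value of [k] in (i) and the threshold -3 have one origin. The derivative of
    [F_l - x^k F_0] is a power of [x] times [(1 - x)^alpha] times a bracket which, near [x = 1],
    starts with [(k - k/b - l) (1 - x)]. The chosen [k] annihilates this term; the next one, of
    order [(1 - x)^2], is negative when [0 < l <= 1] and [b > 2], and it forces divergence because
    [(1 - x)^(alpha + 2)] is not integrable for [alpha < -3]. Hence the degree [n] is picked with
    [0 < n - beta <= 1]. In (ii), log-convexity of [F_(j+1) / F_j] becomes the positivity of a
    function [g] satisfying a first-order differential inequality, whose free term has the right
    sign because [alpha >= -3]. *)

Lemma lebesgue_measure_shift (a : R) (A : set R) : measurable A ->
  leb ((fun x => x + a) @^-1` A) = leb A.
Proof.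
move=> mA; rewrite -[LHS]/(pushforward leb ((fun x => x + a) : _ -> RT) A).
apply/esym/lebesgue_measure_unique => //=.
  apply: measurable_funD => //; exact: measurable_cst.
move=> _ _ [[x y] _ <-]; rewrite /pushforward.
have -> : (fun x => x + a) @^-1` `]x, y] = `]x - a, y - a]%classic.
  by apply/seteqP; split => z /=; rewrite !in_itv /= ltrBlDr lerBrDr.
by rewrite !lebesgue_measure_itv /= !lte_fin ltrD2r -!EFinD (_ : _ - _ - _ = y - x) //; ring.
Qed.

(** Every point of [A] lies in a box with rational corners contained in [A], and there are countably
    many such boxes. *)
Lemma open_measurable2 (A : set (R * R)) : open A ->
  measurable (A : set (RT * RT)).
Proof.
move=> oA.
pose box (q : rat * rat * rat * rat) : set (RT * RT) :=
  `]ratr q.1.1.1, ratr q.1.1.2[ `*` `]ratr q.1.2, ratr q.2[.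
pose F q := if `[< box q `<=` A >] then box q else set0.
have -> : A = \bigcup_q F q.
  apply/seteqP; split=> [p Ap|p [q _]]; last by rewrite /F; case: asboolP => // + qp; apply.
  have /nbhs_ballP[e /= e0 eA] : nbhs p A by apply: open_nbhs_nbhs.
  have H (x : R) : exists q : rat * rat, (x \in `]ratr q.1, ratr q.2[) /\
      forall y, y \in `]ratr q.1, ratr q.2[ -> ball x e y.
    have x1 : x - e < x by rewrite ltrBlDr ltrDl.
    have x2 : x < x + e by rewrite ltrDl.
    have [q1 /= /[!in_itv]/=/andP[q1x xq1]] := rat_in_itvoo x1.
    have [q2 /= /[!in_itv]/=/andP[q2x xq2]] := rat_in_itvoo x2.
    exists (q1, q2); split => /=; first by rewrite in_itv /= xq1 q2x.
    move=> y /[!in_itv]/=/andP[q1y yq2]; rewrite /ball /= ltr_norml.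
    by apply/andP; split; lra.
  have [[q1 q2] [/= q1p q1A]] := H p.1; have [[q3 q4] [/= q3p q3A]] := H p.2.
  exists (q1, q2, q3, q4) => //; rewrite /F; case: asboolP; first by [].
  by case; move=> y [/= y1 y2]; apply: eA; split; [exact: q1A|exact: q3A].
apply: countable_bigcupT_measurable => // q.
by rewrite /F; case: asboolP => // _; apply: measurableX.
Qed.

Lemma closed_measurable2 (A : set (R * R)) : closed A ->
  measurable (A : set (RT * RT)).
Proof. by move=> /closed_openC/open_measurable2/measurableC; rewrite setCK. Qed.

(** Shears generate the rotations, and each section of a sheared set is a translate of a section of
    the original; invariance under isometries thus reduces to one-dimensional translations. *)
Definition shear1 (g : R -> R) (p : RT * RT) : RT * RT := (p.1 + g p.2, p.2).
Definition shear2 (g : R -> R) (p : RT * RT) : RT * RT := (p.1, p.2 + g p.1).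

Lemma measurable_shear1 (g : R -> R) : measurable_fun [set: R] g ->
  measurable_fun [set: RT * RT] (shear1 g).
Proof.
move=> mg; apply: measurable_fun_pair => //; apply: measurable_funD => //.
exact: (measurableT_comp (mg : measurable_fun [set: RT] (g : RT -> R)) measurable_snd).
Qed.

Lemma measurable_shear2 (g : R -> R) : measurable_fun [set: R] g ->
  measurable_fun [set: RT * RT] (shear2 g).
Proof.
move=> mg; apply: measurable_fun_pair => //; apply: measurable_funD => //.
exact: (measurableT_comp (mg : measurable_fun [set: RT] (g : RT -> R)) measurable_fst).
Qed.

Lemma shear2_measure (g : R -> R) (A : set (RT * RT)) : measurable A ->
  leb2 (shear2 g @^-1` A) = leb2 A.
Proof.
move=> mA; rewrite /product_measure1; apply: eq_integral => x _ /=.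
have -> : xsection (shear2 g @^-1` A) x = (fun y => y + g x) @^-1` xsection A x.
  by apply/seteqP; split=> y /=; rewrite /xsection /= !inE.
by rewrite lebesgue_measure_shift//; apply: measurable_xsection.
Qed.

Lemma lebesgue2_flip (A : set (RT * RT)) : measurable A -> leb2 A = (leb \x^ leb)%E A.
Proof. by move=> mA; apply: product_measure_unique => // *; exact: product_measure2E. Qed.

Lemma shear1_measure (g : R -> R) (A : set (RT * RT)) : measurable_fun [set: R] g ->
  measurable A -> leb2 (shear1 g @^-1` A) = leb2 A.
Proof.
move=> mg mA; rewrite !lebesgue2_flip//; last first.
  by rewrite -[X in measurable X]setTI; apply: measurable_shear1.
rewrite /product_measure2; apply: eq_integral => y _ /=.
have -> : ysection (shear1 g @^-1` A) y = (fun x => x + g y) @^-1` ysection A y.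
  by apply/seteqP; split=> x /=; rewrite /ysection /= !inE.
by rewrite lebesgue_measure_shift//; apply: measurable_ysection.
Qed.

Let measurable_affine (m b : R) : measurable_fun [set: R] (fun x => m * x + b).
Proof.
apply: measurable_funD; last exact: measurable_cst.
by apply: measurable_funM => //; exact: measurable_cst.
Qed.

Definition isometry (c s a b : R) (p : RT * RT) : RT * RT :=
  (c * p.1 - s * p.2 + a, s * p.1 + c * p.2 + b).

(** With [t = s / (1 + c)], the tangent of half the angle, a rotation is a horizontal shear by
    [- t], a vertical one by [s] and a horizontal one by [- t] again. The half-turn [c = -1] has no
    such [t]. *)
Let isometry_measure_pos (c s a b : R) (A : set (RT * RT)) : c ^+ 2 + s ^+ 2 = 1 ->
  1 + c != 0 -> measurable A ->
  measurable (isometry c s a b @^-1` A) /\ leb2 (isometry c s a b @^-1` A) = leb2 A.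
Proof.
move=> cs1 c1 mA; pose t := s / (1 + c).
pose f1 := shear1 (fun y => - t * y + 0).
pose f2 := shear2 (fun x => s * x + b).
pose f3 := shear1 (fun y => - t * y + (a + t * b)).
have E : isometry c s a b = f3 \o f2 \o f1.
  have E1 : 1 - t * s = c.
    apply: (mulfI c1); rewrite mulrBr mulr1 /t mulrA mulrCA divff// mulr1.
    by rewrite mulrDl mul1r -!expr2 -cs1; ring.
  have E2 : 2 * t - t * (t * s) = s.
    rewrite (_ : t * s = 1 - c); last by rewrite -E1; ring.
    by rewrite (_ : _ - _ = t * (1 + c)); [rewrite /t -mulrA mulVf// mulr1|ring].
  apply/funext => -[x y]; rewrite /f1 /f2 /f3 /isometry /shear1 /shear2 /=.
  congr (_, _); last by rewrite -[in c * y]E1; ring.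
  by rewrite -[in c * x]E1 -[X in _ - X * y]E2; ring.
rewrite E !comp_preimage.
have m3 : measurable (f3 @^-1` A).
  by rewrite -[X in measurable X]setTI; exact: measurable_shear1.
have m2 : measurable (f2 @^-1` (f3 @^-1` A)).
  by rewrite -[X in measurable X]setTI; exact: measurable_shear2.
split; first by rewrite -[X in measurable X]setTI; exact: measurable_shear1.
by rewrite shear1_measure// shear2_measure// shear1_measure.
Qed.

Lemma isometry_measure (c s a b : R) (A : set (RT * RT)) : c ^+ 2 + s ^+ 2 = 1 ->
  measurable A ->
  measurable (isometry c s a b @^-1` A) /\ leb2 (isometry c s a b @^-1` A) = leb2 A.
Proof.
move=> cs1 mA; have [c1|c1] := eqVneq (1 + c) 0; last exact: isometry_measure_pos.
have s0 : s = 0.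
  by apply/eqP; rewrite -sqrf_eq0; apply/eqP; move: cs1; rewrite (_ : c = -1); lra.
(* The half-turn is a quarter-turn applied twice. *)
have -> : isometry c s a b = isometry 0 1 a b \o isometry 0 1 0 0.
  apply/funext => -[x y]; rewrite /isometry /= s0 (_ : c = -1); last lra.
  by congr (_, _); ring.
have H01 : (0 : R) ^+ 2 + 1 ^+ 2 = 1 by ring.
have H1 : 1 + 0 != 0 :> R by rewrite addr0 oner_neq0.
have [m1 e1] := isometry_measure_pos a b H01 H1 mA.
have [m2 e2] := isometry_measure_pos 0 0 H01 H1 m1.
by rewrite comp_preimage; split => //; rewrite e2.
Qed.

Lemma closed_square_measure (u v l : R) : 0 <= l ->
  leb2 (`[u, u + l] `*` `[v, v + l]) = (l ^+ 2)%:E.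
Proof.
move=> l0; rewrite product_measure1E//= !lebesgue_measure_itv /= !lte_fin.
move: l0; rewrite le_eqVlt => /predU1P[<-|l0]; first by rewrite !addr0 !ltxx mul0e expr2 mul0r.
by rewrite !ltrDl l0 -!EFinB -EFinM expr2; congr (_%:E); ring.
Qed.

Lemma open_square_measure (u v l : R) : 0 <= l ->
  leb2 (`]u, u + l[ `*` `]v, v + l[) = (l ^+ 2)%:E.
Proof.
move=> l0; rewrite product_measure1E//= !lebesgue_measure_itv /= !lte_fin.
move: l0; rewrite le_eqVlt => /predU1P[<-|l0]; first by rewrite !addr0 !ltxx mul0e expr2 mul0r.
by rewrite !ltrDl l0 -!EFinB -EFinM expr2; congr (_%:E); ring.
Qed.

End PlanarMeasure.

(** * The real-valued modulus and complex differentiability *)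

Section ComplexNorm.
Context {R : realType}.
Local Open Scope classical_set_scope.
Local Open Scope complex_scope.
Local Open Scope ring_scope.
Local Notation C := R[i].
Local Notation normc := (@ComplexField.Normc.normc R).
Implicit Types (z w : C) (x y : R).

Lemma normc_normE z : `|z| = (normc z)%:C. Proof. by []. Qed.

Lemma diskE r z : disk r z <-> normc z < r.
Proof. by rewrite /disk /= ltcR. Qed.

Lemma normc_ge0 z : 0 <= normc z.
Proof. by case: z => x y /=; exact: sqrtr_ge0. Qed.

Lemma normc_mul z w : normc (z * w) = normc z * normc w.
Proof. exact: ComplexField.Normc.normcM. Qed.

Lemma normc_triangle z w : normc (z + w) <= normc z + normc w.
Proof. by rewrite -lecR rmorphD /= -!normc_normE ler_normD. Qed.

Lemma normc_opp z : normc (- z) = normc z.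
Proof. by apply: complexI; rewrite -!normc_normE normrN. Qed.

Lemma normc_sub_sym z w : normc (z - w) = normc (w - z).
Proof. by rewrite -normc_opp opprB. Qed.

Lemma normc_sub_le z w : normc z - normc w <= normc (z - w).
Proof. by rewrite lerBlDr (le_trans _ (normc_triangle _ _))// subrK. Qed.

Lemma normc0 : normc 0 = 0.
Proof. by apply: complexI; rewrite -normc_normE normr0. Qed.

Lemma normc1 : normc 1 = 1.
Proof. by apply: complexI; rewrite -normc_normE normr1. Qed.

Lemma normc_eq0 z : (normc z == 0) = (z == 0).
Proof.
apply/eqP/eqP => [|->]; last exact: normc0.
exact: ComplexField.Normc.eq0_normc.
Qed.

Lemma normc_gt0 z : (0 < normc z) = (z != 0).
Proof. by rewrite lt0r normc_ge0 andbT normc_eq0. Qed.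

Lemma normc_inv z : normc z^-1 = (normc z)^-1.
Proof. exact: ComplexField.Normc.normcV. Qed.

Lemma normc_real x : normc x%:C = `|x|.
Proof. by rewrite /= expr0n addr0 sqrtr_sqr. Qed.

Lemma normc_exp z n : normc (z ^+ n) = normc z ^+ n.
Proof. by elim: n => [|n IH]; rewrite ?normc1// !exprS normc_mul IH. Qed.

Lemma normc_nat n : normc n%:R = n%:R.
Proof. by rewrite (_ : n%:R = (n%:R)%:C) ?normc_real ?ger0_norm// rmorph_nat. Qed.

Lemma normc_sum (I : Type) (r : seq I) (P : pred I) (F : I -> C) :
  normc (\sum_(i <- r | P i) F i) <= \sum_(i <- r | P i) normc (F i).
Proof.
elim/big_ind2 : _ => [|x1 x2 y1 y2 h1 h2|//]; first by rewrite normc0.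
by rewrite (le_trans (normc_triangle _ _))// lerD.
Qed.

Lemma sqr_normc_ReIm z : normc z ^+ 2 = complex.Re z ^+ 2 + complex.Im z ^+ 2.
Proof. by case: z => x y /=; rewrite sqr_sqrtr// addr_ge0// sqr_ge0. Qed.

Lemma sqr_normc_conj z : (normc z ^+ 2)%:C = z * z^*.
Proof. by rewrite -sqr_normc rmorphXn. Qed.

Lemma normc_ge_ReN z : `|complex.Re z| <= normc z.
Proof.
by rewrite -[leLHS]ger0_norm// -ler_sqr ?nnegrE ?normc_ge0 ?normr_ge0// normr_id sqr_normc_ReIm real_normK ?num_real// lerDl sqr_ge0.
Qed.

Lemma normc_ge_ImN z : `|complex.Im z| <= normc z.
Proof.
by rewrite -[leLHS]ger0_norm// -ler_sqr ?nnegrE ?normc_ge0 ?normr_ge0// normr_id sqr_normc_ReIm real_normK ?num_real// lerDr sqr_ge0.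
Qed.

Lemma normc_le_ReIm z : normc z <= `|complex.Re z| + `|complex.Im z|.
Proof.
rewrite -ler_sqr ?nnegrE ?normc_ge0 ?addr_ge0// sqr_normc_ReIm.
rewrite -[X in X + _ <= _]real_normK ?num_real// -[X in _ + X <= _]real_normK ?num_real//.
have := mulr_ge0 (normr_ge0 (complex.Re z)) (normr_ge0 (complex.Im z)); lra.
Qed.

(** Stated with a real modulus and no quotient, so that error estimates add up directly and [h = 0]
    is not an exception. *)
Definition cdiff (f : C -> C) z c := forall e, 0 < e -> exists2 d, 0 < d &
  forall h, normc h < d -> normc (f (z + h) - f z - c * h) <= e * normc h.

Lemma derivable_cdiff (f : C -> C) z :
  derivable (f : R[i]^o -> R[i]^o) z 1 -> exists c, cdiff f z c.
Proof.
move=> /cvg_ex[/= c] /cvgr_dist_le Hc; exists c => e e0.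
have e0' : 0 < e%:C by rewrite ltcR.
have /nbhs_ballP[d /= d0 dP] := Hc _ e0'.
have dre : d = (complex.Re d)%:C.
  by move: d0; rewrite ltcE /= => /andP[/eqP]; case: (d) => a b /= ->.
have rd0 : 0 < complex.Re d by rewrite -ltcR -dre.
exists (complex.Re d) => // h hd.
have [->|h0] := eqVneq h 0; first by rewrite addr0 mulr0 subrr subr0 normc0 mulr0.
have /dP/(_ h0) : ball (0 : R[i]^o) d h.
  by rewrite -ball_normE /= sub0r normrN dre normc_normE ltcR.
rewrite normc_normE lecR => H.
have -> : f (z + h) - f z - c * h = - (h * (c - h^-1 *: (f (h *: 1 + z) - f z))).
  rewrite mulrBr [h * (_ *: _)]mulrA divff// mul1r [h *: 1]mulr1 [h + z]addrC; ring.
by rewrite normc_opp normc_mul mulrC ler_wpM2r ?normc_ge0.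
Qed.

End ComplexNorm.

(** * The complex exponential and polar coordinates *)

Section ComplexExponential.
Context {R : realType}.
Local Open Scope classical_set_scope.
Local Open Scope complex_scope.
Local Open Scope ring_scope.
Local Notation C := R[i].
Local Notation normc := (@ComplexField.Normc.normc R).
Implicit Types (z w a b : C) (x y : R).

Definition ez z : C := (expR (complex.Re z) * cos (complex.Im z)) +i* (expR (complex.Re z) * sin (complex.Im z)).

Lemma ezD z w : ez (z + w) = ez z * ez w.
Proof.
case: z w => x y [u v]; rewrite /ez /= expRD cosD sinD.
by apply/eqP; rewrite eq_complex /=; apply/andP; split; apply/eqP; ring.
Qed.

Lemma ez0 : ez 0 = 1.
Proof. by rewrite /ez /= expR0 cos0 sin0 mulr1 mulr0. Qed.

Lemma normc_ez z : normc (ez z) = expR (complex.Re z).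
Proof.
rewrite /ez /= !exprMn -mulrDr cos2Dsin2 mulr1 sqrtr_sqr.
by rewrite ger0_norm // expR_ge0.
Qed.

Lemma ez_neq0 z : ez z != 0.
Proof. by rewrite -normc_gt0 normc_ez expR_gt0. Qed.

Lemma ezN z : ez (- z) = (ez z)^-1.
Proof. by apply: (mulfI (ez_neq0 z)); rewrite -ezD subrr ez0 divff// ez_neq0. Qed.

Lemma ezX z n : ez z ^+ n = ez (n%:R * z).
Proof.
elim: n => [|n IH]; first by rewrite mul0r ez0.
by rewrite exprS IH -ezD -[in RHS]natr1 mulrDl mul1r addrC.
Qed.

Lemma ez_2pi z : ez (z + (0 +i* (2 * pi))) = ez z.
Proof. by case: z => x y; rewrite /ez /= addr0 mulr_natl cosD2pi sinD2pi. Qed.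

Lemma mvt_le (f df : R -> R) (k a b : R) : a <= b ->
  (forall x, is_derive x 1 f (df x)) -> (forall x, a <= x <= b -> df x <= k) ->
  f b - f a <= k * (b - a).
Proof.
move=> ab fd dk; have [|c cab ->] := @MVT_segment R f df a b ab (fun x _ => fd x).
  by apply: derivable_within_continuous => x _; exact: ex_derive.
by rewrite ler_wpM2r ?subr_ge0//; apply: dk; move: cab; rewrite in_itv.
Qed.

Lemma sin_le_abs x : `|sin x| <= `|x|.
Proof.
suff H y : 0 <= y -> `|sin y| <= y.
  have [x0|x0] := leP 0 x; first by rewrite (ger0_norm x0) H.
  by rewrite -normrN -sinN (ltr0_norm x0) H// oppr_ge0 ltW.
move=> y0; rewrite ler_norml; apply/andP; split.
  have : - sin y - - sin 0 <= 1 * (y - 0).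
    by apply: (mvt_le (f := fun t => - sin t) (df := fun t => - cos t)).
  by rewrite sin0 !oppr0 !addr0 mul1r lerNl.
have : sin y - sin 0 <= 1 * (y - 0).
  by apply: (mvt_le (df := cos)).
by rewrite sin0 oppr0 !addr0 mul1r.
Qed.

Lemma one_sub_cos_le x : 0 <= 1 - cos x <= `|x|.
Proof.
apply/andP; split; first by rewrite subr_ge0 cos_le1.
suff H y : 0 <= y -> 1 - cos y <= y.
  have [x0|x0] := leP 0 x; first by rewrite (ger0_norm x0) H.
  by rewrite -cosN (ltr0_norm x0) H// oppr_ge0 ltW.
move=> y0; have : - cos y - - cos 0 <= 1 * (y - 0).
  by apply: (mvt_le (f := fun t => - cos t) (df := fun t => - - sin t)).
by rewrite cos0 opprK addrC oppr0 addr0 mul1r.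
Qed.

Lemma one_sub_cos_le2 x : 1 - cos x <= x ^+ 2.
Proof.
have -> : 1 - cos x = 2 * sin (x / 2) ^+ 2.
  rewrite [in LHS](_ : x = x / 2 + x / 2); last by field.
  by rewrite cosD -!expr2 sin2cos2; ring.
have := sin_le_abs (x / 2); rewrite -ler_sqr ?nnegrE// !real_normK ?num_real// => H.
by move: H (sqr_ge0 x); rewrite exprMn; set u := sin _ ^+ 2; lra.
Qed.

Lemma sin_sub_le x : `|sin x - x| <= x ^+ 2.
Proof.
suff H y : 0 <= y -> `|sin y - y| <= y ^+ 2.
  have [x0|x0] := leP 0 x; first exact: H.
  rewrite (_ : sin x - x = - (sin (- x) - (- x))); last by rewrite sinN; ring.
  by rewrite normrN -sqrrN H// oppr_ge0 ltW.
move=> y0; rewrite ler_norml; apply/andP; split.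
  have : (y - sin y) - (0 - sin 0) <= y * (y - 0).
    apply: (mvt_le (f := fun t => t - sin t) (df := fun t => 1 - cos t)) => // t /andP[t0 ty].
    by have /andP[_] := one_sub_cos_le t; rewrite (ger0_norm t0) => /le_trans; apply.
  by rewrite sin0 oppr0 !addr0 oppr0 !addr0 -expr2 lerNl opprB.
have := sin_le_abs y; rewrite (ger0_norm y0) ler_norml => /andP[_ H].
by rewrite (le_trans _ (sqr_ge0 y))// subr_le0.
Qed.

Lemma expR_neg_bounds x : x <= 0 -> `|expR x - 1| <= `|x| /\ `|expR x - 1 - x| <= x ^+ 2.
Proof.
move=> x0; have e1 : expR x <= 1 by rewrite -expR0 ler_expR.
have e2 := expR_ge1Dx x.
have e3 : expR x - 1 - x <= x ^+ 2.
  (* [exp x <= 1/(1 - x)] *)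
  have e4 := expR_ge1Dx (- x).
  have e5 : expR x * (1 - x) <= 1.
    by rewrite -[leRHS](expRxMexpNx_1 x) ler_wpM2l// expR_ge0.
  by have := expR_ge0 x; nra.
by rewrite (ler0_norm x0); split; [rewrite ler0_norm; lra|rewrite ger0_norm; lra].
Qed.

Lemma ez_sub1_le z : complex.Re z <= 0 -> normc (ez z - 1) <= 3 * normc z.
Proof.
set x := complex.Re z; set y := complex.Im z => x0; set n := normc z.
have hx : `|x| <= n := normc_ge_ReN z.
have hy : `|y| <= n := normc_ge_ImN z.
have [h1 _] := expR_neg_bounds x0.
have -> : ez z - 1 = (expR x - 1)%:C + (expR x)%:C * ((cos y - 1) +i* sin y).
  rewrite /ez -/x -/y; by apply/eqP; rewrite eq_complex /=; apply/andP; split; apply/eqP; ring.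
apply: le_trans (normc_triangle _ _) _; rewrite normc_real normc_mul normc_real.
have h2 : normc ((cos y - 1) +i* sin y) <= `|cos y - 1| + `|sin y| := normc_le_ReIm _.
have /andP[c0 c1] := one_sub_cos_le y; have s1 := sin_le_abs y.
have h3 : `|cos y - 1| <= `|y| by rewrite distrC (ger0_norm c0).
have e1 : `|expR x| <= 1 by rewrite ger0_norm ?expR_ge0// -expR0 ler_expR.
have h4 : `|expR x| * normc ((cos y - 1) +i* sin y) <= 2 * n.
  rewrite -[leRHS]mul1r ler_pM// ?normc_ge0//.
  by apply: le_trans h2 _; lra.
lra.
Qed.

Lemma ez_sub_sub_le z : complex.Re z <= 0 -> normc (ez z - 1 - z) <= 4 * normc z ^+ 2.
Proof.
set x := complex.Re z; set y := complex.Im z => x0; set n := normc z.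
have hx : `|x| <= n := normc_ge_ReN z.
have hy : `|y| <= n := normc_ge_ImN z.
have [h1 h1'] := expR_neg_bounds x0.
have hx2 : x ^+ 2 <= n ^+ 2 by rewrite -real_normK ?num_real// ler_sqr ?nnegrE// normc_ge0.
have hy2 : y ^+ 2 <= n ^+ 2 by rewrite -[y ^+ 2]real_normK ?num_real// ler_sqr ?nnegrE// normc_ge0.
have e1 : `|expR x| <= 1 by rewrite ger0_norm ?expR_ge0// -expR0 ler_expR.
have -> : ez z - 1 - z = (expR x - 1 - x)%:C + (expR x)%:C * ((cos y - 1) +i* (sin y - y)) + (0 +i* ((expR x - 1) * y)).
  rewrite /ez /x /y; case: (z) => ? ?; by apply/eqP; rewrite eq_complex /=; apply/andP; split; apply/eqP; ring.
apply: le_trans (normc_triangle _ _) _.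
apply: le_trans (lerD (normc_triangle _ _) (lexx _)) _.
rewrite normc_real normc_mul normc_real.
have h2 : normc ((cos y - 1) +i* (sin y - y)) <= `|cos y - 1| + `|sin y - y| := normc_le_ReIm _.
have h3 : normc (0 +i* ((expR x - 1) * y)) <= `|expR x - 1| * `|y|.
  by have /= := normc_le_ReIm (0 +i* ((expR x - 1) * y)); rewrite normr0 add0r normrM.
have h5 : `|expR x - 1| * `|y| <= n ^+ 2 by rewrite expr2 ler_pM// (le_trans h1).
have /andP[c0 _] := one_sub_cos_le y; have c1 := one_sub_cos_le2 y.
have s1 := sin_sub_le y.
have h6 : `|cos y - 1| <= y ^+ 2 by rewrite distrC (ger0_norm c0).
have h4 : `|expR x| * normc ((cos y - 1) +i* (sin y - y)) <= 2 * n ^+ 2.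
  rewrite -[leRHS]mul1r ler_pM// ?normc_ge0//.
  by apply: le_trans h2 _; lra.
have h7 : normc (0 +i* ((expR x - 1) * y)) <= n ^+ 2 by exact: le_trans h3 h5.
lra.
Qed.

(** For [Re a <= Re b] put [d = a - b]; then the error is [ez b (ez d - 1 - d) + (ez b - 1) d],
    where every exponent has nonpositive real part. Since [|d| <= 2 m], the two terms are at most
    [8 m |d|] and [3 m |d|]. The other case follows by exchanging [a] and [b]. *)
Lemma ez_linearization a b (m : R) : complex.Re a <= 0 -> complex.Re b <= 0 ->
  normc a <= m -> normc b <= m -> normc (ez a - ez b - (a - b)) <= 11 * m * normc (a - b).
Proof.
have H a' b' : complex.Re a' <= complex.Re b' -> complex.Re b' <= 0 ->
  normc a' <= m -> normc b' <= m -> normc (ez a' - ez b' - (a' - b')) <= 11 * m * normc (a' - b').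
  move=> ab b0 am bm; set d := a' - b'.
  have d0 : complex.Re d <= 0 by rewrite /d; case: (a') (b') ab => ? ? [? ?] /=; lra.
  have -> : ez a' - ez b' - d = ez b' * (ez d - 1 - d) + (ez b' - 1) * d.
    by rewrite {1}(_ : a' = b' + d) ?ezD; [ring|rewrite /d; ring].
  apply: le_trans (normc_triangle _ _) _; rewrite !normc_mul.
  have h1 := ez_sub_sub_le d0; have h2 := ez_sub1_le b0.
  have h3 : normc (ez b') <= 1 by rewrite normc_ez -expR0 ler_expR.
  have h4 : normc d <= 2 * m.
    by rewrite /d (le_trans (normc_triangle _ _))// normc_opp; lra.
  have n0 := normc_ge0 d.
  have h5 : normc (ez b') * normc (ez d - 1 - d) <= 8 * m * normc d.
    rewrite -[leRHS]mul1r ler_pM ?normc_ge0//; apply: le_trans h1 _.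
    by rewrite expr2 mulrA ler_wpM2r//; lra.
  have h6 : normc (ez b' - 1) * normc d <= 3 * m * normc d.
    by rewrite ler_wpM2r// (le_trans h2)// ; lra.
  lra.
move=> a0 b0 am bm; have [ab|/ltW ba] := leP (complex.Re a) (complex.Re b); first exact: H.
rewrite -normc_opp (normc_sub_sym a b).
by rewrite (_ : - _ = ez b - ez a - (b - a)); [exact: H|ring].
Qed.

Lemma polar_form z : z != 0 -> exists2 v, 0 <= v < 2 * pi & z = ez (ln (normc z) +i* v).
Proof.
move=> z0; have n0 : 0 < normc z by rewrite normc_gt0.
set n := normc z in n0 *; have zn := sqr_normc_ReIm z; rewrite -/n in zn.
suff [v v2 [cv sv]] : exists2 v, 0 <= v < 2 * pi & n * cos v = complex.Re z /\ n * sin v = complex.Im z.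
  exists v => //; rewrite /ez /= lnK ?posrE// cv sv.
  by case: (z) => ? ?.
have p0 := pi_gt0 R.
pose c := complex.Re z / n.
have nc : n * c = complex.Re z by rewrite /c mulrCA divff ?mulr1// gt_eqF.
have c1 : -1 <= c <= 1.
  by have := normc_ge_ReN z; rewrite -/n -nc normrM (gtr0_norm n0) -[leRHS]mulr1 ler_pM2l// ler_norml.
have ac := acosK; have sc := sin_acos.
have s2 : n * Num.sqrt (1 - c ^+ 2) = `|complex.Im z|.
  rewrite -[X in X * _]gtr0_norm// -sqrtr_sqr -sqrtrM ?sqr_ge0// -[RHS]sqrtr_sqr.
  congr Num.sqrt; rewrite mulrBr mulr1 -exprMn nc zn; ring.
have a0 := acos_ge0 c1; have api := acos_lepi c1.
have [y0|y0] := leP 0 (complex.Im z).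
  exists (acos c); first by apply/andP; split => //; lra.
  by rewrite acosK ?in_itv// sin_acos// nc s2 ger0_norm.
(* In the lower half-plane the angle is reflected; there [acos c > 0], which keeps it strictly below
   [2 pi]. *)
exists (2 * pi - acos c).
  apply/andP; split; first lra.
  rewrite gtrBl lt_neqAle a0 andbT; apply/eqP => ac0.
  have := sin_acos c1; rewrite -ac0 sin0 => h; move: s2; rewrite -h mulr0 => /esym/eqP.
  by rewrite normr_eq0 lt_eqF.
rewrite mulr_natl addrC cosD2pi sinD2pi cosN sinN acosK ?in_itv// sin_acos// nc mulrN s2.
by rewrite ltr0_norm ?opprK.
Qed.

End ComplexExponential.

(** * Goursat's bisection argument for additive functions of rectangles *)

Section Bisection.
Context {R : realType}.
Local Open Scope classical_set_scope.
Local Open Scope ring_scope.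

Lemma nested_intervals (a w : nat -> R) : (forall n, a n <= a n.+1) ->
  (forall n, a n.+1 + w n.+1 <= a n + w n) -> (forall n, 0 <= w n) ->
  exists x, forall n, a n <= x <= a n + w n.
Proof.
move=> ai di w0.
have aM m n : (m <= n)%N -> a m <= a n by apply: (@homo_leq _ a <=%R) => //; exact: le_trans.
have bM m n : (m <= n)%N -> a n + w n <= a m + w m.
  by apply: (@homo_leq _ (fun n => a n + w n) (fun x y => y <= x)) => // x y z yx zx; exact: le_trans zx yx.
have ab m n : a m <= a n + w n.
  have [mn|/ltnW nm] := leqP m n; first by rewrite (le_trans (aM _ _ mn))// lerDl.
  by rewrite (le_trans _ (bM _ _ nm))// lerDl.
have hs : has_sup (range a).
  by split; [exists (a 0%N), 0%N|exists (a 0%N + w 0%N) => _ [m _ <-]].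
exists (sup (range a)) => n; apply/andP; split.
  by apply: ub_le_sup; [case: hs|exists n].
by apply: ge_sup; [exists (a 0%N), 0%N|move=> _ [m _ <-]].
Qed.

Lemma exists_half_pow_lt (W d : R) : 0 < d -> exists n, W / 2 ^+ n < d.
Proof.
move=> d0; have [n Hn] : exists n, W / d < n%:R.
  by exists (Num.bound `|W / d|); rewrite (le_lt_trans (ler_norm _) (archi_boundP _)).
exists n; rewrite ltr_pdivrMr ?exprn_gt0// mulrC -ltr_pdivrMr//.
apply: lt_trans Hn _; rewrite -natrX ltr_nat; exact: ltn_expl.
Qed.

Lemma quarter_large (d1 d2 d3 d4 N : R) : N <= `|d1 + d2 + (d3 + d4)| ->
  [|| N / 4 <= `|d1|, N / 4 <= `|d2|, N / 4 <= `|d3| | N / 4 <= `|d4|].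
Proof.
move=> H; apply/negPn/negP; rewrite !negb_or -!ltNge => /and4P[k1 k2 k3 k4].
have h1 := ler_normD (d1 + d2) (d3 + d4); have h2 := ler_normD d1 d2.
have h3 := ler_normD d3 d4; lra.
Qed.

(** If [D] were nonzero on the whole rectangle, one of its four quarters would carry at least a
    quarter of [|D|], and so on: the nested rectangles carry at least [|D| / 4^n]. Around their
    common point the local hypothesis bounds this by [e (W + H)^2 / 4^n], impossible for small
    [e]. *)
Lemma bisection_zero (x0 x1 y0 y1 : R) (D : R -> R -> R -> R -> R) :
  x0 <= x1 -> y0 <= y1 ->
  (forall a m b c d, x0 <= a -> a <= m -> m <= b -> b <= x1 -> y0 <= c -> c <= d -> d <= y1 ->
     D a b c d = D a m c d + D m b c d) ->
  (forall a b c m d, x0 <= a -> a <= b -> b <= x1 -> y0 <= c -> c <= m -> m <= d -> d <= y1 ->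
     D a b c d = D a b c m + D a b m d) ->
  (forall x y, x0 <= x <= x1 -> y0 <= y <= y1 -> forall e, 0 < e -> exists2 r, 0 < r &
     forall a b c d, x0 <= a -> a <= x <= b -> b <= x1 -> y0 <= c -> c <= y <= d -> d <= y1 ->
       b - a < r -> d - c < r -> `|D a b c d| <= e * ((b - a) + (d - c)) ^+ 2) ->
  D x0 x1 y0 y1 = 0.
Proof.
move=> x01 y01 splitx splity loc; apply/eqP; apply: contraT => D0.
pose W := x1 - x0; pose H := y1 - y0.
have W0 : 0 <= W by rewrite subr_ge0.
have H0 : 0 <= H by rewrite subr_ge0.
pose N n (p : R * R) := `|D p.1 (p.1 + W / 2 ^+ n) p.2 (p.2 + H / 2 ^+ n)|.
pose sh n (p : R * R) (ij : bool * bool) : R * R :=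
  (p.1 + ij.1%:R * (W / 2 ^+ n.+1), p.2 + ij.2%:R * (H / 2 ^+ n.+1)).
(* The default [(false, false)] is never reached: [grow] shows that some quarter always
   qualifies. *)
pose next n p := sh n p (odflt (false, false) [pick ij | N n p / 4 <= N n.+1 (sh n p ij)]).
pose fix P n := if n is m.+1 then next m (P m) else (x0, y0).
have halfW n : W / 2 ^+ n.+1 + W / 2 ^+ n.+1 = W / 2 ^+ n by rewrite exprS; field; rewrite expf_neq0.
have halfH n : H / 2 ^+ n.+1 + H / 2 ^+ n.+1 = H / 2 ^+ n by rewrite exprS; field; rewrite expf_neq0.
have Wn0 n : 0 <= W / 2 ^+ n by rewrite divr_ge0// exprn_ge0.
have Hn0 n : 0 <= H / 2 ^+ n by rewrite divr_ge0// exprn_ge0.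
have step n : let p := P n in let q := P n.+1 in
    [/\ p.1 <= q.1, q.1 + W / 2 ^+ n.+1 <= p.1 + W / 2 ^+ n,
        p.2 <= q.2 & q.2 + H / 2 ^+ n.+1 <= p.2 + H / 2 ^+ n].
  move=> p q; rewrite /q /= -/p /next; case: (odflt _ _) => i j /=.
  rewrite -(halfW n) -(halfH n) !addrA -!(addrA p.1) -!(addrA p.2) !lerD2l !lerDl.
  by case: i; case: j; rewrite /= ?mul1r ?mul0r ?add0r; split; rewrite ?lerDl.
have inside n : [/\ x0 <= (P n).1, (P n).1 + W / 2 ^+ n <= x1,
    y0 <= (P n).2 & (P n).2 + H / 2 ^+ n <= y1].
  elim: n => [|n [h1 h2 h3 h4]].
    by rewrite /= expr0 !divr1 /W /H ![_ + (_ - _)]addrC !subrK.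
  have [g1 g2 g3 g4] := step n.
  by split; [exact: le_trans g1|exact: le_trans h2|exact: le_trans g3|exact: le_trans h4].
have grow n : N n (P n) / 4 <= N n.+1 (P n.+1).
  rewrite /= /next; case: pickP => //= none; exfalso.
  have [h1 h2 h3 h4] := inside n.
  set p := P n in none h1 h2 h3 h4.
  have {}none i j : (N n p / 4 <= N n.+1 (sh n p (i, j))) = false by exact: none.
  have := none false false; have := none false true; have := none true false; have := none true true.
  rewrite /N /sh /= !mul0r !mul1r !addr0 -!(addrA _ (W / _)) -!(addrA _ (H / _)) halfW halfH.
  have w0 := Wn0 n.+1; have hh0 := Hn0 n.+1.
  have hW : p.1 + W / 2 ^+ n.+1 <= p.1 + W / 2 ^+ n by rewrite -(halfW n) addrA lerDl.
  have hH : p.2 + H / 2 ^+ n.+1 <= p.2 + H / 2 ^+ n by rewrite -(halfH n) addrA lerDl.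
  have hx : p.1 <= p.1 + W / 2 ^+ n.+1 by rewrite lerDl.
  have hy : p.2 <= p.2 + H / 2 ^+ n.+1 by rewrite lerDl.
  have hx' := le_trans h1 hx; have hy' := le_trans h3 hy.
  have hx2 := le_trans hW h2; have hy2 := le_trans hH h4.
  move=> k1 k2 k3 k4.
  have := @quarter_large (D p.1 (p.1 + W / 2 ^+ n.+1) p.2 (p.2 + H / 2 ^+ n.+1))
    (D p.1 (p.1 + W / 2 ^+ n.+1) (p.2 + H / 2 ^+ n.+1) (p.2 + H / 2 ^+ n))
    (D (p.1 + W / 2 ^+ n.+1) (p.1 + W / 2 ^+ n) p.2 (p.2 + H / 2 ^+ n.+1))
    (D (p.1 + W / 2 ^+ n.+1) (p.1 + W / 2 ^+ n) (p.2 + H / 2 ^+ n.+1) (p.2 + H / 2 ^+ n))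
    `|D p.1 (p.1 + W / 2 ^+ n) p.2 (p.2 + H / 2 ^+ n)|.
  rewrite k1 k2 k3 k4 /= => /implyP; rewrite implybF => /negP; apply.
  rewrite -splity//; rewrite -splity//; rewrite -splitx//.
  exact: le_trans hy hH.
have big n : `|D x0 x1 y0 y1| / 4 ^+ n <= N n (P n).
  elim: n => [|n IH].
    by rewrite /N /= !expr0 !divr1 /W /H ![_ + (_ - _)]addrC !subrK.
  by apply: le_trans (grow n); rewrite exprS invfM mulrA mulrAC ler_wpM2r//.
have [x Hx] := @nested_intervals (fun n => (P n).1) (fun n => W / 2 ^+ n)
   (fun n => let: And4 h _ _ _ := step n in h) (fun n => let: And4 _ h _ _ := step n in h) Wn0.
have [y Hy] := @nested_intervals (fun n => (P n).2) (fun n => H / 2 ^+ n)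
   (fun n => let: And4 _ _ h _ := step n in h) (fun n => let: And4 _ _ _ h := step n in h) Hn0.
have xin : x0 <= x <= x1 by have := Hx 0%N; rewrite /= expr0 divr1 /W addrC subrK.
have yin : y0 <= y <= y1 by have := Hy 0%N; rewrite /= expr0 divr1 /H addrC subrK.
(* Chosen so that [e (W + H)^2] is less than the full [|D|]; the added 1 covers a degenerate
   rectangle. *)
pose e := `|D x0 x1 y0 y1| / (2 * ((W + H) ^+ 2 + 1)).
have den0 : 0 < (W + H) ^+ 2 + 1 by rewrite ltr_wpDl// sqr_ge0.
have nD0 : 0 < `|D x0 x1 y0 y1| by rewrite normr_gt0.
have e0 : 0 < e by rewrite divr_gt0// mulr_gt0.
have [r r0 Hr] := loc x y xin yin e e0.
have [n Hn] := exists_half_pow_lt (W + H) r0.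
have [h1 h2 h3 h4] := inside n.
have hWH : W / 2 ^+ n + H / 2 ^+ n < r by rewrite -mulrDl.
have Wn := Wn0 n; have Hnn := Hn0 n.
have K : N n (P n) <= e * ((W + H) / 2 ^+ n) ^+ 2.
  have := Hr (P n).1 ((P n).1 + W / 2 ^+ n) (P n).2 ((P n).2 + H / 2 ^+ n) h1 (Hx n) h2 h3 (Hy n) h4.
  rewrite ![_ + _ - _]addrAC !subrr !add0r -mulrDl; apply.
    by apply: le_lt_trans hWH; rewrite lerDl.
  by apply: le_lt_trans hWH; rewrite lerDr.
have := le_trans (big n) K; rewrite exprMn mulrA exprVn -exprM mulnC exprM.
rewrite (_ : 2 ^+ 2 = 4); last by ring.
rewrite ler_pM2r ?invr_gt0 ?exprn_gt0// /e leNgt mulrAC ltr_pdivrMr ?mulr_gt0// ltr_pM2l//.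
by rewrite mulrDr mulr1 ltr_pwDr// ler_peMl ?sqr_ge0// ler1n.
Qed.

End Bisection.

(** * Green's formula for differentials that are closed pointwise *)

Section Goursat.
Context {R : realType}.
Local Open Scope classical_set_scope.
Local Open Scope ring_scope.

Definition integ (a b : R) (f : R -> R) : R := \int[lebesgue_measure]_(x in `[a, b]) f x.

Definition econt (f : R -> R) x := forall e, 0 < e -> exists2 d, 0 < d &
  forall h, `|h| < d -> `|f (x + h) - f x| <= e.

Lemma econt_continuous f x : econt f x -> {for x, continuous f}.
Proof.
move=> fx; apply/cvgrPdist_le => e e0; have [d d0 dP] := fx e e0.
apply/nbhs_ballP; exists d => //= y; rewrite /ball /= => xy.
by have := dP (y - x); rewrite [x + _]addrC subrK (distrC (f y)); apply; rewrite distrC.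
Qed.

Lemma econt_integrable a b f : (forall x, a <= x <= b -> econt f x) ->
  lebesgue_measure.-integrable `[a, b] (EFin \o f).
Proof.
move=> fc; apply: continuous_compact_integrable; first exact: segment_compact.
apply: continuous_in_subspaceT => x; rewrite inE /= in_itv /= => xab.
exact/econt_continuous/fc.
Qed.

Lemma integ_split a m b f : a <= m -> m <= b -> (forall x, a <= x <= b -> econt f x) ->
  integ a b f = integ a m f + integ m b f.
Proof.
move=> am mb fc; have fi := econt_integrable fc.
rewrite /integ -(@Rintegral_itv_obnd_cbnd _ m); last first.
  by apply: integrableS fi => //; apply: subset_itvr; rewrite bnd_simp.
have <- := @Rintegral_itvB _ f (BLeft a) (BRight b) m fi; rewrite ?bnd_simp//.
by rewrite [RHS]addrC subrK.
Qed.

Lemma integB a b f g : (forall x, a <= x <= b -> econt f x) ->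
  (forall x, a <= x <= b -> econt g x) ->
  integ a b (fun x => f x - g x) = integ a b f - integ a b g.
Proof. by move=> fc gc; rewrite /integ RintegralB//; exact: econt_integrable. Qed.

Lemma integ_cst a b c : a <= b -> integ a b (fun=> c) = c * (b - a).
Proof.
move=> ab; rewrite /integ Rintegral_cst//=; congr (_ * _).
rewrite lebesgue_measure_itv /= lte_fin.
by case: ltgtP ab => //= -> _; rewrite subrr.
Qed.

Lemma econt_cst c x : econt (fun=> c) x.
Proof. by move=> e e0; exists 1 => // h _; rewrite subrr normr0 ltW. Qed.

Lemma integ_dist a b f c e : a <= b -> (forall x, a <= x <= b -> econt f x) ->
  (forall x, a <= x <= b -> `|f x - c| <= e) -> `|integ a b f - c * (b - a)| <= e * (b - a).
Proof.
move=> ab fc fe; rewrite ler_distl -mulrBl -mulrDl -!integ_cst//.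
have fi := econt_integrable fc.
have ci k : lebesgue_measure.-integrable `[a, b] (EFin \o (fun=> k : R)).
  by apply: econt_integrable => x _; exact: econt_cst.
by apply/andP; split; apply: le_Rintegral => // x /=; rewrite in_itv /= => /fe; rewrite ler_distl => /andP[].
Qed.

Definition tdiff (A : R -> R -> R) x y a b := forall e, 0 < e -> exists2 d, 0 < d &
  forall p q, `|p| < d -> `|q| < d -> `|A (x + p) (y + q) - A x y - a * p - b * q| <= e * (`|p| + `|q|).

Lemma tdiff_econt (A : R -> R -> R) x y a b : tdiff A x y a b ->
  econt (A x) y /\ econt (fun s => A s y) x.
Proof.
move=> H; have [d d0 dP] := H 1 ltr01.
have k0 (k : R) : 0 < 1 + `|k| by rewrite ltr_pwDl.
have aux (f : R -> R) z k : (forall h, `|h| < d -> `|f (z + h) - f z - k * h| <= `|h|) -> econt f z.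
  move=> Hf e e0; exists (Num.min d (e / (1 + `|k|))); first by rewrite lt_min d0 divr_gt0.
  move=> h; rewrite lt_min => /andP[/Hf h1 h2].
  have -> : f (z + h) - f z = (f (z + h) - f z - k * h) + k * h by rewrite subrK.
  apply: le_trans (ler_normD _ _) _; rewrite normrM.
  apply: le_trans (lerD h1 (lexx _)) _; rewrite -{1}[`|h|]mul1r -mulrDl mulrC -ler_pdivlMr//.
  exact: ltW.
split; [apply: (aux _ _ b) => h hd; have := dP 0 h _ hd|apply: (aux _ _ a) => h hd; have := dP h 0 hd _];
  by rewrite !normr0 ?addr0 ?mulr0 ?subr0 ?add0r mul1r; apply.
Qed.

Lemma abs_sub_le_length (a b s x : R) : a <= s <= b -> a <= x <= b -> `|s - x| <= b - a.
Proof. by move=> /andP[? ?] /andP[? ?]; rewrite ler_norml; apply/andP; split; lra. Qed.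

(** The shared coefficient [m] says that the [y]-derivative of [A] equals the [x]-derivative of [B],
    so [A dx + B dy] is closed at each point. Near a point the affine parts of [A] and [B] integrate
    to zero around a rectangle and the remainders contribute little-o of the squared size, which is
    what [bisection_zero] asks for. *)
Lemma goursat_form (A B : R -> R -> R) (x0 x1 y0 y1 : R) : x0 <= x1 -> y0 <= y1 ->
  (forall x y, x0 <= x <= x1 -> y0 <= y <= y1 -> exists a m b, tdiff A x y a m /\ tdiff B x y m b) ->
  integ x0 x1 (A ^~ y0) - integ x0 x1 (A ^~ y1) + (integ y0 y1 (B x1) - integ y0 y1 (B x0)) = 0.
Proof.
move=> x01 y01 dAB.
have cA x y : x0 <= x <= x1 -> y0 <= y <= y1 -> econt (A ^~ y) x.
  by move=> xx yy; have [a [m [b [/tdiff_econt[]]]]] := dAB _ _ xx yy.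
have cB x y : x0 <= x <= x1 -> y0 <= y <= y1 -> econt (B x) y.
  by move=> xx yy; have [a [m [b [_ /tdiff_econt[]]]]] := dAB _ _ xx yy.
apply: (@bisection_zero _ x0 x1 y0 y1 (fun x0 x1 y0 y1 => integ x0 x1 (A ^~ y0) - integ x0 x1 (A ^~ y1) + (integ y0 y1 (B x1) - integ y0 y1 (B x0)))) => //.
- move=> a m b c d xa am mb bx yc cd dy.
  rewrite (integ_split am mb) ?(@integ_split a m b (A ^~ d))//; first ring.
    by move=> x /andP[ax xb]; apply: cA; apply/andP; split; [exact: le_trans ax|exact: le_trans bx|exact: le_trans cd|].
  by move=> x /andP[ax xb]; apply: cA; apply/andP; split; [exact: le_trans ax|exact: le_trans bx| |exact: le_trans dy].
- move=> a b c m d xa ab bx yc cm md dy.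
  rewrite (integ_split cm md) ?(@integ_split c m d (B a))//; first ring.
    by move=> x /andP[ax xb]; apply: cB; apply/andP; split; [|exact: le_trans bx|exact: le_trans ax|exact: le_trans dy].
  by move=> x /andP[ax xb]; apply: cB; apply/andP; split; [exact: le_trans ab| |exact: le_trans ax|exact: le_trans dy].
move=> x y xx yy e e0; have [al [m [be [dA dB]]]] := dAB x y xx yy.
have e2 : 0 < e / 2 by rewrite divr_gt0.
have [r1 r10 H1] := dA _ e2; have [r2 r20 H2] := dB _ e2.
exists (Num.min r1 r2); first by rewrite lt_min r10.
move=> a b c d xa /andP[ax xb] bx yc /andP[cy yd] dy; rewrite !lt_min => /andP[ba1 ba2] /andP[dc1 dc2].
have ab := le_trans ax xb; have cd := le_trans cy yd.
have HA s t : a <= s <= b -> c <= t <= d -> `|A s t - (A x y + al * (s - x) + m * (t - y))| <= e / 2 * ((b - a) + (d - c)).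
  move=> sab tcd.
  have sx : `|s - x| <= b - a by apply: abs_sub_le_length => //; apply/andP.
  have ty : `|t - y| <= d - c by apply: abs_sub_le_length => //; apply/andP.
  have := H1 (s - x) (t - y) (le_lt_trans sx ba1) (le_lt_trans ty dc1).
  rewrite [x + _]addrC [y + _]addrC !subrK => H; apply: le_trans (_ : _ <= e / 2 * (`|s - x| + `|t - y|)) _.
    by apply: le_trans H; rewrite le_eqVlt (_ : A s t - _ = A s t - A x y - al * (s - x) - m * (t - y)) ?eqxx//; ring.
  by rewrite ler_wpM2l ?(ltW e2)// lerD.
have HB s t : a <= s <= b -> c <= t <= d -> `|B s t - (B x y + m * (s - x) + be * (t - y))| <= e / 2 * ((b - a) + (d - c)).
  move=> sab tcd.
  have sx : `|s - x| <= b - a by apply: abs_sub_le_length => //; apply/andP.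
  have ty : `|t - y| <= d - c by apply: abs_sub_le_length => //; apply/andP.
  have := H2 (s - x) (t - y) (le_lt_trans sx ba2) (le_lt_trans ty dc2).
  rewrite [x + _]addrC [y + _]addrC !subrK => H; apply: le_trans (_ : _ <= e / 2 * (`|s - x| + `|t - y|)) _.
    by apply: le_trans H; rewrite le_eqVlt (_ : B s t - _ = B s t - B x y - m * (s - x) - be * (t - y)) ?eqxx//; ring.
  by rewrite ler_wpM2l ?(ltW e2)// lerD.
have inx s : a <= s <= b -> x0 <= s <= x1 by move=> /andP[? ?]; apply/andP; split; [exact: le_trans xa _|exact: le_trans bx].
have iny s : c <= s <= d -> y0 <= s <= y1 by move=> /andP[? ?]; apply/andP; split; [exact: le_trans yc _|exact: le_trans dy].
have icc : c <= c <= d by rewrite lexx.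
have idd : c <= d <= d by rewrite lexx cd.
have iaa : a <= a <= b by rewrite lexx.
have ibb : a <= b <= b by rewrite lexx ab.
have cAc : forall s, a <= s <= b -> econt (A ^~ c) s by move=> s sab; apply: cA; [exact: inx|exact: iny].
have cAd : forall s, a <= s <= b -> econt (A ^~ d) s by move=> s sab; apply: cA; [exact: inx|exact: iny].
have cBa : forall s, c <= s <= d -> econt (B a) s by move=> s scd; apply: cB; [exact: inx|exact: iny].
have cBb : forall s, c <= s <= d -> econt (B b) s by move=> s scd; apply: cB; [exact: inx|exact: iny].
have cDB f g z : econt f z -> econt g z -> econt (fun x => f x - g x) z.
  move=> fz gz e' e'0; have e'2 : 0 < e' / 2 by rewrite divr_gt0.
  have [d1 d10 Q1] := fz _ e'2; have [d2 d20 Q2] := gz _ e'2.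
  exists (Num.min d1 d2); first by rewrite lt_min d10.
  move=> h; rewrite lt_min => /andP[/Q1 q1 /Q2 q2].
  rewrite (_ : _ - _ - _ = (f (z + h) - f z) - (g (z + h) - g z)); last ring.
  by rewrite (le_trans (ler_normB _ _))// [leRHS]splitr lerD.
rewrite -!integB//.
set L := (b - a) + (d - c).
(* The affine parts leave [m (c - d) (b - a)] here and [m (b - a) (d - c)] in [KB]; these cancel in
   the sum. *)
have KA : `|integ a b (fun s => A s c - A s d) - (m * (c - d)) * (b - a)| <= (e * L) * (b - a).
  apply: integ_dist => // s sab; first by apply: cDB; [exact: cAc|exact: cAd].
  rewrite (_ : _ - _ = (A s c - (A x y + al * (s - x) + m * (c - y))) - (A s d - (A x y + al * (s - x) + m * (d - y)))); last ring.
  apply: le_trans (ler_normB _ _) _; apply: le_trans (lerD (HA _ _ sab icc) (HA _ _ sab idd)) _.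
  by rewrite -/L le_eqVlt; apply/orP; left; apply/eqP; field.
have KB : `|integ c d (fun t => B b t - B a t) - (m * (b - a)) * (d - c)| <= (e * L) * (d - c).
  apply: integ_dist => // t tcd; first by apply: cDB; [exact: cBb|exact: cBa].
  rewrite (_ : _ - _ = (B b t - (B x y + m * (b - x) + be * (t - y))) - (B a t - (B x y + m * (a - x) + be * (t - y)))); last ring.
  apply: le_trans (ler_normB _ _) _; apply: le_trans (lerD (HB _ _ ibb tcd) (HB _ _ iaa tcd)) _.
  by rewrite -/L le_eqVlt; apply/orP; left; apply/eqP; field.
have := le_trans (ler_normD _ _) (lerD KA KB).
set I := integ _ _ _; set J := integ _ _ _.
rewrite (_ : I - m * (c - d) * (b - a) + (J - m * (b - a) * (d - c)) = I + J); last ring.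
by rewrite (_ : e * L * (b - a) + e * L * (d - c) = e * L ^+ 2)//; rewrite /L; ring.
Qed.

End Goursat.

(** * Cauchy's theorem on rectangles *)

Section Contour.
Context {R : realType}.
Local Open Scope classical_set_scope.
Local Open Scope complex_scope.
Local Open Scope ring_scope.
Local Notation C := R[i].
Local Notation normc := (@ComplexField.Normc.normc R).
Local Notation Re := (@complex.Re R).
Local Notation Im := (@complex.Im R).

Definition ccont (f : R -> C) x := forall e, 0 < e -> exists2 d, 0 < d &
  forall h, `|h| < d -> normc (f (x + h) - f x) <= e.

Lemma ccont_econt f x : ccont f x -> econt (Re \o f) x /\ econt (Im \o f) x.
Proof.
move=> fx; split=> e e0; have [d d0 dP] := fx e e0; exists d => // h /dP; apply: le_trans => /=.
  by rewrite (_ : _ - _ = Re (f (x + h) - f x)) ?normc_ge_ReN//; case: (f _) (f _) => ? ? [].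
by rewrite (_ : _ - _ = Im (f (x + h) - f x)) ?normc_ge_ImN//; case: (f _) (f _) => ? ? [].
Qed.

Definition cinteg (a b : R) (f : R -> C) : C := (integ a b (Re \o f)) +i* (integ a b (Im \o f)).

Lemma cinteg_split a m b f : a <= m -> m <= b -> (forall x, a <= x <= b -> ccont f x) ->
  cinteg a b f = cinteg a m f + cinteg m b f.
Proof.
move=> am mb fc; apply/eqP; rewrite eq_complex /=; apply/andP; split; apply/eqP;
  by apply: integ_split => // x /fc/ccont_econt[].
Qed.

Lemma cinteg_le a b f M : a <= b -> (forall x, a <= x <= b -> ccont f x) ->
  (forall x, a <= x <= b -> normc (f x) <= M) -> normc (cinteg a b f) <= 2 * M * (b - a).
Proof.
move=> ab fc fM; apply: le_trans (normc_le_ReIm _) _ => /=.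
have h1 : `|integ a b (Re \o f) - 0 * (b - a)| <= M * (b - a).
  apply: integ_dist => // x xab; first by have [] := ccont_econt (fc _ xab).
  by rewrite subr0 (le_trans (normc_ge_ReN _))// fM.
have h2 : `|integ a b (Im \o f) - 0 * (b - a)| <= M * (b - a).
  apply: integ_dist => // x xab; first by have [] := ccont_econt (fc _ xab).
  by rewrite subr0 (le_trans (normc_ge_ImN _))// fM.
by move: h1 h2; rewrite mul0r !subr0; lra.
Qed.

Definition cxdiff (F : R -> R -> C) x y c := forall e, 0 < e -> exists2 d, 0 < d &
  forall p q, `|p| < d -> `|q| < d -> normc (F (x + p) (y + q) - F x y - c * (p +i* q)) <= e * (`|p| + `|q|).

(** The Cauchy-Riemann equations. The four facts are paired for the closed forms [Re F dx - Im F dy]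
    and [Im F dx + Re F dy], the real and imaginary parts of [F dz]. *)
Lemma cxdiff_tdiff F x y c : cxdiff F x y c ->
  [/\ tdiff (fun s t => Re (F s t)) x y (Re c) (- Im c),
      tdiff (fun s t => - Im (F s t)) x y (- Im c) (- Re c),
      tdiff (fun s t => Im (F s t)) x y (Im c) (Re c) &
      tdiff (fun s t => Re (F s t)) x y (Re c) (- Im c)].
Proof.
move=> H.
have HR : tdiff (fun s t => Re (F s t)) x y (Re c) (- Im c).
  move=> e e0; have [d d0 dP] := H e e0; exists d => // p q pd qd; apply: le_trans (dP p q pd qd).
  apply: le_trans (normc_ge_ReN _); case: c {H dP} => c1 c2; case: (F x y) (F _ _) => ? ? [? ?] /=.
  by rewrite le_eqVlt; apply/orP; left; apply/eqP; congr (`|_|); ring.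
have HI : tdiff (fun s t => Im (F s t)) x y (Im c) (Re c).
  move=> e e0; have [d d0 dP] := H e e0; exists d => // p q pd qd; apply: le_trans (dP p q pd qd).
  apply: le_trans (normc_ge_ImN _); case: c {H HR dP} => c1 c2; case: (F x y) (F _ _) => ? ? [? ?] /=.
  by rewrite le_eqVlt; apply/orP; left; apply/eqP; congr (`|_|); ring.
split => // e e0; have [d d0 dP] := HI e e0; exists d => // p q pd qd.
by rewrite -normrN; apply: le_trans (dP p q pd qd); rewrite le_eqVlt; apply/orP; left; apply/eqP; congr (`|_|); ring.
Qed.

Lemma cxdiff_ccont F x y c : cxdiff F x y c -> ccont (F x) y /\ ccont (F ^~ y) x.
Proof.
move=> H; have [d d0 dP] := H 1 ltr01.
have k0 : 0 < 1 + normc c by rewrite ltr_pwDl// normc_ge0.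
have aux (f : R -> C) z (g : R -> C) : (forall h, normc (g h) <= `|h|) ->
    (forall h, `|h| < d -> normc (f (z + h) - f z - c * g h) <= `|h|) -> ccont f z.
  move=> gh Hf e e0; exists (Num.min d (e / (1 + normc c))); first by rewrite lt_min d0 divr_gt0.
  move=> h; rewrite lt_min => /andP[/Hf h1 h2].
  have -> : f (z + h) - f z = (f (z + h) - f z - c * g h) + c * g h by rewrite subrK.
  apply: le_trans (normc_triangle _ _) _; rewrite normc_mul.
  apply: le_trans (lerD h1 (ler_wpM2l (normc_ge0 c) (gh h))) _.
  by rewrite -{1}[`|h|]mul1r -mulrDl mulrC -ler_pdivlMr// ltW.
have g1 h : normc (0 +i* h) <= `|h|.
  by apply: le_trans (normc_le_ReIm _) _; rewrite /= normr0 add0r.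
have g2 h : normc (h +i* 0) <= `|h|.
  by apply: le_trans (normc_le_ReIm _) _; rewrite /= normr0 addr0.
split; [apply: (aux _ _ _ g1) => h hd; have := dP 0 h _ hd|apply: (aux _ _ _ g2) => h hd; have := dP h 0 hd _];
  by rewrite !normr0 ?addr0 ?mulr0 ?subr0 ?add0r mul1r; apply.
Qed.

Lemma cxdiff_bounded F x y c : cxdiff F x y c -> exists d M, 0 < d /\
  forall s t, `|s - x| < d -> `|t - y| < d -> normc (F s t) <= M.
Proof.
move=> H; have [d d0 dP] := H 1 ltr01.
exists d, (normc (F x y) + normc c * (2 * d) + 2 * d); split => // s t sd td.
have := dP _ _ sd td; rewrite [x + _]addrC [y + _]addrC !subrK mul1r => h.
have -> : F s t = F x y + c * ((s - x) +i* (t - y)) + (F s t - F x y - c * ((s - x) +i* (t - y))) by ring.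
apply: le_trans (normc_triangle _ _) _; apply: lerD; last by apply: le_trans h _; lra.
apply: le_trans (normc_triangle _ _) _; rewrite lerD2l normc_mul ler_wpM2l ?normc_ge0//.
by apply: le_trans (normc_le_ReIm _) _ => /=; lra.
Qed.

(** The counterclockwise integral of [F dz] around the rectangle; [dz = 'i dy] on the vertical
    sides. *)
Definition contour (F : R -> R -> C) x0 x1 y0 y1 : C :=
  cinteg x0 x1 (F ^~ y0) - cinteg x0 x1 (F ^~ y1) + 'i * (cinteg y0 y1 (F x1) - cinteg y0 y1 (F x0)).

Lemma goursat F x0 x1 y0 y1 : x0 <= x1 -> y0 <= y1 ->
  (forall x y, x0 <= x <= x1 -> y0 <= y <= y1 -> exists c, cxdiff F x y c) ->
  contour F x0 x1 y0 y1 = 0.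
Proof.
move=> x01 y01 dF; apply/eqP; rewrite eq_complex /=; apply/andP; split; apply/eqP.
  rewrite -[RHS](@goursat_form _ (fun s t => Re (F s t)) (fun s t => - Im (F s t)) x0 x1 y0 y1)//; last first.
    by move=> x y xx yy; have [c /cxdiff_tdiff[h1 h2 _ _]] := dF x y xx yy; exists (Re c), (- Im c), (- Re c).
  have iN x : x0 <= x <= x1 -> integ y0 y1 (fun t => - Im (F x t)) = - integ y0 y1 (fun t => Im (F x t)).
    move=> xx; have -> : (fun t => - Im (F x t)) = (fun t => 0 - Im (F x t)) by apply/funext => t; rewrite sub0r.
    rewrite (@integB _ y0 y1 (fun=> 0)); first by rewrite integ_cst// mul0r sub0r.
      by move=> t _; exact: econt_cst.
    by move=> t tt; have [c /cxdiff_ccont[/ccont_econt[]]] := dF x t xx tt.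
  by rewrite !iN ?lexx ?x01// mul0r mul1r sub0r; rewrite /comp; ring.
rewrite -[RHS](@goursat_form _ (fun s t => Im (F s t)) (fun s t => Re (F s t)) x0 x1 y0 y1)//.
  by rewrite mul0r mul1r add0r.
by move=> x y xx yy; have [c /cxdiff_tdiff[_ _ h1 h2]] := dF x y xx yy; exists (Im c), (Re c), (- Im c).
Qed.

Lemma contour_splitx F x0 m x1 y0 y1 : x0 <= m -> m <= x1 ->
  (forall x, x0 <= x <= x1 -> ccont (F ^~ y0) x) ->
  (forall x, x0 <= x <= x1 -> ccont (F ^~ y1) x) ->
  contour F x0 x1 y0 y1 = contour F x0 m y0 y1 + contour F m x1 y0 y1.
Proof.
move=> xm mx c0 c1; rewrite /contour (cinteg_split xm mx)// (cinteg_split xm mx (f := F ^~ y1))//.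
ring.
Qed.

Lemma contour_splity F x0 x1 y0 m y1 : y0 <= m -> m <= y1 ->
  (forall y, y0 <= y <= y1 -> ccont (F x0) y) ->
  (forall y, y0 <= y <= y1 -> ccont (F x1) y) ->
  contour F x0 x1 y0 y1 = contour F x0 x1 y0 m + contour F x0 x1 m y1.
Proof.
move=> ym my c0 c1; rewrite /contour (cinteg_split ym my)// (cinteg_split ym my (f := F x0))//.
ring.
Qed.

Lemma eq0_small (z : C) (K d : R) : 0 < d -> (forall e, 0 < e -> e < d -> normc z <= K * e) -> z = 0.
Proof.
move=> d0 H; apply/eqP; rewrite -normc_eq0 eq_le normc_ge0 andbT; apply/ler_addgt0Pr => e e0.
rewrite add0r; pose e' := Num.min (d / 2) (e / (`|K| + 1)).
have K0 : 0 < `|K| + 1 by rewrite ltr_wpDl.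
have e'0 : 0 < e' by rewrite lt_min !divr_gt0.
have e'd : e' < d.
  by rewrite /e' gt_min; apply/orP; left; rewrite ltr_pdivrMr// ltr_pMr// ltr1n.
apply: le_trans (H _ e'0 e'd) _.
apply: le_trans (_ : (`|K| + 1) * e' <= _).
  by rewrite ler_wpM2r ?(ltW e'0)// (le_trans (ler_norm _))// lerDl.
by rewrite mulrC -ler_pdivlMr// /e' ge_min lexx orbT.
Qed.

(* Cauchy's theorem on a rectangle with one exceptional interior point [p], near which [F] is bounded:
   all but a small square around [p] contributes nothing. *)
Lemma goursat_exceptional F x0 x1 y0 y1 p1 p2 : x0 < p1 < x1 -> y0 < p2 < y1 ->
  (forall x y, x0 <= x <= x1 -> y0 <= y <= y1 -> ~ (x = p1 /\ y = p2) -> exists c, cxdiff F x y c) ->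
  (exists d M, 0 < d /\ forall s t, `|s - p1| < d -> `|t - p2| < d -> normc (F s t) <= M) ->
  contour F x0 x1 y0 y1 = 0.
Proof.
move=> /andP[xp px] /andP[yp py] dF [d [M [d0 FM]]].
pose D := Num.min d (Num.min (Num.min (p1 - x0) (x1 - p1)) (Num.min (p2 - y0) (y1 - p2))).
have D0 : 0 < D by rewrite !lt_min d0 !subr_gt0 xp px yp py.
(* Four sides of length [2 e], each bounded by [2 M (2 e)]; the extra factor 2 comes from estimating
   real and imaginary parts separately. *)
apply: (@eq0_small _ (16 * M) D) => // e e0; rewrite !lt_min.
move=> /and3P[ed /andP[e1 e2] /andP[e3 e4]].
have cx x y : x0 <= x <= x1 -> y0 <= y <= y1 -> y != p2 -> ccont (F ^~ y) x.
  move=> xx yy yp2; have [|c /cxdiff_ccont[]//] := dF x y xx yy.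
  by case=> _ /eqP; rewrite (negbTE yp2).
have cy x y : x0 <= x <= x1 -> y0 <= y <= y1 -> x != p1 -> ccont (F x) y.
  move=> xx yy xp1; have [|c /cxdiff_ccont[]//] := dF x y xx yy.
  by case=> /eqP; rewrite (negbTE xp1).
have Z a b c f : x0 <= a -> a <= b -> b <= x1 -> y0 <= c -> c <= f -> f <= y1 ->
    (b < p1) || (p1 < a) || (f < p2) || (p2 < c) -> contour F a b c f = 0.
  move=> h1 h2 h3 h4 h5 h6 h7; apply: goursat => // x y /andP[ax xb] /andP[cy' yf].
  apply: dF; [by rewrite (le_trans h1 ax) (le_trans xb h3)|by rewrite (le_trans h4 cy') (le_trans yf h6)|].
  case=> ? ?; subst x y; move: h7; rewrite ltNge xb ltNge ax ltNge yf ltNge cy'; done.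
have l1 : x0 <= p1 - e by lra.
have l2 : p1 - e <= p1 + e by lra.
have l3 : p1 + e <= x1 by lra.
have m1 : y0 <= p2 - e by lra.
have m2 : p2 - e <= p2 + e by lra.
have m3 : p2 + e <= y1 by lra.
have o1 : p1 - e < p1 by lra.
have o2 : p1 < p1 + e by lra.
have o3 : p2 - e < p2 by lra.
have o4 : p2 < p2 + e by lra.
have y01 : y0 <= y1 by lra.
have x01 : x0 <= x1 by lra.
rewrite (contour_splitx l1 (le_trans l2 l3)); last 2 first.
- by move=> x xx; apply: cx => //; [rewrite lexx|rewrite lt_eqF].
- by move=> x xx; apply: cx => //; [rewrite lexx y01|rewrite gt_eqF].
rewrite (Z x0 (p1 - e) y0 y1) ?o1 ?lexx// ?add0r; last exact: le_trans l2 l3.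
rewrite (contour_splitx l2 l3); last 2 first.
- by move=> x /andP[ax xb]; apply: cx => //; [rewrite (le_trans l1 ax)|rewrite lexx|rewrite lt_eqF].
- by move=> x /andP[ax xb]; apply: cx => //; [rewrite (le_trans l1 ax)|rewrite lexx y01|rewrite gt_eqF].
rewrite (Z (p1 + e) x1 y0 y1) ?o2 ?orbT ?lexx// ?addr0; last exact: le_trans l1 l2.
rewrite (contour_splity m1 (le_trans m2 m3)); last 2 first.
- by move=> y yy; apply: cy => //; [rewrite l1 (le_trans l2 l3)|rewrite lt_eqF].
- by move=> y yy; apply: cy => //; [rewrite l3 (le_trans l1 l2)|rewrite gt_eqF].
rewrite (Z (p1 - e) (p1 + e) y0 (p2 - e)) ?o3 ?orbT ?lexx// ?add0r; last exact: le_trans m2 m3.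
rewrite (contour_splity m2 m3); last 2 first.
- by move=> y /andP[ay yb]; apply: cy => //; [rewrite l1 (le_trans l2 l3)|rewrite (le_trans m1 ay)|rewrite lt_eqF].
- by move=> y /andP[ay yb]; apply: cy => //; [rewrite l3 (le_trans l1 l2)|rewrite (le_trans m1 ay)|rewrite gt_eqF].
rewrite (Z (p1 - e) (p1 + e) (p2 + e) y1) ?o4 ?orbT ?lexx// ?addr0; last exact: le_trans m1 m2.
have ee (p x : R) : p - e <= x <= p + e -> `|x - p| < d.
  by move=> h; apply: le_lt_trans ed; rewrite ler_distl.
have Bx y : y0 <= y <= y1 -> y != p2 -> `|y - p2| < d -> normc (cinteg (p1 - e) (p1 + e) (F ^~ y)) <= 2 * M * (2 * e).
  move=> yy yp2 yd; rewrite (_ : 2 * e = p1 + e - (p1 - e)); last by ring.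
  apply: cinteg_le => // x xx; last by apply: FM => //; exact: ee.
  by move/andP: xx => [ax xb]; apply: cx => //; rewrite (le_trans l1 ax) (le_trans xb l3).
have By x : x0 <= x <= x1 -> x != p1 -> `|x - p1| < d -> normc (cinteg (p2 - e) (p2 + e) (F x)) <= 2 * M * (2 * e).
  move=> xx xp1 xd; rewrite (_ : 2 * e = p2 + e - (p2 - e)); last by ring.
  apply: cinteg_le => // y yy; last by apply: FM => //; exact: ee.
  by move/andP: yy => [ay yb]; apply: cy => //; rewrite (le_trans m1 ay) (le_trans yb m3).
have ni : normc 'i = 1 by rewrite /= expr0n expr1n add0r sqrtr1.
rewrite /contour; apply: le_trans (normc_triangle _ _) _; rewrite normc_mul ni mul1r.
have T (z w : C) k : normc z <= k -> normc w <= k -> normc (z - w) <= k + k.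
  by move=> h1 h2; rewrite (le_trans (normc_triangle _ _))// normc_opp lerD.
rewrite (_ : 16 * M * e = (2 * M * (2 * e) + 2 * M * (2 * e)) + (2 * M * (2 * e) + 2 * M * (2 * e))); last by ring.
apply: lerD; apply: T.
- by apply: Bx; rewrite ?m1 ?(le_trans m2 m3) ?lt_eqF//; apply: ee; rewrite lexx.
- by apply: Bx; rewrite ?m3 ?(le_trans m1 m2) ?gt_eqF//; apply: ee; rewrite lexx m2.
- by apply: By; rewrite ?l3 ?(le_trans l1 l2) ?gt_eqF//; apply: ee; rewrite lexx l2.
- by apply: By; rewrite ?l1 ?(le_trans l2 l3) ?lt_eqF//; apply: ee; rewrite lexx.
Qed.

End Contour.

(** * Rules of complex differentiation *)

Section ComplexDerivatives.
Context {R : realType}.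
Local Open Scope classical_set_scope.
Local Open Scope complex_scope.
Local Open Scope ring_scope.
Local Notation C := R[i].
Local Notation normc := (@ComplexField.Normc.normc R).
Implicit Types (f g : C -> C) (z w c : C).

Lemma cdiff_lipschitz f z c : cdiff f z c -> exists d K, [/\ 0 < d, 0 < K &
  forall h, normc h < d -> normc (f (z + h) - f z) <= K * normc h].
Proof.
move=> H; have [d d0 dP] := H 1 ltr01; exists d, (1 + normc c); split => //.
  by rewrite ltr_pwDl// normc_ge0.
move=> h hd; have -> : f (z + h) - f z = (f (z + h) - f z - c * h) + c * h by rewrite subrK.
by apply: le_trans (normc_triangle _ _) _; rewrite normc_mul mulrDl lerD// dP.
Qed.

(** Absorbs a fixed factor [K] and a fixed neighbourhood, so that the product, inverse and chain
    rules need only bounds up to constants. *)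
Lemma cdiff_of_bound f z c d K : 0 < d -> 0 < K ->
  (forall e, 0 < e -> exists2 d', 0 < d' & forall h, normc h < d' -> normc h < d ->
    normc (f (z + h) - f z - c * h) <= K * e * normc h) -> cdiff f z c.
Proof.
move=> d0 K0 H e e0; have [d' d'0 dP] := H (e / K) (divr_gt0 e0 K0).
exists (Num.min d d') => [|h]; first by rewrite lt_min d0.
by rewrite lt_min => /andP[h1 h2]; have := dP h h2 h1; rewrite mulrCA divff ?gt_eqF// mulr1.
Qed.

Lemma cdiff_subc f z c k : cdiff f z c -> cdiff (fun x => f x - k) z c.
Proof.
move=> H e e0; have [d d0 dP] := H e e0; exists d => // h /dP.
by rewrite (_ : f (z + h) - k - _ = f (z + h) - f z)//; ring.
Qed.

Lemma cdiff_mul f g z a b : cdiff f z a -> cdiff g z b ->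
  cdiff (fun x => f x * g x) z (a * g z + f z * b).
Proof.
move=> fa gb.
have [d1 [K1 [d10 K10 L1]]] := cdiff_lipschitz fa.
have [d2 [K2 [d20 K20 L2]]] := cdiff_lipschitz gb.
pose K := (normc (g z) + K2) + normc a * K2 + normc (f z) + 1.
have K0 : 0 < K by rewrite ltr_wpDl// !addr_ge0 ?mulr_ge0 ?normc_ge0// ltW.
apply: (cdiff_of_bound (d := Num.min d2 1) _ K0); first by rewrite lt_min d20 ltr01.
move=> e e0; have [r1 r10 H1] := fa e e0; have [r2 r20 H2] := gb e e0.
exists (Num.min (Num.min r1 r2) e); first by rewrite !lt_min r10 r20.
move=> h; rewrite !lt_min => /andP[/andP[/H1 h1 /H2 h2] he] /andP[/L2 h3 h4].
rewrite (_ : _ - _ - _ = (f (z + h) - f z - a * h) * (g z + (g (z + h) - g z)) + a * h * (g (z + h) - g z)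
  + f z * (g (z + h) - g z - b * h)); last by ring.
have nh := normc_ge0 h.
have b1 : normc ((f (z + h) - f z - a * h) * (g z + (g (z + h) - g z))) <= e * normc h * (normc (g z) + K2).
  rewrite normc_mul ler_pM ?normc_ge0//; apply: le_trans (normc_triangle _ _) _; rewrite lerD2l.
  by apply: le_trans h3 _; rewrite ler_piMr ?(ltW K20)// ltW.
have b2 : normc (a * h * (g (z + h) - g z)) <= normc a * K2 * e * normc h.
  rewrite !normc_mul (_ : _ * K2 * e * _ = normc a * normc h * (K2 * e)); last by ring.
  rewrite ler_wpM2l ?mulr_ge0 ?normc_ge0//; apply: le_trans h3 _.
  by rewrite ler_wpM2l ?(ltW K20)// ltW.
have b3 : normc (f z * (g (z + h) - g z - b * h)) <= normc (f z) * (e * normc h).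
  by rewrite normc_mul ler_wpM2l ?normc_ge0.
apply: le_trans (normc_triangle _ _) _; apply: le_trans (lerD (normc_triangle _ _) (lexx _)) _.
apply: le_trans (lerD (lerD b1 b2) b3) _.
rewrite (_ : K * e * normc h = e * normc h * (normc (g z) + K2) + normc a * K2 * e * normc h + normc (f z) * (e * normc h) + e * normc h).
  by rewrite lerDl mulr_ge0// ltW.
by rewrite /K; ring.
Qed.

Lemma cdiff_inv f z c : cdiff f z c -> f z != 0 -> cdiff (fun x => (f x)^-1) z (- c / f z ^+ 2).
Proof.
move=> fc fz0; have n0 : 0 < normc (f z) by rewrite normc_gt0.
have [d1 [K1 [d10 K10 L1]]] := cdiff_lipschitz fc.
pose d := Num.min d1 (normc (f z) / (2 * K1)).
have d0 : 0 < d by rewrite lt_min d10 divr_gt0// mulr_gt0.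
pose K := 2 / normc (f z) ^+ 2 + 2 * normc c * K1 / normc (f z) ^+ 3.
have K0 : 0 < K.
  by rewrite ltr_pwDl ?divr_gt0 ?exprn_gt0// !mulr_ge0 ?normc_ge0 ?invr_ge0 ?exprn_ge0 ?(ltW K10)// normc_ge0.
apply: (cdiff_of_bound d0 K0) => e e0; have [r r0 H] := fc e e0.
exists (Num.min r e); first by rewrite lt_min r0.
move=> h; rewrite !lt_min => /andP[/H h1 he] /andP[/L1 h2 h3].
have nh := normc_ge0 h.
have lo : normc (f z) / 2 <= normc (f (z + h)).
  have : K1 * normc h <= normc (f z) / 2.
    rewrite -ler_pdivlMl//; apply: le_trans (ltW h3) _.
    by rewrite le_eqVlt; apply/orP; left; apply/eqP; field; rewrite gt_eqF.
  have := normc_sub_le (f z) (f (z + h)); rewrite normc_sub_sym; lra.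
have fzh : f (z + h) != 0 by rewrite -normc_gt0 (lt_le_trans _ lo)// divr_gt0.
rewrite (_ : _ - _ - _ = - (f (z + h) - f z - c * h) / (f z * f (z + h)) + c * h * (f (z + h) - f z) / (f z ^+ 2 * f (z + h))); last by field; rewrite fzh fz0.
have lo2 : (normc (f (z + h)))^-1 <= 2 / normc (f z).
  by rewrite -[2 / _]invf_div lef_pV2// posrE ?divr_gt0// (lt_le_trans _ lo)// divr_gt0.
have b1 : normc (- (f (z + h) - f z - c * h) / (f z * f (z + h))) <= e * normc h * (2 / normc (f z) ^+ 2).
  rewrite normc_mul normc_opp normc_inv normc_mul ler_pM ?normc_ge0 ?invr_ge0 ?mulr_ge0 ?normc_ge0//.
  by rewrite invfM expr2 [X in _ <= X](_ : _ = (normc (f z))^-1 * (2 / normc (f z))) ?ler_wpM2l ?invr_ge0 ?normc_ge0//; field; rewrite gt_eqF.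
have b2 : normc (c * h * (f (z + h) - f z) / (f z ^+ 2 * f (z + h))) <= normc c * normc h * (K1 * e) * (2 / normc (f z) ^+ 3).
  rewrite normc_mul ler_pM ?normc_ge0//.
    rewrite !normc_mul ler_wpM2l ?mulr_ge0 ?normc_ge0//; apply: le_trans h2 _.
    by rewrite ler_wpM2l ?(ltW K10)// ltW.
  rewrite normc_inv normc_mul normc_exp invfM.
  by rewrite [X in _ <= X](_ : _ = (normc (f z) ^+ 2)^-1 * (2 / normc (f z))) ?ler_wpM2l ?invr_ge0 ?exprn_ge0 ?normc_ge0//; field; rewrite gt_eqF.
apply: le_trans (normc_triangle _ _) _; apply: le_trans (lerD b1 b2) _.
by rewrite /K le_eqVlt; apply/orP; left; apply/eqP; field; rewrite gt_eqF.
Qed.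

Lemma cdiff_comp f g z a b : cdiff g z a -> cdiff f (g z) b -> cdiff (f \o g) z (b * a).
Proof.
move=> ga fb; have [d1 [K1 [d10 K10 L1]]] := cdiff_lipschitz ga.
pose K := K1 + normc b + 1.
have K0 : 0 < K by rewrite ltr_wpDl// addr_ge0 ?normc_ge0// ltW.
apply: (cdiff_of_bound d10 K0) => e e0.
have [r1 r10 H1] := ga e e0; have [r2 r20 H2] := fb e e0.
exists (Num.min r1 (r2 / K1)); first by rewrite lt_min r10 divr_gt0.
move=> h; rewrite !lt_min => /andP[/H1 h1 h2] /L1 h3 /=.
have k : normc (g (z + h) - g z) < r2 by apply: le_lt_trans h3 _; rewrite mulrC -ltr_pdivlMr.
have := H2 _ k; rewrite [g z + _]addrC subrK => h4.
rewrite (_ : _ - _ - _ = (f (g (z + h)) - f (g z) - b * (g (z + h) - g z)) + b * (g (z + h) - g z - a * h)); last by ring.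
have b1 : normc (f (g (z + h)) - f (g z) - b * (g (z + h) - g z)) <= e * (K1 * normc h).
  by apply: le_trans h4 _; rewrite ler_wpM2l// ltW.
have b2 : normc (b * (g (z + h) - g z - a * h)) <= normc b * (e * normc h).
  by rewrite normc_mul ler_wpM2l ?normc_ge0.
apply: le_trans (normc_triangle _ _) _; apply: le_trans (lerD b1 b2) _.
rewrite (_ : K * e * normc h = e * (K1 * normc h) + normc b * (e * normc h) + e * normc h); last by rewrite /K; ring.
by rewrite lerDl mulr_ge0 ?normc_ge0// ltW.
Qed.

(** The earlier bounds require [Re h <= 0]. For [Re h > 0] a factor [ez h], of modulus at most
    [expR 1], is taken out and those bounds are applied to [- h]; 7 is 4 + 3. *)
Lemma ez_sub_sub_le_unit h : normc h <= 1 -> normc (ez h - 1 - h) <= 7 * expR 1 * normc h ^+ 2.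
Proof.
move=> h1; have e1 : 1 <= expR 1 :> R by rewrite -expR0 ler_expR.
have n2 : 0 <= normc h ^+ 2 by rewrite exprn_ge0 ?normc_ge0.
have [h0|h0] := leP (complex.Re h) 0.
  apply: le_trans (ez_sub_sub_le h0) _; rewrite ler_wpM2r//; lra.
have hN : complex.Re (- h) <= 0 by case: (h) h0 => ? ? /=; lra.
have k1 := ez_sub_sub_le hN; have k2 := ez_sub1_le hN; rewrite !normc_opp in k1 k2.
have -> : ez h - 1 - h = - (ez h * (ez (- h) - 1 - (- h))) - h * (ez h * (ez (- h) - 1)).
  by rewrite ezN; field; exact: ez_neq0.
have eh : normc (ez h) <= expR 1.
  rewrite normc_ez ler_expR; apply: le_trans h1; exact: le_trans (ler_norm _) (normc_ge_ReN _).
have b1 : normc (ez h * (ez (- h) - 1 - (- h))) <= expR 1 * (4 * normc h ^+ 2).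
  by rewrite normc_mul ler_pM ?normc_ge0.
have b2 : normc (h * (ez h * (ez (- h) - 1))) <= normc h * (expR 1 * (3 * normc h)).
  by rewrite !normc_mul ler_wpM2l ?normc_ge0// ler_pM ?normc_ge0.
apply: le_trans (normc_triangle _ _) _; rewrite !normc_opp; apply: le_trans (lerD b1 b2) _.
by rewrite le_eqVlt; apply/orP; left; apply/eqP; ring.
Qed.

Lemma cdiff_ez z : cdiff ez z (ez z).
Proof.
pose K := normc (ez z) * (7 * expR 1).
have K0 : 0 < K by rewrite mulr_gt0 ?normc_gt0 ?ez_neq0// mulr_gt0 ?expR_gt0.
apply: (cdiff_of_bound (ltr01) K0) => e e0; exists e => // h he h1.
have -> : ez (z + h) - ez z - ez z * h = ez z * (ez h - 1 - h) by rewrite ezD; ring.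
rewrite normc_mul /K -!mulrA ler_wpM2l ?normc_ge0//.
apply: le_trans (ez_sub_sub_le_unit (ltW h1)) _; rewrite -mulrA ler_pM2l// ler_pM2l ?expR_gt0//.
by rewrite expr2 ler_wpM2r ?normc_ge0// ltW.
Qed.

Lemma cdiff_cxdiff f (x y : R) c : cdiff f (x +i* y) c -> cxdiff (fun s t => f (s +i* t)) x y c.
Proof.
move=> H e e0; have [d d0 dP] := H e e0; exists (d / 2); first by rewrite divr_gt0.
move=> p q pd qd.
have n : normc (p +i* q) <= `|p| + `|q| := normc_le_ReIm _.
have := dP (p +i* q); rewrite (_ : (x +i* y) + (p +i* q) = (x + p) +i* (y + q))// => h.
apply: le_trans (h _) _; first by apply: le_lt_trans n _; lra.
by rewrite ler_wpM2l// ltW.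
Qed.

End ComplexDerivatives.

(** * Integrals of periodic functions and means over circles *)

Section CircleMean.
Context {R : realType}.
Local Open Scope classical_set_scope.
Local Open Scope complex_scope.
Local Open Scope ring_scope.
Local Notation C := R[i].
Local Notation normc := (@ComplexField.Normc.normc R).
Local Notation Re := (@complex.Re R).
Local Notation Im := (@complex.Im R).
Local Notation leb := (@lebesgue_measure R).
Local Notation RT := (measurableTypeR R).

Lemma integ_shift (a b s : R) (f : R -> R) : (forall x, econt f x) ->
  integ a b (fun x => f (x + s)) = integ (a + s) (b + s) f.
Proof.
move=> fc; have cf : continuous f by move=> x; exact: econt_continuous.
have mf : measurable_fun [set: RT] (f : RT -> R) by exact: continuous_measurable_fun.
pose phi := (fun x => x + s) : RT -> RT.
have mphi : measurable_fun [set: RT] phi.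
  by apply: measurable_funD => //; exact: measurable_cst.
have pre : phi @^-1` `[a + s, b + s] = `[a, b]%classic.
  by apply/seteqP; split => x /=; rewrite !in_itv /= !lerD2r.
have fi : leb.-integrable (phi @^-1` `[a + s, b + s]) ((EFin \o f) \o phi).
  rewrite pre; apply: (@econt_integrable _ a b (fun x => f (x + s))) => x _ e e0.
  have [d d0 dP] := fc (x + s) e e0; exists d => // h hd.
  by rewrite addrAC; apply: dP.
rewrite /integ /Rintegral; congr fine.
have mEf : measurable_fun [set: RT] ((EFin \o f) : RT -> \bar R) by exact/measurable_EFinP.
have /= := integral_pushforward mphi mEf fi (measurable_itv _); rewrite pre => <-.
by apply: eq_measure_integral => A mA _; have /= := lebesgue_measure_shift s mA.
Qed.

Lemma integ_period (f : R -> R) (th : R) : (forall x, econt f x) ->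
  (forall x, f (x + 2 * pi) = f x) -> 0 <= th <= 2 * pi ->
  integ (th - pi) (th + pi) f = integ (- pi) pi f.
Proof.
move=> fc fp /andP[th0 th1]; have p0 := pi_ge0 R.
rewrite (@integ_split _ (th - pi) pi)//; [|lra|lra].
rewrite (@integ_split _ (- pi) (th - pi) pi)//; [|lra|lra].
rewrite addrC; congr (_ + _).
rewrite (_ : integ (- pi) (th - pi) f = integ (- pi) (th - pi) (fun x => f (x + 2 * pi))); last first.
  by congr integ; apply/funext => x; rewrite fp.
rewrite integ_shift// (_ : - pi + 2 * pi = pi); last by ring.
by rewrite (_ : th - pi + 2 * pi = th + pi)//; ring.
Qed.

Lemma econtZ f (x k : R) : econt f x -> econt (fun t => k * f t) x.
Proof.
move=> fx e e0; have k0 : 0 < `|k| + 1 by rewrite ltr_wpDl.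
have [d d0 H] := fx (e / (`|k| + 1)) (divr_gt0 e0 k0).
exists d => // h /H q; rewrite -mulrBr normrM.
apply: le_trans (_ : (`|k| + 1) * `|f (x + h) - f x| <= _); first by rewrite ler_wpM2r// lerDl.
by rewrite mulrC -ler_pdivlMr.
Qed.

Lemma integD a b (f g : R -> R) : (forall x, a <= x <= b -> econt f x) ->
  (forall x, a <= x <= b -> econt g x) ->
  integ a b (fun x => f x + g x) = integ a b f + integ a b g.
Proof. by move=> fc gc; rewrite /integ RintegralD//; exact: econt_integrable. Qed.

Lemma integZ a b k (f : R -> R) : (forall x, a <= x <= b -> econt f x) ->
  integ a b (fun x => k * f x) = k * integ a b f.
Proof. by move=> fc; rewrite /integ RintegralZl//; exact: econt_integrable. Qed.

Lemma cintegD a b (f g : R -> C) : (forall x, a <= x <= b -> ccont f x) ->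
  (forall x, a <= x <= b -> ccont g x) ->
  cinteg a b (fun x => f x + g x) = cinteg a b f + cinteg a b g.
Proof.
move=> fc gc; apply/eqP; rewrite eq_complex /=; apply/andP; split; apply/eqP.
  rewrite -integD; [|by move=> x /fc/ccont_econt[]|by move=> x /gc/ccont_econt[]].
  by congr integ; apply/funext => x /=; case: (f x) (g x) => ? ? [].
rewrite -integD; [|by move=> x /fc/ccont_econt[]|by move=> x /gc/ccont_econt[]].
by congr integ; apply/funext => x /=; case: (f x) (g x) => ? ? [].
Qed.

Lemma cintegZ a b (k : C) (f : R -> C) : (forall x, a <= x <= b -> ccont f x) ->
  cinteg a b (fun x => k * f x) = k * cinteg a b f.
Proof.
move=> fc; case: k => k1 k2; apply/eqP; rewrite eq_complex /=.
have f1 : forall x, a <= x <= b -> econt (Re \o f) x by move=> x /fc/ccont_econt[].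
have f2 : forall x, a <= x <= b -> econt (Im \o f) x by move=> x /fc/ccont_econt[].
apply/andP; split; apply/eqP.
  rewrite -!integZ// -integB; [|by move=> x /f1/econtZ|by move=> x /f2/econtZ].
  by congr integ; apply/funext => x /=; case: (f x).
rewrite -!integZ// -integD; [|by move=> x /f2/econtZ|by move=> x /f1/econtZ].
by congr integ; apply/funext => x /=; case: (f x).
Qed.

Lemma ccontD f g (x : R) : ccont f x -> ccont g x -> ccont (fun t => f t + g t) x.
Proof.
move=> fx gx e e0; have e2 : 0 < e / 2 by rewrite divr_gt0.
have [d1 d10 H1] := fx _ e2; have [d2 d20 H2] := gx _ e2.
exists (Num.min d1 d2) => [|h]; first by rewrite lt_min d10.
rewrite lt_min => /andP[/H1 q1 /H2 q2].
rewrite (_ : _ - _ = (f (x + h) - f x) + (g (x + h) - g x)); last by ring.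
by rewrite (le_trans (normc_triangle _ _))// [leRHS]splitr lerD.
Qed.

Lemma ccontZ f (x : R) (k : C) : ccont f x -> ccont (fun t => k * f t) x.
Proof.
move=> fx e e0; have k0 : 0 < normc k + 1 by rewrite ltr_wpDl// normc_ge0.
have [d d0 H] := fx (e / (normc k + 1)) (divr_gt0 e0 k0).
exists d => // h /H q; rewrite -mulrBr normc_mul.
apply: le_trans (_ : (normc k + 1) * normc (f (x + h) - f x) <= _).
  by rewrite ler_wpM2r ?normc_ge0// lerDl.
by rewrite mulrC -ler_pdivlMr.
Qed.

Lemma ccont_cst (k : C) (x : R) : ccont (fun=> k) x.
Proof. by move=> e e0; exists 1 => // h _; rewrite subrr normc0 ltW. Qed.

Definition cmean (f : R -> C) : C := ((2 * pi)^-1)%:C * cinteg (- pi) pi f.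

Let pi2 : 0 < 2 * pi :> R. Proof. by rewrite mulr_gt0// pi_gt0. Qed.
Let pipi : - pi <= pi :> R. Proof. by have := pi_ge0 R; lra. Qed.

Lemma cmean_eq f g : (forall x, f x = g x) -> cmean f = cmean g.
Proof. by move=> fg; congr cmean; exact/funext. Qed.

Lemma cmeanD f g : (forall x, ccont f x) -> (forall x, ccont g x) ->
  cmean (fun x => f x + g x) = cmean f + cmean g.
Proof. by move=> fc gc; rewrite /cmean cintegD// mulrDr. Qed.

Lemma cmeanZ k f : (forall x, ccont f x) -> cmean (fun x => k * f x) = k * cmean f.
Proof. by move=> fc; rewrite /cmean cintegZ// mulrCA. Qed.

Lemma cmean_cst k : cmean (fun=> k) = k.
Proof.
rewrite -[LHS]/(cmean (fun=> k)) /cmean /cinteg /comp !integ_cst//.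
have E x : (2 * pi)^-1 * (x * (pi - - pi)) = x :> R.
  by rewrite opprK -mulr2n mulr_natl mulrCA mulVf ?mulr1// -mulr_natl gt_eqF.
by case: k => k1 k2; apply/eqP; rewrite eq_complex /= !E !mul0r subr0 addr0 !eqxx.
Qed.

Lemma cmean_sum (f : nat -> R -> C) N : (forall n x, ccont (f n) x) ->
  (forall x, ccont (fun t => \sum_(n < N) f n t) x) /\
  cmean (fun x => \sum_(n < N) f n x) = \sum_(n < N) cmean (f n).
Proof.
move=> fc; elim: N => [|N [c1 IH]].
  have -> : (fun t => \sum_(n < 0) f n t) = (fun=> 0) by apply/funext => t; rewrite big_ord0.
  by rewrite cmean_cst big_ord0; split => // x; exact: ccont_cst.
have -> : (fun t => \sum_(n < N.+1) f n t) = (fun t => \sum_(n < N) f n t + f N t).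
  by apply/funext => t; rewrite big_ord_recr.
split; first by move=> x; exact: ccontD.
by rewrite cmeanD// IH [RHS]big_ord_recr.
Qed.

Lemma cmean_le f M : (forall x, ccont f x) -> (forall x, - pi <= x <= pi -> normc (f x) <= M) ->
  normc (cmean f) <= 2 * M.
Proof.
move=> fc fM; rewrite normc_mul normc_real ger0_norm ?invr_ge0 ?(ltW pi2)//.
rewrite mulrC ler_pdivrMr//; apply: le_trans (cinteg_le pipi (fun x _ => fc x) fM) _.
by rewrite le_eqVlt; apply/orP; left; apply/eqP; ring.
Qed.

(** Allows the window of integration to be centred at the angle of a given point, so that this point
    falls in the interior of the rectangle used later. *)
Lemma cmean_period f th : (forall x, ccont f x) -> (forall x, f (x + 2 * pi) = f x) ->
  0 <= th <= 2 * pi -> cmean f = ((2 * pi)^-1)%:C * cinteg (th - pi) (th + pi) f.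
Proof.
move=> fc fp hth; rewrite /cmean /cinteg; congr (_ * _).
by rewrite !integ_period// => x; rewrite /= ?fp//; have [] := ccont_econt (fc x).
Qed.

Lemma cmean_shift f s : (forall x, ccont f x) -> (forall x, f (x + 2 * pi) = f x) ->
  0 <= s <= 2 * pi -> cmean (fun x => f (x + s)) = cmean f.
Proof.
move=> fc fp hs; rewrite (cmean_period fc fp hs) /cmean /cinteg; congr (_ * _).
have f1 x : econt (Re \o f) x by have [] := ccont_econt (fc x).
have f2 x : econt (Im \o f) x by have [] := ccont_econt (fc x).
rewrite (addrC s) (addrC s pi).
by rewrite -(integ_shift (- pi) pi s f1) -(integ_shift (- pi) pi s f2).
Qed.

End CircleMean.

(** * Cauchy's formula in logarithmic coordinates *)

Section CauchyFormula.
Context {R : realType}.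
Local Open Scope classical_set_scope.
Local Open Scope complex_scope.
Local Open Scope ring_scope.
Local Notation C := R[i].
Local Notation normc := (@ComplexField.Normc.normc R).
Local Notation Re := (@complex.Re R).
Implicit Types (f G : C -> C) (z w : C) (u v r t : R).

Lemma cdiff_ccont_vert G u v c : cdiff G (u +i* v) c -> ccont (fun v => G (u +i* v)) v.
Proof. by move=> /cdiff_cxdiff/cxdiff_ccont[]. Qed.

(** Periodicity makes the horizontal sides cancel, so only the two vertical ones remain. *)
Lemma contour0_vert (F : R -> R -> C) x0 x1 y0 y1 : contour F x0 x1 y0 y1 = 0 ->
  (forall x, F x y0 = F x y1) -> cinteg y0 y1 (F x1) = cinteg y0 y1 (F x0).
Proof.
rewrite /contour => + per; have -> : F ^~ y0 = F ^~ y1 by apply/funext => x; exact: per.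
rewrite subrr add0r => /eqP; rewrite mulf_eq0 => /orP[|/eqP/subr0_eq//].
by rewrite eq_complex /= oner_eq0 andbF.
Qed.

Definition period2pi G := forall z, G (z + (0 +i* (2 * pi))) = G z.

Lemma period2pi_vert G u v : period2pi G -> G (u +i* (v + 2 * pi)) = G (u +i* v).
Proof. by move=> pG; rewrite -(pG (u +i* v)); congr G; apply/eqP; rewrite eq_complex /= addr0 !eqxx. Qed.

Lemma cmean_annulus G u0 u1 : u0 <= u1 -> period2pi G ->
  (forall z, u0 <= Re z <= u1 -> exists c, cdiff G z c) ->
  cmean (fun v => G (u1 +i* v)) = cmean (fun v => G (u0 +i* v)).
Proof.
move=> u01 pG dG; have p0 := pi_ge0 R; rewrite /cmean; congr (_ * _).
apply: (@contour0_vert (fun x y => G (x +i* y)) u0 u1).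
  by apply: goursat => // [|x y xx yy]; [lra|by have [c /cdiff_cxdiff] := dG (x +i* y) xx; exists c].
by move=> x; rewrite -(period2pi_vert x (- pi) pG); congr (G (_ +i* _)); ring.
Qed.

(** The moduli give [u = p]. The quotient of the two values is 1, so [cos (v - th) = 1], and [cos]
    is injective on [[0, pi]], where [|v - th|] lies. *)
Lemma ez_inj_strip (u v p th : R) : ez (u +i* v) = ez (p +i* th) -> th - pi <= v <= th + pi ->
  u = p /\ v = th.
Proof.
move=> E /andP[v0 v1]; have up : u = p.
  by have := congr1 normc E; rewrite !normc_ez => /expR_inj.
split => //; subst p.
have : ez (0 +i* (v - th)) = 1.
  have -> : 0 +i* (v - th) = (u +i* v) - (u +i* th).
    by apply/eqP; rewrite eq_complex /= subrr !eqxx.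
  by rewrite ezD ezN E divff// ez_neq0.
move=> /(congr1 Re); rewrite /ez /= expR0 mul1r => c1.
have n : `|v - th| \in `[0, pi] by rewrite in_itv /= normr_ge0 /= ler_norml; apply/andP; split; lra.
have : acos (cos `|v - th|) = 0.
  have -> : cos `|v - th| = cos (v - th) by case: (ger0P (v - th)) => _; rewrite ?cosN.
  by rewrite c1 acos1.
by rewrite cosK// => /eqP; rewrite normr_eq0 subr_eq0 => /eqP.
Qed.

(** With [zeta = ez z] one has [d zeta = i zeta dv] on a circle, so the mean of this function over a
    vertical period is the Cauchy integral of [(f zeta - f w) / (zeta - w)]. At [zeta = w] its value
    is 0. *)
Definition cauchy_kernel f w z : C := ez z * (f (ez z) - f w) / (ez z - w).

Lemma cauchy_kernel_cdiff f w z b : cdiff f (ez z) b -> ez z != w ->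
  exists c, cdiff (cauchy_kernel f w) z c.
Proof.
move=> fb zw; eexists; apply: cdiff_mul.
  by apply: cdiff_mul; [exact: cdiff_ez|apply: cdiff_subc; exact: (cdiff_comp (cdiff_ez z) fb)].
by apply: (cdiff_inv (f := fun z => ez z - w)); [apply: cdiff_subc; exact: cdiff_ez|rewrite subr_eq0].
Qed.

Lemma cauchy_kernel_near0 f w b : cdiff f 0 b -> exists d K, 0 < d /\
  forall z, normc (ez z) < d -> ez z != w /\ normc (cauchy_kernel f w z) <= K * normc (ez z).
Proof.
move=> fb; have [d1 [K1 [d10 K10 L]]] := cdiff_lipschitz fb.
have [->|w0] := eqVneq w 0.
  exists d1, K1; split => // z zd; split; first exact: ez_neq0.
  rewrite /cauchy_kernel subr0 mulrAC divff ?ez_neq0// mul1r.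
  by have := L _ zd; rewrite add0r.
have nw : 0 < normc w by rewrite normc_gt0.
exists (Num.min d1 (normc w / 2)), ((K1 * d1 + normc (f 0) + normc (f w)) * (2 / normc w)).
split; first by rewrite lt_min d10 divr_gt0.
move=> z; rewrite lt_min => /andP[/[dup] zd /L]; rewrite add0r => h1 h2.
have h3 : normc w / 2 <= normc (ez z - w).
  by rewrite normc_sub_sym; have := normc_sub_le w (ez z); lra.
have zw : ez z != w by rewrite -subr_eq0 -normc_gt0 (lt_le_trans _ h3)// divr_gt0.
split => //; rewrite /cauchy_kernel !normc_mul normc_inv mulrC [leRHS]mulrC mulrCA ler_wpM2l ?normc_ge0// mulrC.
rewrite ler_pM ?normc_ge0 ?invr_ge0 ?normc_ge0//.
  rewrite (_ : f (ez z) - f w = (f (ez z) - f 0) + f 0 - f w); last by ring.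
  apply: le_trans (normc_triangle _ _) _; rewrite normc_opp lerD2r.
  apply: le_trans (normc_triangle _ _) _; rewrite lerD2r (le_trans h1)//.
  by rewrite ler_wpM2l ?ltW.
by rewrite -[2 / _]invf_div lef_pV2// posrE ?divr_gt0// (lt_le_trans _ h3)// divr_gt0.
Qed.

Lemma cauchy_kernel_period f w : period2pi (cauchy_kernel f w).
Proof. by move=> z; rewrite /cauchy_kernel ez_2pi. Qed.

(** The mean over radius [r] equals the mean over an arbitrarily small radius [e], which tends to 0.
    The rectangle between [ln e] and [ln r], one period high and centred at the angle of [w],
    contains at most one preimage of [w]; the kernel is bounded near it, so [goursat_exceptional]
    applies. *)
Lemma cauchy_kernel_mean0 f w r : (forall z, normc z < 1 -> exists c, cdiff f z c) ->
  normc w < r -> r < 1 -> cmean (fun v => cauchy_kernel f w (ln r +i* v)) = 0.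
Proof.
move=> hf wr r1; have r0 : 0 < r by rewrite (le_lt_trans _ wr)// normc_ge0.
have p0 := pi_gt0 R.
have nez u v : normc (ez (u +i* v)) = expR u by rewrite normc_ez.
have u1 : ln r < 0 by rewrite ln_lt0// r0.
have dK z : Re z < 0 -> ez z != w -> exists c, cdiff (cauchy_kernel f w) z c.
  move=> z0 zw; have [|b fb] := hf (ez z); first by rewrite normc_ez expR_lt1.
  exact: cauchy_kernel_cdiff fb zw.
have cK u : u < 0 -> (forall v, ez (u +i* v) != w) -> forall v, ccont (fun v => cauchy_kernel f w (u +i* v)) v.
  by move=> u0 uw v; have [c] := dK (u +i* v) u0 (uw v); exact: cdiff_ccont_vert.
have rw v : ez (ln r +i* v) != w.
  by apply/eqP => E; move: wr; rewrite -E nez lnK ?posrE// ltxx.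
have [b0 fb0] : exists b, cdiff f 0 b by apply: hf; rewrite normc0.
have [d [K [d0 HK]]] := cauchy_kernel_near0 w fb0.
have [p [th [pr th02 E loc]]] : exists p th, [/\ p < ln r, 0 <= th < 2 * pi,
    (forall u v, th - pi <= v <= th + pi -> ~ (u = p /\ v = th) -> ez (u +i* v) != w) &
    (exists d M, 0 < d /\ forall s t, `|s - p| < d -> `|t - th| < d -> normc (cauchy_kernel f w (s +i* t)) <= M)].
  have [w0|w0] := eqVneq w 0.
    (* For [w = 0] there is no exceptional point, and any interior point can take its place. *)
    exists (ln r - 1), pi; split; [lra|by apply/andP; split; lra| |].
      by move=> u v _ _; rewrite w0 ez_neq0.
    have [||c /cdiff_cxdiff/cxdiff_bounded//] := dK ((ln r - 1) +i* pi); first by rewrite /=; lra.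
    by rewrite w0 ez_neq0.
  have [th th02 wE] := polar_form w0.
  exists (ln (normc w)), th; split => //.
  - by rewrite ltr_ln ?posrE ?normc_gt0.
  - by move=> u v hv huv; apply/eqP; rewrite wE => /ez_inj_strip -/(_ hv).
  have [b fb] := hf w (lt_trans wr r1).
  have [d1 [K1 [d10 K10 L1]]] := cdiff_lipschitz fb.
  have [d2 [K2 [d20 K20 L2]]] := cdiff_lipschitz (cdiff_ez (ln (normc w) +i* th)).
  exists (Num.min (d2 / 2) (d1 / (2 * K2))), ((normc w + d1) * K1).
  split; first by rewrite lt_min !divr_gt0// mulr_gt0.
  move=> s t; rewrite !lt_min => /andP[s1 s2] /andP[t1 t2].
  set h := (s - ln (normc w)) +i* (t - th).
  have nh : normc h <= `|s - ln (normc w)| + `|t - th| := normc_le_ReIm _.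
  have hz : (ln (normc w) +i* th) + h = s +i* t.
    by apply/eqP; rewrite eq_complex /= [ln _ + _]addrC [th + _]addrC !subrK !eqxx.
  have hd : normc h < d2 by apply: le_lt_trans nh _; lra.
  have := L2 h hd; rewrite hz -wE => k1.
  have k2 : normc (ez (s +i* t) - w) < d1.
    apply: le_lt_trans k1 _; rewrite mulrC -ltr_pdivlMr//; apply: le_lt_trans nh _.
    by rewrite (_ : d1 / K2 = d1 / (2 * K2) + d1 / (2 * K2)) ?ltrD//; field; rewrite gt_eqF.
  have := L1 _ k2; rewrite [w + _]addrC subrK => k3.
  rewrite /cauchy_kernel -mulrA normc_mul ler_pM ?normc_ge0//.
    rewrite -[ez _](subrK w) addrC (le_trans (normc_triangle _ _))// lerD2l ltW//.
  have [->|zw] := eqVneq (ez (s +i* t)) w; first by rewrite !subrr mul0r normc0 ltW.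
  by rewrite normc_mul normc_inv ler_pdivrMr// normc_gt0 subr_eq0.
apply: (@eq0_small _ _ (2 * K) (Num.min d (expR p))); first by rewrite lt_min d0 expR_gt0.
move=> e e0; rewrite lt_min => /andP[ed ep].
have nle v : normc (ez (ln e +i* v)) = e by rewrite nez lnK ?posrE.
have ep' : ln e < p by rewrite -ltr_expR lnK ?posrE.
have e00 : ln e < 0 by apply: lt_trans u1; apply: lt_trans pr.
have ew v : ez (ln e +i* v) != w by have [] := HK (ln e +i* v); rewrite ?nle.
have th2 : 0 <= th <= 2 * pi by case/andP: th02 => -> /ltW.
suff -> : cmean (fun v => cauchy_kernel f w (ln r +i* v)) = cmean (fun v => cauchy_kernel f w (ln e +i* v)).
  rewrite -mulrA; apply: cmean_le => [|v _]; first exact: cK.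
  by have := HK (ln e +i* v); rewrite nle => /(_ ed)[_].
rewrite (cmean_period (cK _ u1 rw) _ th2); last by move=> v; rewrite period2pi_vert//; exact: cauchy_kernel_period.
rewrite (cmean_period (cK _ e00 ew) _ th2); last by move=> v; rewrite period2pi_vert//; exact: cauchy_kernel_period.
apply: (congr1 ( *%R _)).
apply: (@contour0_vert (fun x y => cauchy_kernel f w (x +i* y)) (ln e) (ln r)); last first.
  move=> x; rewrite (_ : th + pi = th - pi + 2 * pi); last by ring.
  by rewrite period2pi_vert//; exact: cauchy_kernel_period.
apply: (@goursat_exceptional _ _ (ln e) (ln r) (th - pi) (th + pi) p th) => //.
- by rewrite ep'.
- by apply/andP; split; lra.
move=> x y /andP[xe xr] yy ne; have [||c /cdiff_cxdiff H] := dK (x +i* y); [exact: le_lt_trans u1|exact: E|].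
by exists c.
Qed.

End CauchyFormula.

(** * Power series expansion of holomorphic functions *)

Section PowerSeries.
Context {R : realType}.
Local Open Scope classical_set_scope.
Local Open Scope complex_scope.
Local Open Scope ring_scope.
Local Notation C := R[i].
Local Notation normc := (@ComplexField.Normc.normc R).
Local Notation Re := (@complex.Re R).
Implicit Types (f : C -> C) (z w : C) (u v r t : R).

Lemma exists_expr_lt (q e : R) : 0 <= q < 1 -> 0 < e -> exists N, q ^+ N.+1 < e.
Proof.
move=> /andP[q0 q1] e0.
have nq : `|q| < 1 by rewrite ger0_norm.
have /cvgrPdist_lt Hq := cvg_expr nq; have [N _ HN] := Hq e e0.
exists N; have := HN N.+1 (leqnSn N); rewrite /= sub0r normrN ger0_norm// exprn_ge0//.
Qed.

Lemma ccontM (f g : R -> C) x : ccont f x -> ccont g x -> ccont (fun t => f t * g t) x.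
Proof.
move=> fx gx e e0.
have [d1 d10 H1] := fx 1 ltr01.
pose K := normc (f x) + 1 + normc (g x) + 1.
have K0 : 0 < K by rewrite ltr_wpDl// !addr_ge0 ?normc_ge0.
have [d2 d20 H2] := fx (e / K) (divr_gt0 e0 K0); have [d3 d30 H3] := gx (e / K) (divr_gt0 e0 K0).
exists (Num.min d1 (Num.min d2 d3)) => [|h]; first by rewrite !lt_min d10 d20.
rewrite !lt_min => /and3P[/H1 h1 /H2 h2 /H3 h3].
rewrite (_ : _ - _ = f (x + h) * (g (x + h) - g x) + (f (x + h) - f x) * g x); last by ring.
apply: le_trans (normc_triangle _ _) _; rewrite !normc_mul.
have nf : normc (f (x + h)) <= normc (f x) + 1.
  by rewrite -[f (x + h)](subrK (f x)) addrC (le_trans (normc_triangle _ _))// lerD2l.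
have b1 : normc (f (x + h)) * normc (g (x + h) - g x) <= (normc (f x) + 1) * (e / K).
  by rewrite ler_pM ?normc_ge0.
have b2 : normc (f (x + h) - f x) * normc (g x) <= (e / K) * normc (g x).
  by rewrite ler_wpM2r ?normc_ge0.
apply: le_trans (lerD b1 b2) _; rewrite [_ * normc (g x)]mulrC -mulrDl mulrCA ger_pMr//.
by rewrite ler_pdivrMr// mul1r /K -addrA addrA lerDl.
Qed.

Lemma ccontX (f : R -> C) x n : ccont f x -> ccont (fun t => f t ^+ n) x.
Proof.
move=> fx; elim: n => [|n IH]; first exact: ccont_cst.
by have := ccontM fx IH; congr ccont; apply/funext => t; rewrite exprS.
Qed.

Lemma cdiff_exp f z c n : cdiff f z c -> exists c', cdiff (fun x => f x ^+ n) z c'.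
Proof.
move=> fc; elim: n => [|n [c' IH]].
  exists 0 => e e0; exists 1 => // h _.
  by rewrite !expr0 subrr mul0r subr0 normc0 mulr_ge0 ?normc_ge0// ltW.
by eexists; have := cdiff_mul fc IH; rewrite (_ : (fun x => f x * f x ^+ n) = (fun x => f x ^+ n.+1)) ; [exact|apply/funext => x; rewrite exprS].
Qed.

Let zc r v : C := ez (ln r +i* v).

Let zc_norm r v : 0 < r -> normc (zc r v) = r.
Proof. by move=> r0; rewrite /zc normc_ez lnK. Qed.

Let zc_neq0 r v : zc r v != 0. Proof. exact: ez_neq0. Qed.

Let zc_cont r v : ccont (zc r) v.
Proof. exact: cdiff_ccont_vert (cdiff_ez _). Qed.

Let zcV_cont r v : ccont (fun v => (zc r v)^-1) v.
Proof. exact: (cdiff_ccont_vert (G := fun z => (ez z)^-1) (cdiff_inv (cdiff_ez _) (ez_neq0 _))). Qed.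

Let zcw_cont r v w : normc w < r -> ccont (fun v => (zc r v - w)^-1) v.
Proof.
move=> wr; have r0 : 0 < r by rewrite (le_lt_trans _ wr)// normc_ge0.
apply: (cdiff_ccont_vert (G := fun z => (ez z - w)^-1) (cdiff_inv (f := fun z => ez z - w) (@cdiff_subc _ ez _ _ w (cdiff_ez _)) _)).
by rewrite subr_eq0; apply: contraTneq wr => <-; rewrite zc_norm// ltxx.
Qed.

(** For a positive exponent, a shift of the angle by [pi] divided by the exponent changes the sign
    of the integrand but not its mean. *)
Lemma cmean_negative_power r n : 0 < r -> cmean (fun v => (zc r v)^-1 ^+ n) = (n == 0%N)%:R.
Proof.
move=> r0; case: n => [|n]; first by rewrite -[RHS](cmean_cst 1); apply: cmean_eq => v.
have p0 := pi_gt0 R.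
set F := fun v => _; have cF v : ccont F v by apply: ccontX; exact: zcV_cont.
have n1 : 1 <= n.+1%:R :> R by rewrite ler1n.
have hs : 0 <= (pi : R) / n.+1%:R <= 2 * pi.
  rewrite divr_ge0 ?(ltW p0)//= ler_pdivrMr ?(lt_le_trans ltr01)//.
  by rewrite -mulrA mulr_natl; have : pi <= pi * n.+1%:R :> R; [rewrite ler_pMr// |lra].
have pF v : F (v + 2 * pi) = F v.
  rewrite /F /zc; congr (_^-1 ^+ _); rewrite -(ez_2pi (ln r +i* v)); congr ez.
  by apply/eqP; rewrite eq_complex /= addr0 !eqxx.
have FN v : F (v + pi / n.+1%:R) = -1 * F v.
  rewrite /F /zc -!exprVn -!ezN !ezX || rewrite /F /zc -!ezN !ezX.
  have -> : n.+1%:R * - (ln r +i* (v + pi / n.+1%:R)) = n.+1%:R * - (ln r +i* v) + - (0 +i* pi).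
    rewrite (_ : ln r +i* (v + pi / n.+1%:R) = (ln r +i* v) + (0 +i* (pi / n.+1%:R))); last first.
      by apply/eqP; rewrite eq_complex /= addr0 !eqxx.
    rewrite opprD mulrDr; congr (_ + _); rewrite mulrN; congr (- _).
    rewrite (_ : n.+1%:R = (n.+1%:R : R)%:C); last by rewrite rmorph_nat.
    by apply/eqP; rewrite eq_complex /= !mul0r !mulr0 subr0 addr0 eqxx /= mulrC divfK ?eqxx// gt_eqF// (lt_le_trans ltr01).
  rewrite ezD mulrC; congr (_ * _); rewrite /ez /= oppr0 expR0 cosN sinN cospi sinpi.
  by apply/eqP; rewrite eq_complex /= !mul1r oppr0 !eqxx.
have E := cmean_shift cF pF hs.
have : cmean F = - cmean F by rewrite -[LHS]E (cmean_eq FN) cmeanZ// mulN1r.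
move=> H; apply/eqP; have : cmean F *+ 2 == 0 by rewrite mulr2n {1}H addrC subrr.
by rewrite mulrn_eq0.
Qed.

(** [zc / (zc - w)] is the sum of [(w / zc)^n] over [n < N] plus [(w / zc)^N zc / (zc - w)]. On the
    circle [|w / zc| <= t / r] and [|zc / (zc - w)| <= r / (r - t)]. *)
Lemma cauchy_geometric (g : R -> C) (M : R) r t w N : 0 < t -> t < r -> normc w <= t ->
  (forall v, ccont g v) -> (forall v, - pi <= v <= pi -> normc (g v) <= M) ->
  normc (cmean (fun v => g v * (zc r v * (zc r v - w)^-1)) -
    \sum_(n < N) cmean (fun v => g v * (zc r v)^-1 ^+ n) * w ^+ n) <= 2 * (M * (r / (r - t))) * (t / r) ^+ N.
Proof.
move=> t0 tr wt gc gM; have r0 := lt_trans t0 tr; have wr := le_lt_trans wt tr.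
have zw v : zc r v - w != 0.
  by rewrite subr_eq0; apply: contraTneq wr => <-; rewrite zc_norm// ltxx.
have c1 v : ccont (fun v => zc r v * (zc r v - w)^-1) v by apply: ccontM; [exact: zc_cont|exact: zcw_cont].
have cn n v : ccont (fun v => g v * (zc r v)^-1 ^+ n) v by apply: ccontM => //; apply: ccontX; exact: zcV_cont.
pose E v := w ^+ N * (g v * (zc r v)^-1 ^+ N * (zc r v * (zc r v - w)^-1)).
have cE v : ccont E v by apply: ccontZ; apply: ccontM.
have [cs Es] := cmean_sum N (fun n v => ccontZ (w ^+ n) (cn n v)).
have -> : cmean (fun v => g v * (zc r v * (zc r v - w)^-1)) =
    cmean (fun v => \sum_(n < N) w ^+ n * (g v * (zc r v)^-1 ^+ n) + E v).
  apply: cmean_eq => v; rewrite /E.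
  have -> : \sum_(n < N) w ^+ n * (g v * (zc r v)^-1 ^+ n) = g v * \sum_(n < N) (w / zc r v) ^+ n.
    by rewrite mulr_sumr; apply: eq_bigr => n _; rewrite exprMn; ring.
  have q1 : w / zc r v != 1.
    by apply: contraTneq (zw v) => q; rewrite negbK subr_eq0 eq_sym -[zc r v]mul1r -q divfK.
  have gs : \sum_(n < N) (w / zc r v) ^+ n = ((w / zc r v) ^+ N - 1) / (w / zc r v - 1).
    by rewrite subrX1 mulrAC divff ?mul1r ?subr_eq0.
  rewrite gs (_ : w ^+ N * (g v * (zc r v)^-1 ^+ N * (zc r v * (zc r v - w)^-1)) = (w / zc r v) ^+ N * (g v * (zc r v * (zc r v - w)^-1))); last by rewrite exprMn; ring.
  have -> : w / zc r v - 1 = - ((zc r v - w) / zc r v) by field; exact: zc_neq0.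
  by field; rewrite zc_neq0 -subr_eq0 zw || rewrite zc_neq0 zw.
rewrite cmeanD// Es (eq_bigr (fun n : 'I_N => cmean (fun v => g v * (zc r v)^-1 ^+ n) * w ^+ n)); last first.
  by move=> n _; rewrite cmeanZ// mulrC.
rewrite addrAC subrr add0r -mulrA; apply: cmean_le => // v hv; rewrite /E !normc_mul !normc_exp !normc_inv zc_norm//.
have h1 : normc w ^+ N <= t ^+ N by rewrite lerXn2r ?nnegrE ?normc_ge0 ?(ltW t0).
have h2 : (normc (zc r v - w))^-1 <= (r - t)^-1.
  rewrite lef_pV2 ?posrE ?subr_gt0 ?normc_gt0//; have := normc_sub_le (zc r v) w; rewrite zc_norm//; lra.
rewrite (_ : M * (r / (r - t)) * (t / r) ^+ N = t ^+ N * (M * r^-1 ^+ N * (r * (r - t)^-1))); last by rewrite exprMn; ring.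
have rV : 0 <= r^-1 ^+ N by rewrite exprn_ge0 ?invr_ge0 ?(ltW r0).
rewrite ler_pM ?exprn_ge0 ?normc_ge0 ?mulr_ge0 ?invr_ge0 ?normc_ge0 ?(ltW r0)//.
rewrite ler_pM ?mulr_ge0 ?invr_ge0 ?normc_ge0 ?(ltW r0)//; first by rewrite ler_wpM2r// gM.
by rewrite ler_wpM2l ?(ltW r0).
Qed.

(** One pair [K], [q] for each closed disk of radius [t] encodes both the decay of the coefficients
    and the uniform convergence, using finite sums only. *)
Definition series_expansion f (a : nat -> C) := forall t, 0 < t < 1 -> exists K q,
  [/\ 0 < K, 0 < q < 1, (forall n, normc (a n) * t ^+ n <= K * q ^+ n) &
    forall w N, normc w <= t -> normc (f w - \sum_(n < N.+1) a n * w ^+ n) <= K * q ^+ N.+1].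

(** The coefficients are means over the circle of radius 1/2; by [cmean_annulus] any other radius
    gives the same values. Cauchy's formula writes [f w] as the mean of [f zc] times
    [zc / (zc - w)], and [cauchy_geometric] expands that factor. *)
Theorem power_series_expansion f : (forall z, normc z < 1 -> exists c, cdiff f z c) ->
  exists a, series_expansion f a.
Proof.
move=> hf.
have cfz r v : 0 < r < 1 -> ccont (fun v => f (zc r v)) v.
  move=> /andP[r0 r1]; have [|c fc] := hf (zc r v); first by rewrite zc_norm.
  exact: (cdiff_ccont_vert (G := fun z => f (ez z)) (cdiff_comp (cdiff_ez _) fc)).
pose al r n := cmean (fun v => f (zc r v) * (zc r v)^-1 ^+ n).
have alE n r s : 0 < r -> r <= s -> s < 1 -> al s n = al r n.
  move=> r0 rs s1; have s0 := lt_le_trans r0 rs.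
  apply: (@cmean_annulus _ (fun z => f (ez z) * (ez z)^-1 ^+ n)); first by rewrite ler_ln.
    by move=> z; rewrite ez_2pi.
  move=> z /andP[_ zs]; have [|c fc] := hf (ez z).
    by rewrite normc_ez (le_lt_trans _ s1)// -[leRHS](lnK s0) ler_expR.
  have [c' Hc'] := cdiff_exp n (cdiff_inv (cdiff_ez z) (ez_neq0 z)).
  by eexists; apply: cdiff_mul Hc'; exact: (cdiff_comp (cdiff_ez z) fc).
have h12 : (0 : R) < 2^-1 by rewrite invr_gt0.
exists (al 2^-1) => t /andP[t0 t1].
(* A radius strictly between [t] and 1 that is at least 1/2, as [alE] requires. *)
pose r := Num.max ((1 + t) / 2) 2^-1.
have tr : t < r by rewrite lt_max; apply/orP; left; lra.
have r1 : r < 1 by rewrite gt_max; apply/andP; split; lra.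
have r0 := lt_trans t0 tr.
have r01 : 0 < r < 1 by rewrite r0.
have {}alE n : al 2^-1 n = al r n by rewrite -(alE n 2^-1 r)// le_max lexx orbT.
have pp : - pi <= pi :> R by have := pi_ge0 R; lra.
have cn : {within `[- pi, pi], continuous (fun v => normc (f (zc r v)))}.
  apply: continuous_in_subspaceT => v _; apply: econt_continuous => e e0.
  have [d d0 dP] := cfz r v r01 e e0; exists d => // h /dP; apply: le_trans.
  rewrite ler_norml normc_sub_le andbT lerNl opprB normc_sub_sym; exact: normc_sub_le.
have [v0 _ Mv] := EVT_max pp cn.
pose M := normc (f (zc r v0)) + 1.
have M0 : 0 < M by rewrite ltr_wpDl// normc_ge0.
have fM v : - pi <= v <= pi -> normc (f (zc r v)) <= M.
  by move=> hv; rewrite (le_trans (Mv v _)) ?lerDl// in_itv.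
have rt : 1 <= r / (r - t) by rewrite ler_pdivlMr ?subr_gt0// mul1r gerBl ltW.
have rtp : 0 < r / (r - t) by rewrite (lt_le_trans ltr01).
have q01 : 0 < t / r < 1 by rewrite divr_gt0//= ltr_pdivrMr// mul1r.
exists (2 * (M * (r / (r - t)))), (t / r); split => //.
- by rewrite mulr_gt0// mulr_gt0.
- move=> n; have : normc (al 2^-1 n) <= 2 * (M * r^-1 ^+ n).
    rewrite alE; apply: cmean_le => v; first by apply: ccontM; [exact: cfz|apply: ccontX; exact: zcV_cont].
    move=> hv; rewrite normc_mul normc_exp normc_inv zc_norm// ler_wpM2r ?fM//.
    by rewrite exprn_ge0// invr_ge0 ltW.
  move=> H; apply: le_trans (ler_wpM2r (exprn_ge0 n (ltW t0)) H) _.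
  rewrite exprMn -!mulrA ler_pM2l// ler_pM2l// [r^-1 ^+ n * _]mulrC.
  by rewrite mulrA ler_peMl ?mulr_ge0 ?exprn_ge0 ?invr_ge0 ?(ltW t0) ?(ltW r0).
move=> w N wt; have wr := le_lt_trans wt tr.
have zw v : zc r v - w != 0.
  by rewrite subr_eq0; apply: contraTneq wr => <-; rewrite zc_norm// ltxx.
have c1 v : ccont (fun v => zc r v * (zc r v - w)^-1) v by apply: ccontM; [exact: zc_cont|exact: zcw_cont].
(* The same expansion applied to the constant function 1, of which only the term of index 0
   survives. *)
have mean1 : cmean (fun v => zc r v * (zc r v - w)^-1) = 1.
  apply/eqP; rewrite -subr_eq0 -normc_eq0 eq_le normc_ge0 andbT.
  apply/ler_addgt0Pr => e e0; rewrite add0r.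
  pose K := 2 * (1 * (r / (r - t))); have K0 : 0 < K by rewrite /K mul1r mulr_gt0.
  have [|n Hn] := @exists_expr_lt (t / r) (e / K) _ (divr_gt0 e0 K0).
    by case/andP: q01 => /ltW ->.
  have n1 (v : R) : - pi <= v <= pi -> normc 1 <= 1 by move=> _; rewrite normc1.
  have := @cauchy_geometric (fun=> 1) 1 r t w n.+1 t0 tr wt (@ccont_cst _ 1) n1.
  rewrite big_ord_recl /= big1 ?addr0; last first.
    move=> i _; have -> : cmean (fun v => 1 * (zc r v)^-1 ^+ (bump 0 i)) = cmean (fun v => (zc r v)^-1 ^+ i.+1).
      by apply: cmean_eq => v; rewrite mul1r.
    by rewrite cmean_negative_power// mul0r.
  have -> : cmean (fun v => 1 * (zc r v)^-1 ^+ 0) * w ^+ 0 = 1.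
    by rewrite !mulr1 -[RHS](cmean_cst 1); apply: cmean_eq => v; rewrite expr0 mul1r.
  rewrite (_ : cmean (fun v => 1 * _) = cmean (fun v => zc r v * (zc r v - w)^-1)); last first.
    by apply: cmean_eq => v; rewrite mul1r.
  move=> H; apply: le_trans H _.
  by rewrite -/K mulrC -ler_pdivlMr// ltW.
have fE : f w = cmean (fun v => f (zc r v) * (zc r v * (zc r v - w)^-1)).
  have := cauchy_kernel_mean0 hf wr r1.
  rewrite (_ : cmean _ = cmean (fun v => f (zc r v) * (zc r v * (zc r v - w)^-1) + - f w * (zc r v * (zc r v - w)^-1))); last first.
    by apply: cmean_eq => v; rewrite /cauchy_kernel /zc; ring.
  rewrite cmeanD; [|by move=> v; apply: ccontM => //; exact: cfz|by move=> v; exact: ccontZ].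
  by rewrite cmeanZ// mean1 mulr1 => /eqP; rewrite subr_eq0 => /eqP.
rewrite fE; under eq_bigr do rewrite alE.
by apply: cauchy_geometric => // v; exact: cfz.
Qed.

End PowerSeries.

(** * Linearization of a power series in logarithmic coordinates *)

Section Linearization.
Context {R : realType}.
Local Open Scope complex_scope.
Local Open Scope ring_scope.
Local Notation C := R[i].
Local Notation normc := (@ComplexField.Normc.normc R).
Local Notation Re := (@complex.Re R).

Lemma sum_sqr_geometric_le (q : R) : 0 <= q < 1 -> exists D, 0 < D /\
  forall N, \sum_(n < N) n%:R ^+ 2 * q ^+ n <= D.
Proof.
move=> /andP[q0 q1]; have p0 : 0 < 1 - q by rewrite subr_gt0.
(* [A], [B], [D] are the coefficients of the quadratic satisfying [step]; with them [n^2 q^n] is the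
   telescoping difference [g n - g (n + 1)]. *)
pose A := (1 - q)^-1; pose B := 2 * A * q / (1 - q); pose D := q * (A + B) / (1 - q).
have A0 : 0 <= A by rewrite invr_ge0 ltW.
have B0 : 0 <= B by rewrite !mulr_ge0// invr_ge0 ltW.
have D0 : 0 <= D by rewrite !mulr_ge0// ?invr_ge0 ?addr_ge0 ?(ltW p0).
pose g (n : nat) := (A * n%:R ^+ 2 + B * n%:R + D) * q ^+ n.
have step x : (A * x ^+ 2 + B * x + D) - q * (A * (x + 1) ^+ 2 + B * (x + 1) + D) = x ^+ 2.
  by rewrite /D /B /A; field; rewrite gt_eqF.
have E N : \sum_(n < N) n%:R ^+ 2 * q ^+ n = g 0%N - g N.
  elim: N => [|N IH]; first by rewrite big_ord0 subrr.
  rewrite big_ord_recr /= IH; apply/eqP; rewrite -subr_eq0; apply/eqP.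
  by rewrite -(step N%:R) /g -(natr1 N) (exprS q N); ring.
exists (D + 1); split => [|N]; first by rewrite ltr_wpDl.
rewrite E; have : 0 <= g N by rewrite mulr_ge0 ?exprn_ge0// !addr_ge0// ?mulr_ge0// ?sqr_ge0.
have -> : g 0%N = D by rewrite /g; ring.
lra.
Qed.

Lemma coef_sum_le (a : nat -> C) (K q t : R) : 0 < K -> 0 < q < 1 ->
  (forall n, normc (a n) * t ^+ n <= K * q ^+ n) -> exists S, 0 < S /\
  forall N, \sum_(n < N) n%:R ^+ 2 * (normc (a n) * t ^+ n) <= S.
Proof.
move=> K0 /andP[/ltW q0 q1] aK; have [|D [D0 HD]] := @sum_sqr_geometric_le q; first by rewrite q0.
exists (K * D); split => [|N]; first by rewrite mulr_gt0.
apply: le_trans (_ : K * \sum_(n < N) n%:R ^+ 2 * q ^+ n <= _); last by rewrite ler_pM2l.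
rewrite mulr_sumr; by apply: ler_sum => n _; rewrite [leRHS]mulrCA ler_wpM2l// exprn_ge0.
Qed.

(** The truncation of [z f'(z)], the derivative at 0 of [x => f (z * ez x)]. *)
Definition linear_coef (a : nat -> C) N z : C := \sum_(n < N) n%:R * a n * z ^+ n.

(** In the term of index [n] the exponents are [n x] and [n y], so [ez_linearization] costs
    [11 (n m) (n |x - y|)]; the weights [n^2] in [S] absorb this. Linear terms with [n >= N],
    missing from [linear_coef], cost at most [S / N] because [n <= n^2 / N]. Partial sums of length
    [N + M] are treated, and then [M] grows. *)
Lemma linearization f (a : nat -> C) (t S m : R) (N : nat) z x y : 0 < t < 1 -> series_expansion f a ->
  (forall N, \sum_(n < N) n%:R ^+ 2 * (normc (a n) * t ^+ n) <= S) -> (0 < N)%N ->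
  normc z <= t -> Re x <= 0 -> Re y <= 0 -> normc x <= m -> normc y <= m ->
  normc (f (z * ez x) - f (z * ez y) - linear_coef a N z * (x - y)) <= (11 * m * S + S / N%:R) * normc (x - y).
Proof.
move=> t01 fa aS N0 zt x0 y0 xm ym.
have [t0 t1] : 0 < t /\ t < 1 by apply/andP.
have [K [q [K0 q01 _ fK]]] := fa t t01.
have [q0 q1] : 0 < q /\ q < 1 by apply/andP.
have m0 : 0 <= m by rewrite (le_trans (normc_ge0 x)).
have wt w : Re w <= 0 -> normc (z * ez w) <= t.
  move=> w0; rewrite normc_mul normc_ez -[leRHS]mulr1 ler_pM ?normc_ge0 ?expR_ge0//.
  by rewrite -expR0 ler_expR.
have T M : normc (\sum_(n < N + M) a n * (z * ez x) ^+ n - \sum_(n < N + M) a n * (z * ez y) ^+ n - linear_coef a N z * (x - y))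
    <= (11 * m * S + S / N%:R) * normc (x - y).
  have -> : \sum_(n < N + M) a n * (z * ez x) ^+ n - \sum_(n < N + M) a n * (z * ez y) ^+ n - linear_coef a N z * (x - y)
    = \sum_(n < N + M) a n * z ^+ n * (ez (n%:R * x) - ez (n%:R * y) - (n%:R * x - n%:R * y))
     + \sum_(j < M) (N + j)%:R * a (N + j)%N * z ^+ (N + j) * (x - y).
    have -> : linear_coef a N z * (x - y) = \sum_(n < N + M) n%:R * a n * z ^+ n * (x - y) - \sum_(j < M) (N + j)%:R * a (N + j)%N * z ^+ (N + j) * (x - y).
      by rewrite big_split_ord /= addrK /linear_coef mulr_suml.
    rewrite opprB addrCA addrC; congr (_ + _); rewrite -!sumrB; apply: eq_bigr => n _.
    by rewrite !exprMn !ezX; ring.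
  apply: le_trans (normc_triangle _ _) _; rewrite mulrDl; apply: lerD.
    apply: le_trans (normc_sum _ _ _) _.
    apply: le_trans (_ : \sum_(n < N + M) (11 * m * normc (x - y)) * (n%:R ^+ 2 * (normc (a n) * t ^+ n)) <= _).
      apply: ler_sum => n _; rewrite !normc_mul normc_exp.
      have nx : normc (n%:R * x) <= n%:R * m by rewrite normc_mul normc_nat ler_wpM2l.
      have ny : normc (n%:R * y) <= n%:R * m by rewrite normc_mul normc_nat ler_wpM2l.
      have Ren w : Re w <= 0 -> Re (n%:R * w) <= 0.
        rewrite (_ : n%:R = (n%:R : R)%:C); last by rewrite rmorph_nat.
        by case: w => w1 w2 /= w0; rewrite mul0r subr0 mulr_ge0_le0.
      have := ez_linearization (Ren _ x0) (Ren _ y0) nx ny.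
      rewrite -mulrBr normc_mul normc_nat => H.
      have zn : normc z ^+ n <= t ^+ n by rewrite lerXn2r ?nnegrE ?normc_ge0 ?(ltW t0).
      apply: le_trans (_ : normc (a n) * t ^+ n * (11 * (n%:R * m) * (n%:R * normc (x - y))) <= _).
        by rewrite ler_pM ?mulr_ge0 ?exprn_ge0 ?normc_ge0// ler_wpM2l ?normc_ge0.
      by rewrite le_eqVlt; apply/orP; left; apply/eqP; ring.
    rewrite -mulr_sumr (_ : 11 * m * S * _ = (11 * m * normc (x - y)) * S); last by ring.
    by rewrite ler_wpM2l// !mulr_ge0// normc_ge0.
  rewrite -mulr_suml normc_mul ler_wpM2r ?normc_ge0//.
  apply: le_trans (normc_sum _ _ _) _; rewrite ler_pdivlMr ?ltr0n// mulr_suml.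
  apply: le_trans (aS (N + M)%N); rewrite big_split_ord /= -[X in X <= _]add0r; apply: lerD.
    by apply: sumr_ge0 => n _; rewrite !mulr_ge0 ?exprn_ge0 ?normc_ge0 ?(ltW t0)// exprn_ge0.
  apply: ler_sum => j _; rewrite !normc_mul normc_nat normc_exp.
  have zn : normc z ^+ (N + j) <= t ^+ (N + j) by rewrite lerXn2r ?nnegrE ?normc_ge0 ?(ltW t0).
  apply: le_trans (_ : (N + j)%:R * normc (a (N + j)%N) * t ^+ (N + j) * (N + j)%:R <= _).
    rewrite ler_pM ?mulr_ge0 ?exprn_ge0 ?normc_ge0//; first by rewrite ler_wpM2l ?mulr_ge0 ?normc_ge0.
    by rewrite ler_nat leq_addr.
  by rewrite le_eqVlt; apply/orP; left; apply/eqP; ring.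
apply/ler_addgt0Pr => e e0.
have [|M HM] := @exists_expr_lt _ q (e / (2 * K)) _ (divr_gt0 e0 (mulr_gt0 (ltr0n _ 2) K0)).
  by rewrite (ltW q0).
have NM : (N + M.+1 = (N + M).+1)%N by rewrite addnS.
have Kq : 2 * (K * q ^+ (N + M).+1) <= e.
  rewrite mulrA -ler_pdivlMl ?mulr_gt0// mulrC; apply: le_trans (ltW HM).
  by rewrite -NM exprD ler_piMl ?exprn_ge0 ?(ltW q0)// exprn_ile1 ?(ltW q0) ?(ltW q1).
have := T M.+1; rewrite NM => h.
have h1 := fK _ (N + M)%N (wt _ x0); have h2 := fK _ (N + M)%N (wt _ y0).
set Px := \sum_(n < _) _ in h h1; set Py := \sum_(n < _) _ in h h2.
rewrite (_ : f (z * ez x) - f (z * ez y) - linear_coef a N z * (x - y) =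
  (Px - Py - linear_coef a N z * (x - y)) + ((f (z * ez x) - Px) - (f (z * ez y) - Py))); last by ring.
apply: le_trans (normc_triangle _ _) _; apply: lerD => //.
apply: le_trans (normc_triangle _ _) _; rewrite normc_opp; apply: le_trans (lerD h1 h2) _.
by rewrite -mulr2n -mulr_natl.
Qed.

End Linearization.

(** * Images of small squares under nearly linear maps *)

Section Cells.
Context {R : realType}.
Local Open Scope classical_set_scope.
Local Open Scope complex_scope.
Local Open Scope ring_scope.
Local Notation C := R[i].
Local Notation normc := (@ComplexField.Normc.normc R).
Local Notation Re := (@complex.Re R).
Local Notation Im := (@complex.Im R).
Local Notation leb := (@lebesgue_measure R).
Local Notation leb2 := (leb \x leb)%E.
Local Notation RT := (measurableTypeR R).

(** The square is placed in [Re x <= 0], so that multiplication by [ez x] does not increase the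
    modulus. *)
Definition cell (h : R) (x : C) := (- h <= Re x <= 0) && (0 <= Im x <= h).
Definition ocell (h : R) (x : C) := (- h < Re x < 0) && (0 < Im x < h).
Definition pt (x : C) : RT * RT := (Re x, Im x).

Lemma unit_direction (c : C) : exists k1 k2 : R, k1 ^+ 2 + k2 ^+ 2 = 1 /\ c = (normc c)%:C * (k1 +i* k2).
Proof.
have [->|c0] := eqVneq c 0.
  by exists 1, 0; rewrite normc0 mul0r expr1n expr0n addr0.
have n0 : normc c != 0 by rewrite normc_eq0.
exists (Re c / normc c), (Im c / normc c); split.
  by rewrite !exprMn -mulrDl -sqr_normc_ReIm -exprMn divff// expr1n.
have := n0; move: (normc c) => n; case: c {c0 n0} => x y n0.
by apply/eqP; rewrite eq_complex /= !mul0r subr0 addr0 !(mulrC n) !divfK ?eqxx.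
Qed.

(** For a unit vector [k1 +i* k2] in the direction of [c], this rotation turns multiplication by [c]
    into scaling by [|c|], so the images of cells become nearly axis-parallel. *)
Definition untilt (k1 k2 : R) (p : C) : C := (k1 -i* k2) * p.

Lemma untilt_isometry k1 k2 (p p0 : C) : isometry k1 (- k2) (- Re (untilt k1 k2 p0)) (- Im (untilt k1 k2 p0)) (pt p) = pt (untilt k1 k2 (p - p0)).
Proof.
by case: p p0 => x y [x0 y0]; rewrite /untilt /isometry /pt /=; congr (_, _); ring.
Qed.

Lemma untilt_mul k1 k2 (c x : C) : k1 ^+ 2 + k2 ^+ 2 = 1 -> c = (normc c)%:C * (k1 +i* k2) ->
  untilt k1 k2 (c * x) = (normc c)%:C * x.
Proof.
move=> k cE; rewrite {1}cE /untilt mulrA; congr (_ * _).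
rewrite mulrCA -[RHS]mulr1; congr (_ * _).
by apply/eqP; rewrite eq_complex /= -k; apply/andP; split; apply/eqP; ring.
Qed.

Lemma untilt_norm k1 k2 (p : C) : k1 ^+ 2 + k2 ^+ 2 = 1 -> normc (untilt k1 k2 p) = normc p.
Proof. by move=> k; rewrite normc_mul /= sqrrN k sqrtr1 mul1r. Qed.

Lemma untilt_bound k1 k2 (p : C) (b : R) : k1 ^+ 2 + k2 ^+ 2 = 1 -> normc p <= b ->
  (- b <= Re (untilt k1 k2 p) <= b) /\ (- b <= Im (untilt k1 k2 p) <= b).
Proof.
by move=> k pb; rewrite -!ler_norml; split; apply: le_trans pb; rewrite -(untilt_norm p k);
  [exact: normc_ge_ReN|exact: normc_ge_ImN].
Qed.

Lemma cell_norm h x : cell h x -> normc x <= 2 * h.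
Proof.
move=> /andP[/andP[x0 x1] /andP[x2 x3]]; apply: le_trans (normc_le_ReIm _) _.
by rewrite (ler0_norm x1) (ger0_norm x2); lra.
Qed.

Lemma ReD (x y : C) : Re (x + y) = Re x + Re y. Proof. by case: x y => ? ? []. Qed.
Lemma ImD (x y : C) : Im (x + y) = Im x + Im y. Proof. by case: x y => ? ? []. Qed.
Lemma ReZ (k : R) (y : C) : Re (k%:C * y) = k * Re y. Proof. by case: y => ? ? /=; ring. Qed.
Lemma ImZ (k : R) (y : C) : Im (k%:C * y) = k * Im y. Proof. by case: y => ? ? /=; ring. Qed.

(** A point of the cell has modulus at most [2 h], so after untilting the image differs from the
    scaled square by at most [2 e h]; a square enlarged by this amount on each side contains it. *)
Lemma cell_upper (F : C -> C) (c : C) (h e : R) : 0 < h -> 0 <= e ->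
  (forall x y, cell h x -> cell h y -> normc (F x - F y - c * (x - y)) <= e * normc (x - y)) ->
  exists T : set (RT * RT), [/\ measurable T, leb2 T = (((normc c + 4 * e) * h) ^+ 2)%:E &
    forall x, cell h x -> T (pt (F x))].
Proof.
move=> h0 e0 HF; have [k1 [k2 [k cE]]] := unit_direction c.
set n := normc c in cE *; have n0 : 0 <= n := normc_ge0 c.
pose l := (n + 4 * e) * h; have l0 : 0 <= l by rewrite mulr_ge0 ?addr_ge0 ?mulr_ge0 ?(ltW h0).
pose A : set (RT * RT) := `[- n * h - 2 * e * h, - n * h - 2 * e * h + l] `*` `[- 2 * e * h, - 2 * e * h + l].
have mA : measurable A by apply: measurableX.
have k' : k1 ^+ 2 + (- k2) ^+ 2 = 1 by rewrite sqrrN.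
have [mT eT] := isometry_measure (- Re (untilt k1 k2 (F 0))) (- Im (untilt k1 k2 (F 0))) k' mA.
exists (isometry k1 (- k2) (- Re (untilt k1 k2 (F 0))) (- Im (untilt k1 k2 (F 0))) @^-1` A).
split; [exact: mT|by rewrite eT (closed_square_measure _ _ l0)|move=> x cx].
have c0 : cell h 0 by rewrite /cell /= oppr_le0 lexx (ltW h0).
rewrite /preimage /= untilt_isometry.
have nx := cell_norm cx.
have err : normc (F x - F 0 - c * x) <= 2 * e * h.
  have := HF x 0 cx c0; rewrite subr0 => H; apply: le_trans H _.
  by rewrite -mulrA mulrCA ler_wpM2l.
have [/andP[r1 r2] /andP[i1 i2]] := untilt_bound k err.
have E : untilt k1 k2 (F x - F 0) = untilt k1 k2 (F x - F 0 - c * x) + n%:C * x.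
  by rewrite -(untilt_mul x k cE) /untilt -mulrDr subrK.
rewrite E /pt ReD ImD ReZ ImZ; move: cx => /andP[/andP[x0 x1] /andP[x2 x3]].
move: r1 r2 i1 i2; set U := Re (untilt _ _ _); set V := Im (untilt _ _ _) => r1 r2 i1 i2.
have m1 : - (n * h) <= n * Re x by rewrite -mulrN ler_wpM2l.
have m2 : n * Re x <= 0 by rewrite mulr_ge0_le0.
have m3 : 0 <= n * Im x by rewrite mulr_ge0.
have m4 : n * Im x <= n * h by rewrite ler_wpM2l.
clear E err nx c0 mT eT mA HF cE.
split; rewrite /= in_itv /= /l; apply/andP; split; lra.
Qed.

Lemma cell_continuous (F : C -> C) (c p : C) (h e : R) :
  (forall x y, cell h x -> cell h y -> normc (F x - F y - c * (x - y)) <= e * normc (x - y)) ->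
  {within (`[- h, 0] `*` `[0, h] : set (R * R)), continuous (fun x : R * R => normc (F (x.1 +i* x.2) - p))}.
Proof.
move=> HF; apply/subspace_continuousP => -[x1 x2] [/= hx1 hx2].
have cx : cell h (x1 +i* x2) by move: hx1 hx2; rewrite !in_itv /cell /= => -> ->.
apply/cvgrPdist_le => d d0; pose K := normc c + `|e| + 1.
have K0 : 0 < K by rewrite ltr_wpDl// addr_ge0// normc_ge0.
apply/nbhs_ballP; exists (d / (2 * K)) => /=; first by rewrite divr_gt0// mulr_gt0.
move=> [y1 y2] [/= b1 b2] [/= hy1 hy2].
have cy : cell h (y1 +i* y2) by move: hy1 hy2; rewrite !in_itv /cell /= => -> ->.
set X := x1 +i* x2 in cx *; set Y := y1 +i* y2 in cy *.
have XY : normc (X - Y) <= d / K.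
  have nn : normc (X - Y) <= `|x1 - y1| + `|x2 - y2| := normc_le_ReIm _.
  apply: le_trans nn _; rewrite (_ : d / K = d / (2 * K) + d / (2 * K)); last by field; rewrite gt_eqF.
  by apply: lerD; apply: ltW.
have L : normc (F X - F Y) <= d.
  rewrite -[F X - F Y](subrK (c * (X - Y))); apply: le_trans (normc_triangle _ _) _.
  rewrite normc_mul; apply: le_trans (lerD (HF X Y cx cy) (lexx _)) _; rewrite -mulrDl.
  apply: le_trans (_ : K * normc (X - Y) <= _).
    rewrite ler_wpM2r ?normc_ge0// /K addrC -addrA lerD2l; apply: le_trans (ler_norm e) _; lra.
  by rewrite mulrC -ler_pdivlMr.
apply: le_trans L; rewrite ler_norml; apply/andP; split.
  rewrite lerNl opprB normc_sub_sym; apply: le_trans (normc_sub_le _ _) _.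
  by rewrite opprB addrA subrK.
apply: le_trans (normc_sub_le _ _) _; by rewrite opprB addrA subrK.
Qed.

Lemma ocell_of_scaled (n e h q1 q2 u v : R) (y : C) : 0 < n ->
  n * Re y = q1 - u -> n * Im y = q2 - v ->
  - (2 * e * h) <= u -> u <= 2 * e * h -> - (2 * e * h) <= v -> v <= 2 * e * h ->
  - n * h + 2 * e * h < q1 -> q1 < - (2 * e * h) -> 2 * e * h < q2 -> q2 < n * h - 2 * e * h -> ocell h y.
Proof.
move=> n0 Er Ei u1 u2 v1 v2 q11 q12 q21 q22.
have l1 : n * - h < n * Re y by rewrite Er; lra.
have l2 : n * Re y < n * 0 by rewrite Er; lra.
have l3 : n * 0 < n * Im y by rewrite Ei; lra.
have l4 : n * Im y < n * h by rewrite Ei; lra.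
by rewrite !ltr_pM2l// in l1 l2 l3 l4; rewrite /ocell l1 l2 l3 l4.
Qed.

(** For [p] in a square shrunk by [2 e h] on each side, let [x] minimise [|F x - p|] over the
    compact cell. The Newton step [y = x + (p - F x) / c] stays in the open cell thanks to the
    margin, and [|F y - p| <= (e / |c|) |F x - p|]. As [e < |c|], minimality forces [F x = p]. The
    area bound is [(n - 4 e)^2 >= n^2 - 8 e n]. *)
Lemma cell_lower (F : C -> C) (c : C) (h e : R) : 0 < h -> 0 <= e ->
  (forall x y, cell h x -> cell h y -> normc (F x - F y - c * (x - y)) <= e * normc (x - y)) ->
  exists T : set (RT * RT), [/\ measurable T, (((normc c ^+ 2 - 8 * e * normc c) * h ^+ 2)%:E <= leb2 T)%E &
    forall p, T p -> exists2 x, ocell h x & p = pt (F x)].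
Proof.
move=> h0 e0 HF; have [k1 [k2 [k cE]]] := unit_direction c.
have [ne|ne] := leP (normc c) (4 * e).
  (* Here the required lower bound is not positive. *)
  exists set0; split => //; rewrite measure0 lee_fin mulr_le0_ge0 ?sqr_ge0// expr2 -mulrBl.
  by rewrite mulr_le0_ge0 ?normc_ge0//; lra.
have nc0 : 0 < normc c by apply: le_lt_trans ne; rewrite mulr_ge0.
have c0 : c != 0 by rewrite -normc_gt0.
set n := normc c in ne nc0 cE *.
pose l := (n - 4 * e) * h; have l0 : 0 <= l by rewrite mulr_ge0 ?(ltW h0)// subr_ge0 ltW.
pose A : set (RT * RT) := `]- n * h + 2 * e * h, - n * h + 2 * e * h + l[ `*` `]2 * e * h, 2 * e * h + l[.
have mA : measurable A by apply: measurableX.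
have k' : k1 ^+ 2 + (- k2) ^+ 2 = 1 by rewrite sqrrN.
have [mT eT] := isometry_measure (- Re (untilt k1 k2 (F 0))) (- Im (untilt k1 k2 (F 0))) k' mA.
exists (isometry k1 (- k2) (- Re (untilt k1 k2 (F 0))) (- Im (untilt k1 k2 (F 0))) @^-1` A).
have ll : (n ^+ 2 - 8 * e * n) * h ^+ 2 <= l ^+ 2.
  by rewrite /l exprMn ler_wpM2r ?sqr_ge0//; have := sqr_ge0 e; rewrite sqrrB; lra.
split; [exact: mT|by rewrite eT (open_square_measure _ _ l0) lee_fin|move=> [p1 p2]].
rewrite /preimage /=; set p := p1 +i* p2.
rewrite -[(p1, p2)]/(pt p) untilt_isometry => -[/=]; rewrite !in_itv /= /l.
set q := untilt k1 k2 (p - F 0) => /andP[q1 q2] /andP[q3 q4].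
have Q0 : (`[- h, 0] `*` `[0, h] : set (R * R)) !=set0.
  by exists (0, 0); split => /=; rewrite in_itv /= ?oppr_le0 ?lexx ?(ltW h0).
have cQ : compact (`[- h, 0] `*` `[0, h] : set (R * R)) by apply: compact_setX; exact: segment_compact.
have [[x1 x2]] := compact_EVT_min Q0 cQ (cell_continuous (p := p) HF).
rewrite inE /= => -[hx1 hx2]; rewrite /= in hx1 hx2 *; set x := x1 +i* x2 => minx.
have cx : cell h x by move: hx1 hx2; rewrite !in_itv /cell /= => -> ->.
have cz : cell h 0 by rewrite /cell /= oppr_le0 lexx (ltW h0).
pose y := x + (p - F x) / c.
have nx := cell_norm cx.
have err : normc (F x - F 0 - c * x) <= 2 * e * h.
  have := HF x 0 cx cz; rewrite subr0 => H; apply: le_trans H _.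
  by rewrite -mulrA mulrCA ler_wpM2l.
have [/andP[r1 r2] /andP[i1 i2]] := untilt_bound k err.
have E : n%:C * y = q - untilt k1 k2 (F x - F 0 - c * x).
  rewrite -(untilt_mul y k cE) /q /untilt -mulrBr; congr (_ * _).
  rewrite /y mulrDr [c * (_ / c)]mulrCA divff// mulr1.
  by ring.
have ER : n * Re y = Re q - Re (untilt k1 k2 (F x - F 0 - c * x)).
  by rewrite -ReZ E; case: (q) (untilt _ _ _) => ? ? [].
have EI : n * Im y = Im q - Im (untilt k1 k2 (F x - F 0 - c * x)).
  by rewrite -ImZ E; case: (q) (untilt _ _ _) => ? ? [].
have oy : ocell h y.
  by apply: (ocell_of_scaled nc0 ER EI r1 r2 i1 i2 q1 _ q3 _); [apply: lt_le_trans q2 _|apply: lt_le_trans q4 _]; lra.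
have cy : cell h y.
  by move/andP: oy => [/andP[/ltW o1 /ltW o2] /andP[/ltW o3 /ltW o4]]; rewrite /cell o1 o2 o3 o4.
have my : normc (F x - p) <= normc (F y - p).
  have yQ : (Re y, Im y) \in (`[- h, 0] `*` `[0, h] : set (R * R)).
    by rewrite inE; move: cy => /andP[g1 g2]; split; rewrite /= in_itv.
  by have := minx _ yQ; rewrite /= (_ : Re y +i* Im y = y)//; case: (y).
have yx : y - x = (p - F x) / c by rewrite /y addrC addKr.
have := HF y x cy cx; rewrite yx mulrCA divff// mulr1 opprB addrA subrK => Hy.
have m0 : normc (F x - p) = 0.
  apply/eqP; rewrite eq_le normc_ge0 andbT leNgt; apply/negP => m0.
  have := le_trans my Hy; rewrite normc_mul normc_inv (normc_sub_sym p) -/n leNgt => /negP; apply.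
  rewrite mulrCA gtr_pMr// ltr_pdivrMr// mul1r; lra.
have Fxp : F x = p by apply/eqP; rewrite -subr_eq0 -normc_eq0 m0.
have yE : y = x by apply/eqP; rewrite -subr_eq0 yx Fxp subrr mul0r.
by exists x; rewrite -?yE // /pt yE Fxp.
Qed.

End Cells.

(** * Measurability of images of disks; injectivity of the exponential *)

Section DiskImages.
Context {R : realType}.
Local Open Scope classical_set_scope.
Local Open Scope complex_scope.
Local Open Scope ring_scope.
Local Notation C := R[i].
Local Notation normc := (@ComplexField.Normc.normc R).
Local Notation Re := (@complex.Re R).
Local Notation Im := (@complex.Im R).
Local Notation leb := (@lebesgue_measure R).
Local Notation leb2 := (leb \x leb)%E.
Local Notation RT := (measurableTypeR R).

Definition dimage (f : C -> C) (t : R) : set (RT * RT) := [set pt (f z) | z in disk t].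

Lemma areaE f t : area f t = fine (leb2 (dimage f t)). Proof. by []. Qed.

Lemma area_fin f t : (leb2 (dimage f t) < +oo)%E -> (area f t)%:E = leb2 (dimage f t).
Proof. by move=> fin; rewrite areaE fineK ?ge0_fin_numE; [|exact: fin|exact: measure_ge0]. Qed.

Lemma pt_inj : injective (@pt R).
Proof. by move=> [a b] [c d] [-> ->]. Qed.

(** The image of a compact disk under a continuous map is compact, hence closed. *)
Lemma dimage_closed_disk (f : C -> C) (s : R) : s < 1 -> (forall z, normc z < 1 -> exists c, cdiff f z c) ->
  measurable [set pt (f z) | z in [set z | normc z <= s]].
Proof.
move=> s1 hf; have [s0|s0] := leP 0 s; last first.
  rewrite (_ : [set z | normc z <= s] = set0) ?image_set0//; apply/seteqP; split => // z /= h.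
  by have := le_trans (normc_ge0 z) h; rewrite leNgt s0.
pose A : set (R * R) := [set p | p.1 ^+ 2 + p.2 ^+ 2 <= s ^+ 2].
have AE p : A p <-> normc (p.1 +i* p.2) <= s.
  have <- : (normc (p.1 +i* p.2) ^+ 2 <= s ^+ 2) = (normc (p.1 +i* p.2) <= s).
    by rewrite ler_sqr ?nnegrE ?normc_ge0.
  by rewrite sqr_normc_ReIm.
have clA : closed A.
  apply: (@closed_comp _ R (fun p : R * R => p.1 ^+ 2 + p.2 ^+ 2) [set x | x <= s ^+ 2]); last exact: closed_le.
  move=> p _; apply: (@continuousD _ _ _ (fun p : R * R => p.1 ^+ 2) (fun p => p.2 ^+ 2)).
    by apply: (@continuous_comp _ _ _ fst (fun x : R => x ^+ 2)); [exact: cvg_fst|exact: exprn_continuous].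
  by apply: (@continuous_comp _ _ _ snd (fun x : R => x ^+ 2)); [exact: cvg_snd|exact: exprn_continuous].
have cA : compact A.
  apply: (@subclosed_compact _ A (`[- s, s] `*` `[- s, s])) => //.
    by apply: compact_setX; exact: segment_compact.
  move=> p /AE ps; split => /=; rewrite in_itv /= -ler_norml; apply: le_trans ps.
    exact: (normc_ge_ReN (p.1 +i* p.2)).
  exact: (normc_ge_ImN (p.1 +i* p.2)).
pose g (p : R * R) : R * R := (Re (f (p.1 +i* p.2)), Im (f (p.1 +i* p.2))).
have cg : {within A, continuous g}.
  apply: continuous_in_subspaceT => p; rewrite inE => /AE ps.
  have [c fc] := hf _ (le_lt_trans ps s1).
  have [d [K [d0 K0 L]]] := cdiff_lipschitz fc.
  apply/cvg_ballP => e e0.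
  have r0 : 0 < Num.min (d / 2) (e / (2 * K)) by rewrite lt_min !divr_gt0// mulr_gt0.
  apply: filterS (nbhsx_ballx p _ r0) => q [/=]; rewrite /ball /= !lt_min => /andP[b1 b2] /andP[b3 b4].
  set h := (q.1 - p.1) +i* (q.2 - p.2).
  have nh : normc h <= `|p.1 - q.1| + `|p.2 - q.2|.
    by rewrite (distrC p.1) (distrC p.2); exact: normc_le_ReIm.
  have hd : normc h < d by apply: le_lt_trans nh _; lra.
  have hz : (p.1 +i* p.2) + h = q.1 +i* q.2.
    by apply/eqP; rewrite eq_complex /= [p.1 + _]addrC [p.2 + _]addrC !subrK !eqxx.
  have := L h hd; rewrite hz => k.
  have ke : normc (f (q.1 +i* q.2) - f (p.1 +i* p.2)) < e.
    apply: le_lt_trans k _; rewrite mulrC -ltr_pdivlMr//; apply: le_lt_trans nh _.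
    by rewrite (_ : e / K = e / (2 * K) + e / (2 * K)) ?ltrD//; field; rewrite gt_eqF.
  split; rewrite /ball /= distrC; apply: le_lt_trans ke.
    by apply: le_trans (normc_ge_ReN _); case: (f _) (f _) => ? ? [].
  by apply: le_trans (normc_ge_ImN _); case: (f _) (f _) => ? ? [].
have cgA := continuous_compact cg cA.
have clgA : closed (g @` A) by apply: compact_closed cgA; exact: norm_hausdorff.
have := closed_measurable2 clgA; rewrite (_ : g @` A = [set pt (f z) | z in [set z | normc z <= s]])//.
apply/seteqP; split => [_ [p /AE ps <-]|_ [[x y] /= zs <-]].
  by exists (p.1 +i* p.2).
by exists (x, y) => //; apply/AE.
Qed.

Lemma dimage_measurable f t : t <= 1 -> (forall z, normc z < 1 -> exists c, cdiff f z c) ->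
  measurable (dimage f t).
Proof.
move=> t1 hf.
have -> : dimage f t = \bigcup_n [set pt (f z) | z in [set z | normc z <= t - n.+1%:R^-1]].
  apply/seteqP; split => [_ [z /diskE zt <-]|_ [n _ [z /= zn <-]]].
    have [n Hn] : exists n : nat, normc z <= t - n.+1%:R^-1.
      have e0 : 0 < t - normc z by rewrite subr_gt0.
      exists (Num.bound (t - normc z)^-1); rewrite lerBrDr addrC -lerBrDr.
      rewrite -[leRHS]invrK lef_pV2 ?posrE ?invr_gt0//; apply: ltW.
      apply: lt_trans (archi_boundP _) _; first by rewrite invr_ge0 ltW.
      by rewrite ltr_nat.
    by exists n => //; exists z.
  exists z => //; apply/diskE; apply: le_lt_trans zn _.
  by rewrite ltrBlDr ltrDl invr_gt0.
apply: bigcup_measurable => n _; apply: dimage_closed_disk => //.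
by apply: lt_le_trans t1; rewrite ltrBlDr ltrDl invr_gt0.
Qed.

Lemma dimage_le f t (M : R) : t <= 1 -> (forall z, normc z < 1 -> exists c, cdiff f z c) ->
  0 <= M -> (forall z, normc z < t -> normc (f z - f 0) <= M) -> (leb2 (dimage f t) <= ((2 * M) ^+ 2)%:E)%E.
Proof.
move=> t1 hf M0 fM; have M2 : 0 <= 2 * M by rewrite mulr_ge0.
rewrite -(closed_square_measure (Re (f 0) - M) (Im (f 0) - M) M2); apply: le_measure.
- by rewrite inE; exact: dimage_measurable.
- by rewrite inE; apply: measurableX.
move=> _ [z /diskE/fM H <-].
have h1 := le_trans (normc_ge_ReN _) H; have h2 := le_trans (normc_ge_ImN _) H.
have e1 : Re (f z - f 0) = Re (f z) - Re (f 0) by case: (f z) (f 0) => ? ? [].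
have e2 : Im (f z - f 0) = Im (f z) - Im (f 0) by case: (f z) (f 0) => ? ? [].
move: h1 h2; rewrite e1 e2 !ler_norml => /andP[a1 a2] /andP[a3 a4].
by split; rewrite /= in_itv /=; apply/andP; split; lra.
Qed.

(** Up to distance [pi] this is [ez_inj_strip]. Beyond it, replacing [th] by [th + 2 pi] brings the
    angles within [pi], so [v = th + 2 pi], against the strict bound. *)
Lemma ez_inj_2pi (u v p th : R) : ez (u +i* v) = ez (p +i* th) -> `|v - th| < 2 * pi ->
  u = p /\ v = th.
Proof.
move=> E vth; have [le|gt] := leP `|v - th| pi.
  by apply: ez_inj_strip E _; rewrite -ler_distl.
exfalso; move: E vth gt; wlog lt : u v p th / th <= v => [W E vth gt|E].
  have [|/ltW] := leP th v; first by move=> h; exact: (W u v p th h E vth gt).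
  by move=> h; apply: (W p th u v h (esym E)); rewrite distrC.
rewrite ger0_norm ?subr_ge0// => h1 h2.
have E' : ez (u +i* v) = ez (p +i* (th + 2 * pi)).
  by rewrite E -(ez_2pi (p +i* th)); congr ez; apply/eqP; rewrite eq_complex /= addr0 !eqxx.
have [|_ ] := ez_inj_strip E'; first by apply/andP; split; lra.
by move=> vE; rewrite vE in h1; lra.
Qed.

End DiskImages.

(** * The area gained across a thin annulus *)

Section AnnulusStep.
Context {R : realType}.
Local Open Scope classical_set_scope.
Local Open Scope complex_scope.
Local Open Scope ring_scope.
Local Notation C := R[i].
Local Notation normc := (@ComplexField.Normc.normc R).
Local Notation Re := (@complex.Re R).
Local Notation Im := (@complex.Im R).
Local Notation leb := (@lebesgue_measure R).
Local Notation leb2 := (leb \x leb)%E.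
Local Notation RT := (measurableTypeR R).

Let im (y : R) : C := 0 +i* y.

Let imD x y : im (x + y) = im x + im y.
Proof. by apply/eqP; rewrite eq_complex /= addr0 !eqxx. Qed.

Let imM n y : n%:R * im y = im (n%:R * y).
Proof.
rewrite (_ : n%:R = (n%:R : R)%:C); last by rewrite rmorph_nat.
by apply/eqP; rewrite eq_complex /= !mulr0 !mul0r subrr addr0 !eqxx.
Qed.

Let ez_conj y : (ez (im y))^* = ez (im (- y)).
Proof. by apply/eqP; rewrite eq_complex /= cosN sinN mulrN !eqxx. Qed.

(** The cross term of [n] and [m] is a sum of the powers of an [N]-th root of unity. Since both
    indices are below the number [N] of sample points, the root is 1 only for [n = m]; otherwise its
    powers sum to 0. *)
Lemma discrete_parseval (b : nat -> C) N : (0 < N)%N ->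
  \sum_(k < N) normc (\sum_(n < N) b n * ez (im (k%:R * (2 * pi / N%:R))) ^+ n) ^+ 2 =
  N%:R * \sum_(n < N) normc (b n) ^+ 2.
Proof.
move=> N0; set h := 2 * pi / N%:R; have p0 := pi_gt0 R.
have N0' : 0 < N%:R :> R by rewrite ltr0n.
have Nh : N%:R * h = 2 * pi by rewrite /h mulrCA divff ?mulr1// gt_eqF.
have h0 : 0 < h by rewrite divr_gt0// mulr_gt0.
apply: complexI; rewrite rmorphM rmorph_nat !rmorph_sum /=.
under [LHS]eq_bigr => k _.
  rewrite sqr_normc_conj rmorph_sum big_distrlr /=.
  over.
rewrite exchange_big mulr_sumr; apply: eq_bigr => n _ /=.
rewrite exchange_big (bigD1 n) //= [X in _ + X]big1 ?addr0; last first.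
  move=> m mn; pose rho := ez (im (n%:R * h - m%:R * h)).
  have rN : rho ^+ N = 1.
    have Nnm : N%:R * (n%:R * h - m%:R * h) = n%:R * (2 * pi) - m%:R * (2 * pi).
      by rewrite -Nh; ring.
    rewrite /rho ezX imM Nnm imD ezD.
    have P (j : nat) : ez (im (j%:R * (2 * pi))) = 1.
      elim: j => [|j IH]; first by rewrite mul0r (_ : im 0 = 0) ?ez0.
      by rewrite -natr1 mulrDl mul1r imD ez_2pi.
    rewrite P mul1r.
    have -> : ez (im (- (m%:R * (2 * pi)))) = (ez (im (m%:R * (2 * pi))))^* by rewrite ez_conj.
    by rewrite P; apply/eqP; rewrite eq_complex /= oppr0 !eqxx.
  have r1 : rho != 1.
    apply: contra mn => /eqP; rewrite -ez0 => /(@ez_inj_2pi _ 0 _ 0 0)[].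
      rewrite subr0 -mulrBl normrM (gtr0_norm h0) -Nh ltr_pM2r// ltr_norml.
      have := ltn_ord n; have := ltn_ord m; rewrite -!(ltr_nat R) => l1 l2.
      by have := ler0n R n; have := ler0n R m => k1 k2; apply/andP; split; lra.
    move=> _ /eqP; rewrite subr_eq0 => /eqP /(mulIf (lt0r_neq0 h0))/eqP.
    by rewrite eqr_nat => /eqP/ord_inj ->.
  have -> : \sum_(k < N) b n * ez (im (k%:R * h)) ^+ n * (b m * ez (im (k%:R * h)) ^+ m)^* =
     b n * (b m)^* * \sum_(k < N) rho ^+ k.
    rewrite mulr_sumr; apply: eq_bigr => k _; rewrite rmorphM rmorphXn /= ez_conj !ezX !imM.
    rewrite mulrACA -ezD -imD; congr (_ * ez (im _)); ring.
  have : (rho - 1) * \sum_(k < N) rho ^+ k = 0 by rewrite -subrX1 rN subrr.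
  by move/eqP; rewrite mulf_eq0 subr_eq0 (negbTE r1) => /eqP ->; rewrite mulr0.
under eq_bigr => k _.
  rewrite -sqr_normc_conj normc_mul normc_exp normc_ez /= expR0 expr1n mulr1.
  over.
by rewrite sumr_const card_ord mulr_natl.
Qed.

Lemma linear_coef_parseval (a : nat -> C) (t : R) N : 0 < t -> (0 < N)%N ->
  \sum_(k < N) normc (linear_coef a N (ez (ln t +i* (k%:R * (2 * pi / N%:R))))) ^+ 2 =
  N%:R * \sum_(n < N) n%:R ^+ 2 * normc (a n) ^+ 2 * t ^+ (2 * n).
Proof.
move=> t0 N0; have -> : \sum_(n < N) n%:R ^+ 2 * normc (a n) ^+ 2 * t ^+ (2 * n) = \sum_(n < N) normc (n%:R * a n * t%:C ^+ n) ^+ 2.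
  apply: eq_bigr => n _; rewrite !normc_mul normc_nat normc_exp normc_real gtr0_norm//.
  by rewrite mulnC exprM !exprMn.
rewrite -(@discrete_parseval (fun n => n%:R * a n * t%:C ^+ n) N N0); apply: eq_bigr => k _; congr (normc _ ^+ 2); apply: eq_bigr => n _.
rewrite -[RHS]mulrA -exprMn; congr (_ * _ ^+ _).
by apply/eqP; rewrite eq_complex /= expR0 !mul1r lnK ?posrE// !mul0r subr0 addr0 !eqxx.
Qed.

Lemma linear_coef_le (a : nat -> C) (t S : R) N z : 0 <= t ->
  (forall N, \sum_(n < N) n%:R ^+ 2 * (normc (a n) * t ^+ n) <= S) ->
  normc z <= t -> normc (linear_coef a N z) <= S.
Proof.
move=> t0 aS zt; apply: le_trans (aS N); apply: le_trans (normc_sum _ _ _) _.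
apply: ler_sum => n _; rewrite !normc_mul normc_nat normc_exp -mulrA.
have zn : normc z ^+ n <= t ^+ n by rewrite lerXn2r ?nnegrE ?normc_ge0.
rewrite ler_pM ?mulr_ge0 ?exprn_ge0 ?normc_ge0//; last by rewrite ler_wpM2l ?normc_ge0.
by rewrite -natrX ler_nat; case: (n : nat) => // m; rewrite expnS leq_pmulr// expn_gt0.
Qed.

Lemma sandwich_bound (A1 A2 m s u5 u6 u7 : R) : A1 <= A2 + (m + s + u6) -> A2 + (m - s) <= A1 ->
  s <= u5 -> u6 <= u7 -> 0 <= u7 -> `|A1 - A2 - m| <= u5 + u7.
Proof. by move=> *; rewrite ler_norml; apply/andP; split; lra. Qed.

(* The annulus [t exp(-h) <= |z| < t] is cut into [N] cells which are squares of side [h] in logarithmic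
   coordinates; [f] is nearly linear on each of them, with coefficient [linear_coef a N z_k]. *)
Lemma annulus_step f a (t S h : R) N : h = 2 * pi / N%:R -> (forall z, normc z < 1 -> exists c, cdiff f z c) ->
  {in disk 1 &, injective f} -> series_expansion f a -> 0 < t < 1 ->
  (forall N, \sum_(n < N) n%:R ^+ 2 * (normc (a n) * t ^+ n) <= S) -> (0 < N)%N ->
  (leb2 (dimage f t) < +oo)%E ->
  `|area f t - area f (t * expR (- h)) - 2 * pi * h * \sum_(n < N) n%:R ^+ 2 * normc (a n) ^+ 2 * t ^+ (2 * n)|
    <= 2 * pi * (184 + 8464 * (2 * pi)) * S ^+ 2 * h ^+ 2.
Proof.
move=> hE hf injf fa t01 aS N0 fin.
have [t0 t1] : 0 < t /\ t < 1 by apply/andP.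
have p0 := pi_gt0 R.
have N0' : 0 < N%:R :> R by rewrite ltr0n.
have h0 : 0 < h by rewrite hE divr_gt0// mulr_gt0.
have Nh : N%:R * h = 2 * pi by rewrite hE mulrCA divff ?mulr1// gt_eqF.
have h2p : h <= 2 * pi by rewrite -Nh ler_peMl ?(ltW h0)// ler1n.
have S0 : 0 <= S by have := aS 0%N; rewrite big_ord0.
pose z k : C := ez (ln t +i* (k%:R * h)).
have nz k : normc (z k) = t by rewrite normc_ez /= lnK.
pose c k := linear_coef a N (z k).
have cS k : normc (c k) <= S by apply: linear_coef_le (ltW t0) aS _; rewrite nz.
(* [linearization] with [m = 2 h] gives [22 S h], and one more [S h] dominates
   [S / N = S h / (2 pi)]. *)
pose e := 23 * S * h; have e0 : 0 <= e by rewrite !mulr_ge0// ltW.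
pose F k (x : C) := f (z k * ez x).
have lin k x y : cell h x -> cell h y -> normc (F k x - F k y - c k * (x - y)) <= e * normc (x - y).
  move=> cx cy; have nx := cell_norm cx; have ny := cell_norm cy.
  case/andP: cx => /andP[_ x0] _; case/andP: cy => /andP[_ y0] _.
  have zt : normc (z k) <= t by rewrite nz.
  have := linearization t01 fa aS N0 zt x0 y0 nx ny => H; apply: le_trans H _.
  rewrite ler_wpM2r ?normc_ge0// /e.
  have -> : S / N%:R = S * h / (2 * pi) by rewrite -Nh; field; rewrite ?(lt0r_neq0 h0) ?(lt0r_neq0 N0') ?pnatr_eq0 -?lt0n.
  have : S * h / (2 * pi) <= S * h.
    rewrite ler_pdivrMr ?mulr_gt0// ler_peMr ?mulr_ge0 ?(ltW h0)//.
    by have := pi_ge2 R; lra.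
  lra.
have tt : t * expR (- h) < t by rewrite gtr_pMr// -expR0 ltr_expR oppr_lt0.
have mt : measurable (dimage f t) by apply: dimage_measurable => //; exact: ltW.
have mt' : measurable (dimage f (t * expR (- h))).
  by apply: dimage_measurable => //; exact: ltW (lt_trans tt t1).
have sub : dimage f (t * expR (- h)) `<=` dimage f t.
  by move=> _ [w /diskE wt <-]; exists w => //; apply/diskE; exact: lt_trans tt.
have fin' : (leb2 (dimage f (t * expR (- h))) < +oo)%E.
  by apply: le_lt_trans fin; apply: le_measure; rewrite ?inE.
have fa1 := area_fin fin; have fa2 := area_fin fin'.
move: (area f t) (area f (t * expR (- h))) fa1 fa2 => A1 A2 fa1 fa2.
have parseval := @linear_coef_parseval a t N t0 N0; rewrite -hE in parseval.
set P := \sum_(n < N) n%:R ^+ 2 * normc (a n) ^+ 2 * t ^+ (2 * n) in parseval *.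
have cP : \sum_(k < N) normc (c k) ^+ 2 = N%:R * P by exact: parseval.
have bound (A : R) : 0 <= A -> \sum_(k < N) (normc (c k) * A) <= N%:R * (S * A).
  move=> A0; apply: le_trans (_ : \sum_(k < N) (S * A) <= _).
    by apply: ler_sum => k _; rewrite ler_wpM2r.
  by rewrite sumr_const card_ord mulr_natl.
have phase k x : z k * ez x = ez ((ln t + Re x) +i* (k%:R * h + Im x)).
  by rewrite -ezD; congr ez; case: x.
(* The smaller disk and the [N] cells cover the disk of radius [t]; in [G], index 0 is the image of
   the smaller disk and index [k + 1] the square containing the image of cell [k]. *)
have up : A1 <= A2 + \sum_(k < N) ((normc (c k) + 4 * e) * h) ^+ 2.
  have /choice[T HT] k := @cell_upper _ (F k) (c k) h e h0 e0 (lin k).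
  rewrite -lee_fin EFinD fa1 fa2 -sumEFin.
  under [X in (_ + X)%E]eq_bigr => k _ do rewrite -(let: And3 _ m _ := HT k in m).
  pose G (k : nat) : set (RT * RT) := if k is j.+1 then T j else dimage f (t * expR (- h)).
  have mG k : measurable (G k) by case: k => [//|k /=]; have [] := HT k.
  have := @content_subadditive _ _ _ leb2 (dimage f t) G N.+1 (fun k _ => mG k) mt.
  have SG : (\sum_(k < N.+1) leb2 (G k) = leb2 (dimage f (t * expR (- h))) + \sum_(k < N) leb2 (T k))%E.
    by rewrite big_ord_recl.
  rewrite SG => H; apply: H; rewrite -bigcup_mkord => _ [w /diskE wt <-]; have [wt'|wt'] := ltP (normc w) (t * expR (- h)).
    by exists 0%N => //; exists w => //; apply/diskE.
  have w0 : w != 0 by rewrite -normc_gt0 (lt_le_trans _ wt')// mulr_gt0// expR_gt0.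
  have [v /andP[v0 v1] wE] := polar_form w0.
  pose k := Num.truncn (v / h).
  have /andP[k1 k2] : (k%:R <= v / h < k.+1%:R) by apply: truncn_itv; rewrite divr_ge0// ltW.
  rewrite ler_pdivlMr// in k1; rewrite ltr_pdivrMr// in k2.
  have kN : (k < N)%N by rewrite -(ltr_nat R) -(ltr_pM2r h0) Nh (le_lt_trans k1).
  exists k.+1 => //=.
  pose x : C := (ln (normc w) - ln t) +i* (v - k%:R * h).
  have -> : w = z k * ez x.
    by rewrite phase /x /= [in RHS](addrC (ln t)) [in RHS](addrC (k%:R * h)) !subrK.
  have [_ _ HTk] := HT k; apply: HTk; rewrite /cell /x /=.
  have nw : 0 < normc w by rewrite normc_gt0.
  have l1 : ln t - h <= ln (normc w).
    have : ln (t * expR (- h)) <= ln (normc w) by rewrite ler_ln ?posrE// mulr_gt0// expR_gt0.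
    by rewrite lnM ?posrE ?expR_gt0// expRK.
  have l2 : ln (normc w) <= ln t by rewrite ler_ln ?posrE// ltW.
  move: k2; rewrite -natr1 mulrDl mul1r => k2.
  by apply/andP; split; apply/andP; split; lra.
(* The inner squares are disjoint from one another and from the image of the smaller disk: their
   points have preimages in distinct open cells, and [f] is injective. *)
have low : A2 + \sum_(k < N) ((normc (c k) ^+ 2 - 8 * e * normc (c k)) * h ^+ 2) <= A1.
  have /choice[T HT] k := @cell_lower _ (F k) (c k) h e h0 e0 (lin k).
  rewrite -lee_fin EFinD fa1 fa2 -sumEFin.
  pose G (k : nat) : set (RT * RT) := if k is j.+1 then T j else dimage f (t * expR (- h)).
  have mG k : measurable (G k) by case: k => [//|k /=]; have [] := HT k.
  have ozt k x : ocell h x -> normc (z k * ez x) < t /\ t * expR (- h) < normc (z k * ez x).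
    move=> /andP[/andP[x0 x1] _]; rewrite normc_mul nz normc_ez; split.
      by rewrite gtr_pMr// -expR0 ltr_expR.
    by rewrite ltr_pM2l// ltr_expR.
  have indisk w : normc w < t -> w \in disk 1 by move=> wt; rewrite inE; apply/diskE; exact: lt_trans t1.
  have tG : trivIset `I_N.+1 G.
    have D0 k : G 0%N `&` G k.+1 = set0.
      apply/seteqP; split => // p [[w /diskE wt <-]] /=; have [_ _ HTk] := HT k.
      move=> /HTk[x ox /pt_inj E]; have [x1 x2] := ozt k x ox; have wt' := lt_trans wt tt.
      have := injf _ _ (indisk _ wt') (indisk _ x1) E => wE.
      by move: x2; rewrite -wE ltNge (ltW wt).
    move=> [|i] [|j] //= iN jN [p [Gi Gj]]; first by exfalso; have : (G 0%N `&` G j.+1) p by []; rewrite D0.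
      by exfalso; have : (G 0%N `&` G i.+1) p by []; rewrite D0.
    apply: (congr1 succn); have [_ _ HTi] := HT i; have [_ _ HTj] := HT j.
    have [x ox pE] := HTi _ Gi; have [y oy] := HTj _ Gj; rewrite pE => /pt_inj E.
    have [x1 _] := ozt i x ox; have [y1 _] := ozt j y oy.
    have := injf _ _ (indisk _ x1) (indisk _ y1) E; rewrite !phase.
    case/andP: ox => _ /andP[ox1 ox2]; case/andP: oy => _ /andP[oy1 oy2].
    have angle (k : nat) (s : R) : (k < N)%N -> 0 < s -> s < h -> 0 < k%:R * h + s /\ k%:R * h + s < 2 * pi.
      move=> kN s0 sh; split; first by rewrite ltr_wpDl// mulr_ge0// ltW.
      apply: lt_le_trans (_ : k.+1%:R * h <= _); first by rewrite -natr1 mulrDl mul1r ltrD2l.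
      by rewrite -Nh ler_pM2r// ler_nat.
    have [a1 a2] := angle i _ iN ox1 ox2; have [b1 b2] := angle j _ jN oy1 oy2.
    move=> /ez_inj_2pi[|_ ang]; first by rewrite ltr_norml; apply/andP; split; lra.
    apply/eqP; rewrite eqn_leq; apply/andP; split; rewrite leqNgt; apply/negP => lt.
      have : j.+1%:R * h <= i%:R * h by rewrite ler_pM2r// ler_nat.
      by rewrite -natr1 mulrDl mul1r; lra.
    have : i.+1%:R * h <= j%:R * h by rewrite ler_pM2r// ler_nat.
    by rewrite -natr1 mulrDl mul1r; lra.
  have mU : measurable (\big[setU/set0]_(k < N.+1) G k) by apply: bigsetU_measurable => k _.
  have := @measure_semi_additive_ord_I _ _ _ leb2 G N.+1 (fun k _ => mG k) tG mU; move=> mE.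
  have SG : (\sum_(k < N.+1) leb2 (G k) = leb2 (dimage f (t * expR (- h))) + \sum_(k < N) leb2 (T k))%E.
    by rewrite big_ord_recl.
  apply: le_trans (_ : leb2 (\big[setU/set0]_(k < N.+1) G k) <= _)%E.
    by rewrite mE SG; apply: leeD => //; apply: lee_sum => k _; have [] := HT k.
  apply: le_measure; rewrite ?inE// -bigcup_mkord => p [[|k] /= kN]; first exact: sub.
  have [_ _ HTk] := HT k; move=> /HTk[x ox ->]; have [x1 _] := ozt k x ox.
  by exists (z k * ez x) => //; apply/diskE.
have E1 : \sum_(k < N) ((normc (c k) + 4 * e) * h) ^+ 2 =
   h ^+ 2 * (N%:R * P) + \sum_(k < N) (normc (c k) * (8 * e * h ^+ 2)) + N%:R * (16 * e ^+ 2 * h ^+ 2).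
  have -> : N%:R * (16 * e ^+ 2 * h ^+ 2) = \sum_(k < N) (16 * e ^+ 2 * h ^+ 2).
    by rewrite sumr_const card_ord mulr_natl.
  rewrite -cP mulr_sumr -!big_split /=.
  by apply: eq_bigr => k _; ring.
have E2 : \sum_(k < N) ((normc (c k) ^+ 2 - 8 * e * normc (c k)) * h ^+ 2) =
   h ^+ 2 * (N%:R * P) - \sum_(k < N) (normc (c k) * (8 * e * h ^+ 2)).
  by rewrite -cP mulr_sumr -sumrB; apply: eq_bigr => k _; ring.
have A0 : 0 <= 8 * e * h ^+ 2 by rewrite mulr_ge0 ?sqr_ge0// mulr_ge0.
have B1 := bound _ A0.
have E3 : h ^+ 2 * (N%:R * P) = 2 * pi * h * P by rewrite -Nh; ring.
rewrite E1 E3 in up; rewrite E2 E3 in low.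
(* 184 is 8 times 23, and 8464 below is 16 times the square of 23, with 23 the factor in [e]. *)
have E4 : N%:R * (S * (8 * e * h ^+ 2)) = 2 * pi * 184 * S ^+ 2 * h ^+ 2 by rewrite -Nh /e; ring.
have E5 : N%:R * (16 * e ^+ 2 * h ^+ 2) = 2 * pi * (8464 * h) * S ^+ 2 * h ^+ 2 by rewrite -Nh /e; ring.
have pp : 0 <= 2 * pi :> R by rewrite mulr_ge0// ltW.
have E6 : 2 * pi * (8464 * h) * S ^+ 2 * h ^+ 2 <= 2 * pi * (8464 * (2 * pi)) * S ^+ 2 * h ^+ 2.
  have k : 8464 * h <= 8464 * (2 * pi) := ler_wpM2l (ler0n R 8464) h2p. 
  by rewrite ler_wpM2r ?sqr_ge0// ler_wpM2r ?sqr_ge0// ler_wpM2l.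
have E7 : 2 * pi * (184 + 8464 * (2 * pi)) * S ^+ 2 * h ^+ 2 =
  2 * pi * 184 * S ^+ 2 * h ^+ 2 + 2 * pi * (8464 * (2 * pi)) * S ^+ 2 * h ^+ 2 by ring.
have E8 : 0 <= 2 * pi * (8464 * (2 * pi)) * S ^+ 2 * h ^+ 2.
  have k8 : 0 <= 8464 * (2 * pi) :> R := mulr_ge0 (ler0n R 8464) pp.
  exact: mulr_ge0 (mulr_ge0 (mulr_ge0 pp k8) (sqr_ge0 S)) (sqr_ge0 h).
rewrite E5 in up; rewrite E4 in B1; rewrite E7.
exact: sandwich_bound up low B1 E6 E8.
Qed.

End AnnulusStep.

(** * The area theorem for univalent functions *)

Section AreaExpansion.
Context {R : realType}.
Local Open Scope classical_set_scope.
Local Open Scope complex_scope.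
Local Open Scope ring_scope.
Local Notation C := R[i].
Local Notation normc := (@ComplexField.Normc.normc R).
Local Notation leb := (@lebesgue_measure R).
Local Notation leb2 := (leb \x leb)%E.

Definition area_sum (a : nat -> C) N (t : R) : R := pi * \sum_(n < N) n%:R * normc (a n) ^+ 2 * t ^+ (2 * n).

(** The sum is the first-order term in the change of [area_sum] when the logarithm of the radius
    drops by [h]. The Taylor remainder of the exponential contributes [n (2 n h)^2] to the term of
    index [n], and [n^3 <= n^4] brings it under [S^2]. *)
Lemma area_sum_step (a : nat -> C) N (s t S h : R) : 0 <= s -> s <= t -> 0 <= h ->
  (forall N, \sum_(n < N) n%:R ^+ 2 * (normc (a n) * t ^+ n) <= S) ->
  `|2 * pi * h * \sum_(n < N) n%:R ^+ 2 * normc (a n) ^+ 2 * s ^+ (2 * n)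
    - (area_sum a N s - area_sum a N (s * expR (- h)))| <= 4 * pi * S ^+ 2 * h ^+ 2.
Proof.
move=> s0 st h0 aS; have p0 := pi_ge0 R; have t0 := le_trans s0 st.
have term0 n : 0 <= n%:R ^+ 2 * (normc (a n) * t ^+ n).
  by rewrite !mulr_ge0 ?exprn_ge0 ?normc_ge0.
have termS n : n%:R ^+ 2 * (normc (a n) * t ^+ n) <= S.
  by apply: le_trans (aS n.+1); rewrite big_ord_recr /= lerDr; apply: sumr_ge0.
have -> : 2 * pi * h * \sum_(n < N) n%:R ^+ 2 * normc (a n) ^+ 2 * s ^+ (2 * n)
    - (area_sum a N s - area_sum a N (s * expR (- h))) =
  pi * \sum_(n < N) n%:R * normc (a n) ^+ 2 * s ^+ (2 * n) * (expR (- (2 * n)%:R * h) - 1 - (- (2 * n)%:R * h)).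
  rewrite /area_sum -mulrBr -sumrB [2 * pi]mulrC -!mulrA -mulrBr; congr (_ * _).
  rewrite mulrA mulr_sumr -sumrB; apply: eq_bigr => n _.
  by rewrite exprMn mulNr -mulrN expRM_natl natrM; ring.
rewrite normrM ger0_norm// (_ : 4 * pi * S ^+ 2 * h ^+ 2 = pi * (4 * h ^+ 2 * S * S)); last by ring.
rewrite ler_wpM2l//; apply: le_trans (ler_norm_sum _ _ _) _.
apply: le_trans (_ : \sum_(n < N) (4 * h ^+ 2 * S) * (n%:R ^+ 2 * (normc (a n) * t ^+ n)) <= _); last first.
  by rewrite -mulr_sumr ler_wpM2l// !mulr_ge0 ?sqr_ge0//; apply: le_trans (termS 0%N).
apply: ler_sum => n _; rewrite normrM.
have e1 : `|expR (- (2 * n)%:R * h) - 1 - (- (2 * n)%:R * h)| <= (- (2 * n)%:R * h) ^+ 2.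
  by have [] := @expR_neg_bounds R (- (2 * n)%:R * h); rewrite ?mulNr ?oppr_le0 ?mulr_ge0.
have stn : s ^+ (2 * n) <= t ^+ n * t ^+ n.
  by rewrite -exprD addnn -mul2n lerXn2r ?nnegrE.
have nn0 : 0 <= n%:R * normc (a n) ^+ 2 * s ^+ (2 * n) by rewrite !mulr_ge0 ?exprn_ge0 ?normc_ge0.
rewrite (ger0_norm nn0).
apply: le_trans (_ : n%:R * normc (a n) ^+ 2 * (t ^+ n * t ^+ n) * (- (2 * n)%:R * h) ^+ 2 <= _).
  by rewrite ler_pM// ler_wpM2l// mulr_ge0 ?exprn_ge0 ?normc_ge0.
rewrite [leLHS](_ : _ = 4 * h ^+ 2 * (n%:R ^+ 3 * (normc (a n) * t ^+ n) ^+ 2)); last by rewrite natrM; ring.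
have h20 : 0 <= 4 * h ^+ 2 by rewrite mulr_ge0 ?sqr_ge0.
rewrite -[4 * h ^+ 2 * S * _]mulrA ler_wpM2l//.
apply: le_trans (_ : (n%:R ^+ 2 * (normc (a n) * t ^+ n)) * (n%:R ^+ 2 * (normc (a n) * t ^+ n)) <= _).
  rewrite [leRHS](_ : _ = n%:R ^+ 4 * (normc (a n) * t ^+ n) ^+ 2); last by ring.
  by rewrite ler_wpM2r ?sqr_ge0// -!natrX ler_nat; case: (n : nat) => // m; exact: leq_pexp2l.
by rewrite ler_wpM2r.
Qed.

(** The term of index 0 vanishes, so every other one carries at least a factor [q^2]. *)
Lemma area_sum_decay (a : nat -> C) N (t S q : R) : 0 <= t -> 0 <= q <= 1 ->
  (forall N, \sum_(n < N) n%:R ^+ 2 * (normc (a n) * t ^+ n) <= S) ->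
  0 <= area_sum a N (t * q) <= q ^+ 2 * (pi * S ^+ 2).
Proof.
move=> t0 /andP[q0 q1] aS; have p0 := pi_ge0 R.
have term0 n : 0 <= n%:R ^+ 2 * (normc (a n) * t ^+ n).
  by rewrite !mulr_ge0 ?exprn_ge0 ?normc_ge0.
have termS n : n%:R ^+ 2 * (normc (a n) * t ^+ n) <= S.
  by apply: le_trans (aS n.+1); rewrite big_ord_recr /= lerDr; apply: sumr_ge0.
apply/andP; split.
  by rewrite mulr_ge0//; apply: sumr_ge0 => n _; rewrite !mulr_ge0 ?exprn_ge0 ?normc_ge0 ?mulr_ge0.
rewrite mulrCA ler_wpM2l// expr2 -[S ^+ 2]/(S * S) !mulrA -expr2.
apply: le_trans (_ : \sum_(n < N) (q ^+ 2 * S) * (n%:R ^+ 2 * (normc (a n) * t ^+ n)) <= _); last first.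
  by rewrite -mulr_sumr ler_wpM2l// mulr_ge0 ?sqr_ge0//; apply: le_trans (termS 0%N).
apply: ler_sum => -[[|n] /= nN] _; first by rewrite mul0r mul0r expr0n mul0r mulr0.
have tE : t ^+ (2 * n.+1) = (t ^+ n.+1) ^+ 2 by rewrite mulnC exprM.
rewrite /= (exprMn _ t q) tE.
have qn : q ^+ (2 * n.+1) <= q ^+ 2 by apply: ler_wiXn2l => //; rewrite leq_pmulr.
apply: le_trans (_ : q ^+ 2 * ((n.+1%:R ^+ 2 * (normc (a n.+1) * t ^+ n.+1)) * (n.+1%:R ^+ 2 * (normc (a n.+1) * t ^+ n.+1))) <= _).
  rewrite [leLHS](_ : _ = q ^+ (2 * n.+1) * (n.+1%:R * (normc (a n.+1) * t ^+ n.+1) ^+ 2)); last by ring.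
  rewrite ler_pM ?exprn_ge0 ?mulr_ge0 ?sqr_ge0 ?normc_ge0 ?exprn_ge0//.
  rewrite [leRHS](_ : _ = n.+1%:R ^+ 4 * (normc (a n.+1) * t ^+ n.+1) ^+ 2); last first.
    by move: (t ^+ n.+1) (n.+1%:R : R) => x y; ring.
  by rewrite ler_wpM2r ?sqr_ge0// -natrX ler_nat -[leqLHS]expn1 leq_pexp2l.
by rewrite -[leRHS]mulrA ler_wpM2l ?sqr_ge0// ler_wpM2r.
Qed.

Lemma dist_sub_le (a1 a2 g b1 b2 k1 k2 : R) : `|a1 - a2 - g| <= k1 -> `|g - (b1 - b2)| <= k2 ->
  `|a1 - b1 - (a2 - b2)| <= k1 + k2.
Proof.
move=> h1 h2; apply: le_trans (lerD h1 h2).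
by apply: le_trans (ler_normD _ _); rewrite (_ : a1 - a2 - g + _ = a1 - b1 - (a2 - b2))//; ring.
Qed.

Lemma abs_sub_le_add (x y k : R) : 0 <= x -> 0 <= y -> x + y <= k -> `|x - y| <= k.
Proof. by move=> *; rewrite ler_norml; apply/andP; split; lra. Qed.

(** The difference [D] of area and partial sum changes by [O(h^2)] across one annulus. First [M] is
    fixed so large that at radius [t Q^(M+1)] both quantities are small; reaching that radius takes
    [(M + 1) N] annuli, whose total error is [O(h)] for fixed [M] and vanishes as [N] grows. *)
Theorem area_expansion f a (t : R) : (forall z, normc z < 1 -> exists c, cdiff f z c) ->
  {in disk 1 &, injective f} -> series_expansion f a -> 0 < t < 1 ->
  forall e, 0 < e -> exists N0, forall N, (N0 <= N)%N -> `|area f t - area_sum a N t| <= e.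
Proof.
move=> hf injf fa t01 e e0; have p0 := pi_gt0 R.
have [t0 t1] : 0 < t /\ t < 1 by apply/andP.
have [K [q [K0 q01 aK fK]]] := fa t t01.
have [S [S0 aS]] := coef_sum_le K0 q01 aK.
have fb w : normc w <= t -> normc (f w - a 0%N) <= K * q.
  by move=> wt; have := fK w 0%N wt; rewrite big_ord_recl big_ord0 addr0 expr0 mulr1 expr1.
have fin s : 0 < s -> s <= t -> (leb2 (dimage f s) < +oo)%E.
  move=> s0 st; have Kq : 0 <= 2 * (K * q) by rewrite !mulr_ge0 ?(ltW K0)//; case/andP: q01 => /ltW.
  apply: le_lt_trans (dimage_le (ltW (le_lt_trans st t1)) hf Kq _) (ltry _).
  move=> z zs; rewrite (_ : f z - f 0 = (f z - a 0%N) - (f 0 - a 0%N)); last by ring.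
  apply: le_trans (normc_triangle _ _) _; rewrite normc_opp [2 * _]mulr2n || rewrite normc_opp.
  have := fb z (le_trans (ltW zs) st); have : normc (f 0 - a 0%N) <= K * q by apply: fb; rewrite normc0 ltW.
  lra.
have [b fb0] : exists b, cdiff f 0 b by apply: hf; rewrite normc0.
have [d [K1 [d0 K10 L]]] := cdiff_lipschitz fb0.
have small s : 0 < s -> s <= t -> s < d -> 0 <= area f s <= (2 * (K1 * s)) ^+ 2.
  move=> s0 st sd; have fs := area_fin (fin s s0 st).
  rewrite -!lee_fin fs measure_ge0 /=; apply: dimage_le => //.
  - exact: ltW (le_lt_trans st t1).
  - by rewrite mulr_ge0 ?ltW.
  move=> z zs; have := L z (lt_trans zs sd); rewrite add0r => H; apply: le_trans H _.
  by rewrite ler_pM2l// ltW.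
(* [N] steps of logarithmic length [h = 2 pi / N] multiply the radius by exactly [Q], whatever [N]
   is. *)
pose Q := expR (- (2 * pi)) : R.
have Q0 : 0 < Q by exact: expR_gt0.
have Q1 : Q < 1 by rewrite expR_lt1 oppr_lt0 mulr_gt0.
pose W := (2 * K1) ^+ 2 + pi * S ^+ 2 + 1.
have piS : 0 <= pi * S ^+ 2 := mulr_ge0 (ltW p0) (sqr_ge0 S).
have W0 : 0 < W by rewrite ltr_wpDl// addr_ge0// sqr_ge0.
have Q01 : 0 <= Q < 1 by rewrite (ltW Q0) Q1.
have dm : 0 < Num.min d (Num.min 1 (e / (2 * W))) by rewrite !lt_min d0 ltr01 divr_gt0// mulr_gt0.
have [M HM] := exists_expr_lt Q01 dm.
move: HM; rewrite !lt_min => /and3P[Qd Q11 QW].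
pose K' := 2 * pi * (184 + 8464 * (2 * pi)) * S ^+ 2 + 4 * pi * S ^+ 2.
have K'0 : 0 <= K'.
  have k8 : 0 <= 184 + 8464 * (2 * pi) :> R.
    exact: addr_ge0 (ler0n R 184) (mulr_ge0 (ler0n R 8464) (mulr_ge0 (ler0n R 2) (ltW p0))).
  have p2 : 0 <= 2 * pi :> R := mulr_ge0 (ler0n R 2) (ltW p0).
  have p4 : 0 <= 4 * pi :> R := mulr_ge0 (ler0n R 4) (ltW p0).
  exact: addr_ge0 (mulr_ge0 (mulr_ge0 p2 k8) (sqr_ge0 S)) (mulr_ge0 p4 (sqr_ge0 S)).
pose X := K' * (M.+1)%:R * (2 * pi) ^+ 2.
have X0 : 0 <= X := mulr_ge0 (mulr_ge0 K'0 (ler0n R M.+1)) (sqr_ge0 _).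
exists (Num.bound (X / (e / 2))).+1 => N NN.
have N0 : (0 < N)%N by apply: leq_trans NN.
have N0' : 0 < N%:R :> R by rewrite ltr0n.
pose h : R := 2 * pi / N%:R.
have h0 : 0 < h by rewrite divr_gt0// mulr_gt0.
have Nh : N%:R * h = 2 * pi by rewrite /h mulrCA divff ?mulr1// gt_eqF.
pose s j := t * expR (- (j%:R * h)).
have s0 j : 0 < s j by rewrite mulr_gt0// expR_gt0.
have st j : s j <= t by rewrite ger_pMr// -expR0 ler_expR oppr_le0 mulr_ge0// ltW.
have sS j : s j.+1 = s j * expR (- h).
  by rewrite /s -mulrA -expRD -natr1 mulrDl mul1r opprD.
have aSj j N' : \sum_(n < N') n%:R ^+ 2 * (normc (a n) * s j ^+ n) <= S.
  apply: le_trans (aS N'); apply: ler_sum => n _; rewrite ler_wpM2l ?sqr_ge0// ler_wpM2l ?normc_ge0//.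
  by rewrite lerXn2r ?nnegrE ?(ltW (s0 j)) ?(ltW t0).
pose D j := area f (s j) - area_sum a N (s j).
have step j : `|D j - D j.+1| <= K' * h ^+ 2.
  have sj01 : 0 < s j < 1 by rewrite s0 (le_lt_trans (st j) t1).
  have h1 := @annulus_step _ f a (s j) S h N erefl hf injf fa sj01 (aSj j) N0 (fin _ (s0 j) (st j)).
  have h2 := @area_sum_step a N (s j) (s j) S h (ltW (s0 j)) (lexx _) (ltW h0) (aSj j).
  rewrite /D sS /K' mulrDl; exact: dist_sub_le h1 h2.
have tele m : `|D 0%N - D m| <= m%:R * (K' * h ^+ 2).
  elim: m => [|m IH]; first by rewrite subrr normr0 mul0r.
  rewrite (_ : D 0%N - D m.+1 = (D 0%N - D m) + (D m - D m.+1)); last by ring.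
  by apply: le_trans (ler_normD _ _) _; rewrite -natr1 mulrDl mul1r lerD.
have D0 : D 0%N = area f t - area_sum a N t by rewrite /D /s mul0r oppr0 expR0 mulr1.
pose m := (M.+1 * N)%N.
have sm : s m = t * Q ^+ M.+1.
  rewrite /s /Q -expRM_natl; congr (_ * expR _); rewrite mulrN; congr (- _).
  by rewrite natrM -mulrA Nh.
have QM0 : 0 < Q ^+ M.+1 by rewrite exprn_gt0.
have Dm : `|D m| <= e / 2.
  have smd : s m < d by rewrite sm (le_lt_trans _ Qd)// ler_piMl// ltW.
  have /andP[A0 A1] := small (s m) (s0 m) (st m) smd.
  have QM : 0 <= Q ^+ M.+1 <= 1 by rewrite !ltW.
  have /andP[B0 B1] := @area_sum_decay a N t S (Q ^+ M.+1) (ltW t0) QM aS.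
  rewrite -sm in B0 B1.
  have A2 : (2 * (K1 * s m)) ^+ 2 <= (Q ^+ M.+1) ^+ 2 * (2 * K1) ^+ 2.
    rewrite mulrA exprMn mulrC ler_wpM2r ?sqr_ge0// lerXn2r ?nnegrE ?(ltW (s0 m)) ?(ltW QM0)//.
    by rewrite sm ler_piMl ?(ltW QM0)// ltW.
  have Q2 : (Q ^+ M.+1) ^+ 2 <= Q ^+ M.+1 by rewrite expr2 ler_piMr// ltW.
  have QW' : Q ^+ M.+1 * W <= e / 2.
    apply: le_trans (ler_wpM2r (ltW W0) (ltW QW)) _.
    by rewrite le_eqVlt; apply/orP; left; apply/eqP; field; rewrite gt_eqF.
  have Wle : (Q ^+ M.+1) ^+ 2 * ((2 * K1) ^+ 2 + pi * S ^+ 2) <= Q ^+ M.+1 * W.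
    rewrite ler_pM ?sqr_ge0//; first by rewrite addr_ge0// sqr_ge0.
    by rewrite /W lerDl.
  rewrite mulrDr in Wle.
  have U : area f (s m) + area_sum a N (s m) <= e / 2.
    by apply: le_trans QW'; apply: le_trans Wle; apply: lerD => //; exact: le_trans A2.
  exact: abs_sub_le_add.
have Tm : m%:R * (K' * h ^+ 2) <= e / 2.
  have -> : m%:R * (K' * h ^+ 2) = X / N%:R.
    by rewrite /X -Nh /m natrM; field; rewrite gt_eqF.
  rewrite ler_pdivrMr// mulrC -ler_pdivrMr ?divr_gt0//; apply: ltW.
  apply: lt_le_trans (archi_boundP _) _; first by rewrite divr_ge0// ltW// divr_gt0.
  by rewrite ler_nat ltnW.
rewrite -D0 (_ : D 0%N = (D 0%N - D m) + D m); last by ring.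
by apply: le_trans (ler_normD _ _) _; rewrite [leRHS]splitr lerD// (le_trans (tele m)).
Qed.

End AreaExpansion.

(** * Areas for univalent functions and for monomials *)

Section AreaFormulas.
Context {R : realType}.
Local Open Scope classical_set_scope.
Local Open Scope complex_scope.
Local Open Scope ring_scope.
Local Notation C := R[i].
Local Notation normc := (@ComplexField.Normc.normc R).

Lemma univalent_cdiff (f : C -> C) : holomorphic_on_disk f ->
  forall z, normc z < 1 -> exists c, cdiff f z c.
Proof. by move=> hf z z1; apply: derivable_cdiff; apply: hf; apply/diskE. Qed.

Lemma univalent_area_series (f : C -> C) : univalent_on_disk f ->
  exists d : nat -> R, (forall n, 0 <= d n) /\
  forall t, 0 < t < 1 -> forall e, 0 < e -> exists N0, forall N, (N0 <= N)%N ->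
    `|area f t - pi * t ^+ 2 * \sum_(n < N) d n * (t ^+ 2) ^+ n| <= e.
Proof.
move=> [/univalent_cdiff hf injf]; have [a fa] := power_series_expansion hf.
exists (fun n => n.+1%:R * normc (a n.+1) ^+ 2); split => [n|t t01 e e0].
  by rewrite mulr_ge0 ?sqr_ge0.
have [N0 HN] := area_expansion hf injf fa t01 e0; exists N0 => N NN.
have := HN N.+1 (leq_trans NN (leqnSn N)).
rewrite /area_sum big_ord_recl mul0r mul0r add0r -[pi * t ^+ 2 * _]mulrA [t ^+ 2 * _]mulr_sumr.
rewrite (eq_bigr (fun n : 'I_N => t ^+ 2 * (n.+1%:R * normc (a n.+1) ^+ 2 * (t ^+ 2) ^+ n))) => [//|n _].
rewrite [in LHS](_ : t ^+ (2 * lift ord0 n) = t ^+ 2 * (t ^+ 2) ^+ n); last first.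
  by rewrite -exprS exprM.
by rewrite mulrCA.
Qed.

Lemma linear_area (c : C) (t : R) : c != 0 -> 0 < t < 1 -> area (fun z => c * z) t = pi * normc c ^+ 2 * t ^+ 2.
Proof.
move=> c0 t01; pose f z := c * z; pose a n : C := if n == 1%N then c else 0.
have hf z : normc z < 1 -> exists k, cdiff f z k.
  move=> _; exists c => e e0; exists 1 => // h _.
  by rewrite (_ : f (z + h) - f z - c * h = 0) ?normc0 ?mulr_ge0 ?normc_ge0 ?(ltW e0)// /f; ring.
have injf : {in disk 1 &, injective f} by move=> x y _ _ /(mulfI c0).
have fa : series_expansion f a.
  move=> s /andP[s0 s1]; exists (normc c + 1), s.
  have cp : 0 < normc c + 1 by rewrite ltr_wpDl// normc_ge0.
  split => //; first by rewrite s0.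
    move=> n; rewrite /a; case: eqP => [->|_]; last by rewrite normc0 mul0r mulr_ge0 ?exprn_ge0 ?ltW.
    by rewrite ler_wpM2r ?exprn_ge0 ?(ltW s0)// lerDl.
  move=> w [|N] ws; rewrite /f.
    rewrite big_ord_recl big_ord0 addr0 /a /= mul0r subr0 normc_mul expr1.
    by rewrite ler_pM ?normc_ge0// lerDl.
  rewrite 2!big_ord_recl /= /a /= mul0r add0r expr1 big1; last by move=> i _; rewrite mul0r.
  by rewrite addr0 subrr normc0 mulr_ge0 ?exprn_ge0 ?ltW.
apply/eqP; rewrite -subr_eq0 -normr_eq0 eq_le normr_ge0 andbT; apply/ler_addgt0Pr => e e0; rewrite add0r.
have [N0 HN] := area_expansion hf injf fa t01 e0.
(* At least two terms, so that the only nonzero coefficient, of index 1, is included. *)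
have := HN N0.+2 (leq_trans (leqnSn N0) (leqnSn _)).
rewrite /area_sum 2!big_ord_recl /= /a /= mul0r mul0r add0r mul1r big1 ?addr0 ?muln1 ?mulrA//.
by move=> i _; rewrite /= !expr0n /= addr0 sqrtr0 expr0n mulr0 mul0r.
Qed.

(** Multiplicity is not counted: [a z^n] has the same image of the disk of radius [t] as the linear
    map with factor [a t^(n-1)], since every complex number has an [n]-th root. *)
Lemma monomial_area (a : C) n (t : R) : a != 0 -> (0 < n)%N -> 0 < t < 1 ->
  area (fun z => a * z ^+ n) t = pi * normc a ^+ 2 * t ^+ (2 * n).
Proof.
move=> a0 n0 t01; have [t0 t1] : 0 < t /\ t < 1 by apply/andP.
have tc : t%:C != 0 by rewrite -normc_gt0 normc_real gtr0_norm.
pose c := a * t%:C ^+ n.-1.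
have c0 : c != 0 by rewrite mulf_neq0 ?expf_neq0.
have tn : t ^+ n.-1 * t = t ^+ n by rewrite -exprSr prednK.
have -> : area (fun z => a * z ^+ n) t = area (fun z => c * z) t.
  rewrite !areaE; congr (fine (_ _)); apply/seteqP; split => _ [z /diskE zt <-].
    exists (z ^+ n / t%:C ^+ n.-1); last first.
      by congr pt; rewrite /c -mulrA [t%:C ^+ _ * _]mulrC divfK ?expf_neq0.
    apply/diskE; rewrite normc_mul normc_exp normc_inv normc_exp normc_real gtr0_norm//.
    rewrite ltr_pdivrMr ?exprn_gt0// mulrC tn.
    by rewrite ltrXn2r ?nnegrE ?normc_ge0 ?(ltW t0)// -lt0n.
  have rE : (n.-root (t%:C ^+ n.-1 * z)) ^+ n = t%:C ^+ n.-1 * z by rewrite rootCK.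
  exists (n.-root (t%:C ^+ n.-1 * z)); last by congr pt; rewrite rE /c mulrA.
  apply/diskE; rewrite -(@ltr_pXn2r _ n)// ?nnegrE ?normc_ge0 ?(ltW t0)//.
  rewrite -normc_exp rE normc_mul normc_exp normc_real gtr0_norm// -tn.
  by rewrite ltr_pM2l// exprn_gt0.
rewrite linear_area// /c normc_mul normc_exp normc_real gtr0_norm//.
by rewrite mulnC exprM -tn; move: (t ^+ n.-1) => x; ring.
Qed.

End AreaFormulas.

(** * Integrals of powers against the weight *)

Section PowerIntegrals.
Context {R : realType}.
Local Open Scope classical_set_scope.
Local Open Scope ring_scope.
Local Notation leb := (@lebesgue_measure R).
Implicit Types (alpha l t r x : R).

Definition pdens alpha l t : R := (t ^+ 2) `^ l * mu_density alpha t.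
(** Under [s = t^2] this is the incomplete beta integral of [s^l (1 - s)^alpha] over [[0, r^2]]. *)
Definition pint alpha l r : R := \int[leb]_(t in `]0, r[) pdens alpha l t.

Lemma pdens_continuous alpha l t : 0 < t < 1 -> {for t, continuous (pdens alpha l)}.
Proof.
move=> /andP[t0 t1].
have t2 : 0 < t ^+ 2 by rewrite exprn_gt0.
have t3 : 0 < 1 - t ^+ 2 by rewrite subr_gt0 expr_lt1// ltW.
have cp (g : R -> R) (k : R) : 0 < g t -> {for t, continuous g} -> {for t, continuous (fun s => g s `^ k)}.
  move=> g0 cg; apply: (@continuous_comp _ _ _ g (fun x => x `^ k)) => //.
  apply: differentiable_continuous; apply/derivable1_diffP.
  by have [] := is_derive1_powR k g0.
have c2 : {for t, continuous (fun s : R => s ^+ 2)} by exact: exprn_continuous.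
apply: continuousM; first exact: cp.
apply: continuousM; last by apply: continuousM; [exact: cst_continuous|exact: cvg_id].
by apply: (cp (fun s => 1 - s ^+ 2)) => //; apply: continuousB => //; exact: cst_continuous.
Qed.

Lemma pdens_ge0 alpha l t : 0 <= t -> 0 <= pdens alpha l t.
Proof. by move=> t0; rewrite /pdens /mu_density !mulr_ge0 ?powR_ge0. Qed.

Lemma one_powR (p : R) : 1 `^ p = 1.
Proof. by rewrite powR1. Qed.

Lemma pdens_bound alpha l r : 0 <= l -> 0 < r < 1 -> exists M, 0 < M /\
  forall t, 0 < t <= r -> pdens alpha l t <= M.
Proof.
move=> l0 /andP[r0 r1]; have r2 : 0 < 1 - r ^+ 2 by rewrite subr_gt0 expr_lt1// ltW.
exists (2 * (1 + (1 - r ^+ 2) `^ alpha)); split; first by rewrite mulr_gt0// ltr_pwDl// powR_ge0.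
move=> t /andP[t0 tr]; have t1 := le_lt_trans tr r1; have t2 : 0 < 1 - t ^+ 2 by rewrite subr_gt0 expr_lt1// ltW.
have h1 : (t ^+ 2) `^ l <= 1.
  by rewrite -[leRHS](one_powR l) ge0_ler_powR ?nnegrE ?sqr_ge0// exprn_ile1 ?ltW.
have h2 : (1 - t ^+ 2) `^ alpha <= 1 + (1 - r ^+ 2) `^ alpha.
  have [a0|a0] := leP 0 alpha.
    rewrite -[leLHS]addr0 lerD ?powR_ge0// -[leRHS](one_powR alpha) ge0_ler_powR ?nnegrE ?(ltW t2)//.
    by rewrite gerBl sqr_ge0.
  rewrite -[leLHS]add0r lerD// -[alpha]opprK ![_ `^ - - alpha]powRN lef_pV2 ?posrE ?powR_gt0//.
  rewrite ge0_ler_powR ?nnegrE ?oppr_ge0 ?(ltW a0) ?(ltW t2) ?(ltW r2)// lerD2l lerN2.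
  by rewrite lerXn2r ?nnegrE ?(ltW t0) ?(ltW r0).
rewrite /pdens /mu_density; apply: le_trans (_ : 1 * ((1 + (1 - r ^+ 2) `^ alpha) * 2) <= _).
  rewrite ler_pM ?powR_ge0 ?mulr_ge0 ?powR_ge0 ?(ltW t0)//.
  rewrite ler_pM ?powR_ge0 ?mulr_ge0 ?(ltW t0)//; lra.
by rewrite mul1r mulrC.
Qed.

Lemma pdens_integrable alpha l r : 0 <= l -> 0 < r < 1 -> leb.-integrable `]0, r] (EFin \o pdens alpha l).
Proof.
move=> l0 r01; have [M [M0 HM]] := pdens_bound alpha l0 r01; move/andP: r01 => [r0 r1].
apply: measurable_bounded_integrable => //.
- by rewrite /= lebesgue_measure_itv /= lte_fin r0 -EFinB ltry.
- have m01 : measurable_fun (`]0, 1[ : set (measurableTypeR R)) (pdens alpha l).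
    by apply: open_continuous_measurable_fun => // t; rewrite inE /= in_itv /=; exact: pdens_continuous.
  apply: measurable_funS m01 => //.
  by move=> t /=; rewrite !in_itv /= => /andP[-> /le_lt_trans]; apply.
exists M; split; first exact: num_real.
move=> y My t /=; rewrite in_itv /= => tr; rewrite ger0_norm.
  by apply: le_trans (HM t tr) _; exact: ltW.
by apply: pdens_ge0; case/andP: tr => /ltW.
Qed.

Lemma pintE alpha l r : 0 <= l -> 0 < r < 1 -> pint alpha l r = \int[leb]_(t in `]0, r]) pdens alpha l t.
Proof.
move=> l0 r01; rewrite /pint Rintegral_itv_bndo_bndc//.
by apply: integrableS (pdens_integrable alpha l0 r01) => //; apply: subset_itvl; rewrite bnd_simp.
Qed.

Lemma pint_derive alpha l r : 0 <= l -> 0 < r < 1 -> is_derive r 1 (pint alpha l) (pdens alpha l r).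
Proof.
move=> l0 /andP[r0 r1]; pose u := (r + 1) / 2.
have ru : r < u by rewrite /u; lra.
have u1 : u < 1 by rewrite /u; lra.
have u01 : 0 < u < 1 by rewrite (lt_trans r0 ru).
have r01 : 0 < r < 1 by rewrite r0.
have br : (BRight 0 < BRight r)%O by rewrite bnd_simp.
have [d e] := @continuous_FTC1 R (pdens alpha l) (BRight 0) r u ru (pdens_integrable alpha l0 u01)
  br (@pdens_continuous alpha l r r01).
pose F x := \int[leb]_(t in [set` Interval (BRight 0) (BRight x)]) pdens alpha l t.
have eqF : \forall x \near r, F x = pint alpha l x.
  have rin : r \in `]0, 1[ by rewrite in_itv /= r0.
  apply: filterS (near_in_itvoo rin) => x; rewrite in_itv /= => x01.
  by rewrite pintE.
apply: near_eq_is_derive eqF _.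
by split; [exact: d|rewrite -derive1E e].
Qed.

Lemma pint_small alpha l e : 0 <= l -> 0 < e -> exists2 d, 0 < d < 1 & forall r, 0 < r < d -> 0 <= pint alpha l r <= e.
Proof.
move=> l0 e0; have h01 : 0 < (2^-1 : R) < 1 by apply/andP; split; lra.
have [M [M0 HM]] := pdens_bound alpha l0 h01.
exists (Num.min 2^-1 (e / M)).
  by rewrite lt_min divr_gt0// !gt_min; apply/andP; split; [lra|apply/orP; left; lra].
move=> r /andP[r0]; rewrite lt_min => /andP[r2 rM].
have r01 : 0 < r < 1 by rewrite r0 (lt_trans r2)//; lra.
apply/andP; split.
  by apply: Rintegral_ge0 => t /=; rewrite in_itv /= => /andP[/ltW t0 _]; exact: pdens_ge0.
rewrite pintE//; apply: le_trans (_ : M * r <= _); last by rewrite mulrC -ler_pdivlMr// ltW.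
apply: le_trans (_ : \int[leb]_(t in `]0, r]) M <= _).
  apply: le_Rintegral => //; first exact: pdens_integrable.
    apply: measurable_bounded_integrable => //.
    - by rewrite /= lebesgue_measure_itv /= lte_fin r0 -EFinB ltry.
    - by exists `|M|; split; [exact: num_real|move=> y My t _ /=; exact: ltW].
  by move=> t /=; rewrite in_itv /= => /andP[t0 tr]; apply: HM; rewrite t0 (le_trans tr)// ltW.
rewrite Rintegral_cst//= lebesgue_measure_itv /= lte_fin r0 -EFinB /= subr0.
exact: lexx.
Qed.

End PowerIntegrals.

(** * Monotonicity arguments on the unit interval *)

Section Calculus.
Context {R : realType}.
Local Open Scope classical_set_scope.
Local Open Scope ring_scope.
Implicit Types (f g : R -> R) (x y a b e : R).

Lemma is_derive_continuous f x d : is_derive x 1 f d -> {for x, continuous f}.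
Proof. by move=> [h _]; apply: differentiable_continuous; exact/derivable1_diffP. Qed.

Lemma mvt f df a b : a < b -> (forall x, a <= x <= b -> is_derive x 1 f (df x)) ->
  exists2 c, a < c < b & f b - f a = df c * (b - a).
Proof.
move=> ab fd; have [| |c cab ->] := @MVT R f df a b ab.
- by move=> x /[!in_itv]/= /andP[ax xb]; apply: fd; rewrite !ltW.
- apply: derivable_within_continuous => x; rewrite in_itv /= => /fd h; exact: ex_derive.
by exists c => //; move: cab; rewrite in_itv.
Qed.

Lemma nondecreasing01 f df : (forall x, 0 < x < 1 -> is_derive x 1 f (df x)) ->
  (forall x, 0 < x < 1 -> 0 <= df x) -> forall x y, 0 < x -> x <= y -> y < 1 -> f x <= f y.
Proof.
move=> fd df0 x y x0; rewrite le_eqVlt => /predU1P[->//|xy] y1.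
have [z zxy|c /andP[c0 c1] E] := @mvt f df x y xy.
  by case/andP: zxy => h1 h2; apply: fd; rewrite (lt_le_trans x0 h1) (le_lt_trans h2 y1).
rewrite -subr_ge0 E mulr_ge0 ?subr_ge0 ?(ltW xy)// df0//.
by rewrite (lt_trans x0 c0) (lt_trans c1 y1).
Qed.

Definition vanish0 f := forall e, 0 < e -> exists2 d, 0 < d & forall x, 0 < x < d -> x < 1 -> `|f x| <= e.

Lemma nonneg_of_derive f df : (forall x, 0 < x < 1 -> is_derive x 1 f (df x)) ->
  (forall x, 0 < x < 1 -> 0 <= df x) -> vanish0 f -> forall x, 0 < x < 1 -> 0 <= f x.
Proof.
move=> fd df0 f0 x /andP[x0 x1]; rewrite -oppr_le0; apply/ler_addgt0Pr => e e0; rewrite add0r.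
have [d d0 Hd] := f0 e e0; pose y := Num.min (d / 2) x.
have y0 : 0 < y by rewrite lt_min divr_gt0.
have yx : y <= x by rewrite ge_min lexx orbT.
have yd : y < d by rewrite gt_min; apply/orP; left; rewrite ltr_pdivrMr// ltr_pMr// ltr1n.
have := Hd y; rewrite y0 yd => /(_ isT (le_lt_trans yx x1)); rewrite ler_norml => /andP[h _].
by rewrite lerNl (le_trans h)// (nondecreasing01 fd df0).
Qed.

Lemma eq_of_derive f g df : (forall x, 0 < x < 1 -> is_derive x 1 f (df x)) ->
  (forall x, 0 < x < 1 -> is_derive x 1 g (df x)) -> vanish0 f -> vanish0 g ->
  forall x, 0 < x < 1 -> f x = g x.
Proof.
have W u v : (forall x, 0 < x < 1 -> is_derive x 1 u (df x)) ->
    (forall x, 0 < x < 1 -> is_derive x 1 v (df x)) -> vanish0 u -> vanish0 v ->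
    forall x, 0 < x < 1 -> u x <= v x.
  move=> du dv u0 v0 x x01; rewrite -subr_ge0.
  apply: (@nonneg_of_derive (fun x => v x - u x) (fun=> 0)) => // [y y01|e e0].
    by apply: (is_derive_eq (is_deriveB (dv y y01) (du y y01))); rewrite subrr.
  have e2 : 0 < e / 2 by rewrite divr_gt0.
  have [d1 d10 H1] := u0 _ e2; have [d2 d20 H2] := v0 _ e2.
  exists (Num.min d1 d2) => [|y]; first by rewrite lt_min d10.
  rewrite lt_min => /and3P[y0 y1 y2] y3; apply: le_trans (ler_normB _ _) _.
  by rewrite [leRHS]splitr lerD// ?H1 ?H2 ?y0.
by move=> df' dg f0 g0 x x01; apply/eqP; rewrite eq_le; apply/andP; split; exact: W.
Qed.

(** If [f x < 0], let [s] be the last point up to [x] with [f s >= f x / 2]; it exists by continuity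
    and the behaviour at 0. After [s] the function is negative, hence nondecreasing, so
    [f x >= f s >= f x / 2], a contradiction. *)
Lemma barrier f df : (forall x, 0 < x < 1 -> is_derive x 1 f (df x)) ->
  (forall x, 0 < x < 1 -> f x < 0 -> 0 <= df x) ->
  (forall e, 0 < e -> exists2 d, 0 < d & forall x, 0 < x < d -> x < 1 -> - e <= f x) ->
  forall x, 0 < x < 1 -> 0 <= f x.
Proof.
move=> fd df0 f0 x /andP[x0 x1]; rewrite leNgt; apply/negP => fx.
pose c := f x / 2; have c0 : c < 0 by rewrite /c ltr_pdivrMr// mul0r.
have fc : f x < c by rewrite /c ltr_pdivlMr//; lra.
have nc0 : 0 < - c by rewrite oppr_gt0.
have [d d0 Hd] := f0 _ nc0.
pose S := [set y | 0 < y <= x /\ c <= f y].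
pose y0 := Num.min (d / 2) x.
have y00 : 0 < y0 by rewrite lt_min divr_gt0.
have y0x : y0 <= x by rewrite ge_min lexx orbT.
have y0d : y0 < d by rewrite gt_min; apply/orP; left; rewrite ltr_pdivrMr// ltr_pMr// ltr1n.
have Sy0 : S y0.
  split; first by rewrite y00.
  by have := Hd y0; rewrite opprK y00 y0d; apply => //; exact: le_lt_trans x1.
have hS : has_sup S by split; [exists y0|exists x => y [/andP[]]].
pose s := sup S; have sx : s <= x by apply: ge_sup; [exists y0|move=> y [/andP[]]].
have s0 : 0 < s by apply: lt_le_trans y00 _; apply: ub_le_sup => //; case: hS.
have s1 := le_lt_trans sx x1.
have cs : {for s, continuous f} by apply: is_derive_continuous (fd s _); rewrite s0.
have fs : c <= f s.
  rewrite leNgt; apply/negP => fsc.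
  have /nbhs_ballP[e /= e0 He] : \forall y \near s, f y < c.
    exact: (cvgr_lt _ cs).
  have [y Sy] := sup_adherent e0 hS; rewrite -/s => sy.
  have ys : y <= s by apply: (ub_le_sup hS.2).
  have : f y < c by apply: He; rewrite /ball /= ger0_norm ?subr_ge0//; lra.
  by case: Sy => _; rewrite leNgt => /negP.
have {}sx : s < x by rewrite lt_neqAle sx andbT; apply/eqP => E; move: fs; rewrite E leNgt fc.
have [z /andP[z0 z1]|z /andP[z0 z1] E] := @mvt f df s x sx.
  by apply: fd; rewrite (lt_le_trans s0 z0) (le_lt_trans z1 x1).
have fz : f z < c.
  rewrite ltNge; apply/negP => h; have : z <= s; last by rewrite leNgt z0.
  by apply: ub_le_sup; [case: hS|split => //; rewrite (lt_trans s0 z0) ltW].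
have : 0 <= df z by apply: df0; [rewrite (lt_trans s0 z0) (lt_trans z1 x1)|exact: lt_trans c0].
move=> dz; have : 0 <= f x - f s by rewrite E mulr_ge0// subr_ge0 ltW.
by rewrite subr_ge0 leNgt (lt_le_trans fc fs).
Qed.

(** The [F_l] of the overview, with derivative [x^l (1 - x)^al]. *)
Definition pF (al l x : R) := pint al l (Num.sqrt x).

Lemma sqrt01 x : 0 < x < 1 -> 0 < Num.sqrt x < 1.
Proof.
move=> /andP[x0 x1]; rewrite sqrtr_gt0 x0 /=.
by rewrite -[ltRHS]sqrtr1 ltr_sqrt.
Qed.

Lemma pF_derive al l x : 0 <= l -> 0 < x < 1 -> is_derive x 1 (pF al l) (x `^ l * (1 - x) `^ al).
Proof.
move=> l0 x01; have s01 := sqrt01 x01; case/andP: (x01) => x0 x1.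
have h1 := pint_derive al l0 s01; have h2 := is_derive1_sqrt x0.
have := is_derive1_comp h1 h2; rewrite /pdens /mu_density sqr_sqrtr ?(ltW x0)// => H.
apply: is_derive_eq H _; case/andP: s01 => s0 _.
by field; rewrite gt_eqF.
Qed.

Lemma pF_vanish al l : 0 <= l -> vanish0 (pF al l) /\ forall x, 0 < x < 1 -> 0 <= pF al l x.
Proof.
move=> l0; split=> [e e0|x x01].
  have [d /andP[d0 d1] Hd] := pint_small al l0 e0.
  exists (d ^+ 2) => [|x /andP[x0 xd] x1]; first by rewrite exprn_gt0.
  have /andP[h0 h1] : 0 <= pint al l (Num.sqrt x) <= e.
    apply: Hd; rewrite sqrtr_gt0 x0 /= -[ltRHS]gtr0_norm// -sqrtr_sqr ltr_sqrt// exprn_gt0//.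
  by rewrite ger0_norm.
apply: Rintegral_ge0 => t /=; rewrite in_itv /= => /andP[/ltW t0 _]; exact: pdens_ge0.
Qed.

Lemma pF_gt0 al l x : 0 <= l -> 0 < x < 1 -> 0 < pF al l x.
Proof.
move=> l0 /andP[x0 x1]; have x2 : x / 2 < x by rewrite ltr_pdivrMr// ltr_pMr// ltr1n.
have x20 : 0 < x / 2 by rewrite divr_gt0.
have [z /andP[z0 z1]|c /andP[c0 c1] E] := @mvt (pF al l) (fun x => x `^ l * (1 - x) `^ al) (x / 2) x x2.
  by apply: pF_derive => //; rewrite (lt_le_trans x20 z0) (le_lt_trans z1 x1).
have [_ /(_ (x / 2))] := pF_vanish al l0; rewrite x20 (lt_trans x2 x1) => /(_ isT) h.
apply: le_lt_trans h _; rewrite -subr_gt0 E !mulr_gt0 ?powR_gt0 ?subr_gt0//.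
  exact: lt_trans c0.
exact: lt_trans x1.
Qed.

End Calculus.

(** * Convexity in the logarithmic variable and means of monomials *)

Section Convexity.
Context {R : realType}.
Local Open Scope classical_set_scope.
Local Open Scope complex_scope.
Local Open Scope ring_scope.
Local Notation normc := (@ComplexField.Normc.normc R).
Local Notation leb := (@lebesgue_measure R).
Implicit Types (F G H : R -> R) (al l x y u v w : R).

Definition cvx H := forall s x y, 0 <= s <= 1 -> x < 0 -> y < 0 ->
  H (s * x + (1 - s) * y) <= s * H x + (1 - s) * H y.

Lemma convex_function_cvx H : convex_function [set u : R^o | u < 0] H <-> cvx H.
Proof.
split=> [h s x y s01 x0 y0|h t x y]; last first.
  by rewrite !inE /= => x0 y0; rewrite !convRE; apply: h => //; rewrite ge0 le1.
pose t : {i01 R} := Itv01 (andP s01).1 (andP s01).2.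
by have := h t x y; rewrite !inE /= !convRE; apply.
Qed.

Lemma conv_lt0 s x y : 0 <= s <= 1 -> x < 0 -> y < 0 -> s * x + (1 - s) * y < 0.
Proof.
move=> /andP[s0 s1] x0 y0; have [m [m0 mx my]] : exists m, [/\ m < 0, x <= m & y <= m].
  by exists (Num.max x y); rewrite gt_max x0 y0 !le_max !lexx orbT.
apply: le_lt_trans m0; have : s * x <= s * m by rewrite ler_wpM2l.
have : (1 - s) * y <= (1 - s) * m by rewrite ler_wpM2l// subr_ge0.
lra.
Qed.

(** Passes from [u = log r] in the statement to [w = 2 u], the logarithm of [r^2], used by [lmean];
    [c] collects multiplicative constants of the mean. *)
Lemma cvx_scale2 G H c : (forall u, u < 0 -> H u = c + G (2 * u)) -> cvx H <-> cvx G.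
Proof.
move=> E; have neg := conv_lt0.
split=> h s x y s01 x0 y0.
  have x20 : x / 2 < 0 by rewrite ltr_pdivrMr// mul0r.
  have y20 : y / 2 < 0 by rewrite ltr_pdivrMr// mul0r.
  have := h s _ _ s01 x20 y20; rewrite !E ?neg// !mulrDr ![2 * (_ * (_ / 2))]mulrCA.
  by rewrite ![2 * (_ / 2)]mulrC !divfK//; lra.
rewrite !E ?neg// mulrDr ![2 * (_ * _)]mulrCA.
have := h s (2 * x) (2 * y) s01; rewrite !pmulr_rlt0// => /(_ x0 y0); lra.
Qed.

Lemma cvx_derive H h : (forall w, w < 0 -> is_derive w 1 H (h w)) ->
  (forall v w, v <= w -> w < 0 -> h v <= h w) -> cvx H.
Proof.
move=> Hd hm.
have W s x y : 0 <= s <= 1 -> x < y -> y < 0 -> H (s * x + (1 - s) * y) <= s * H x + (1 - s) * H y.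
  move=> /andP[s0 s1] xy y0; set z := s * x + _.
  have zx : z - x = (1 - s) * (y - x) by rewrite /z; ring.
  have yz : y - z = s * (y - x) by rewrite /z; ring.
  have yx : 0 < y - x by rewrite subr_gt0.
  have [E|s00] := eqVneq s 0; first by rewrite /z E !(mul0r, add0r, subr0, mul1r).
  have [E|s11] := eqVneq s 1; first by rewrite /z E !(subrr, mul0r, addr0, mul1r).
  have xz : x < z by rewrite -subr_gt0 zx mulr_gt0// subr_gt0 lt_neqAle s11.
  have zy : z < y by rewrite -subr_gt0 yz mulr_gt0// lt_neqAle eq_sym s00.
  have z0 := lt_trans zy y0.
  have [t /andP[_ tz]|c1 /andP[_ c1z] E1] := @mvt R H h x z xz; first by apply: Hd; apply: le_lt_trans z0.
  have [t /andP[_ tz]|c2 /andP[zc2 c2y] E2] := @mvt R H h z y zy; first by apply: Hd; apply: le_lt_trans y0.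
  have k : h c1 <= h c2 by apply: hm; [rewrite ltW// (lt_trans c1z)|exact: lt_trans y0].
  rewrite -subr_ge0.
  have -> : s * H x + (1 - s) * H y - H z = (1 - s) * (H y - H z) - s * (H z - H x) by ring.
  rewrite E1 E2 zx yz.
  have -> : (1 - s) * (h c2 * (s * (y - x))) - s * (h c1 * ((1 - s) * (y - x)))
    = (1 - s) * s * (y - x) * (h c2 - h c1) by ring.
  by rewrite !mulr_ge0// ?subr_ge0// ltW.
move=> s x y s01 x0 y0; have [xy|yx|->] := ltgtP x y; first exact: W.
  have := W (1 - s) y x; rewrite subKr [(1 - s) * y + _]addrC [(1 - s) * H y + _]addrC; apply => //.
  by case/andP: s01 => ? ?; apply/andP; split; lra.
by rewrite -!mulrDl addrC subrK !mul1r.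
Qed.

Lemma cvx_slope H x y z : cvx H -> x < y -> y < z -> z < 0 ->
  (H y - H x) * (z - y) <= (H z - H y) * (y - x).
Proof.
move=> h xy yz z0; have zx : 0 < z - x by rewrite subr_gt0 (lt_trans xy).
pose s := (z - y) / (z - x).
have E : s * (z - x) = z - y by rewrite /s divfK// gt_eqF.
have := h s x z; have -> : s * x + (1 - s) * z = y.
  by have -> : s * x + (1 - s) * z = z - s * (z - x); [ring|rewrite E; ring].
have s01 : 0 <= s <= 1.
  apply/andP; split; first by rewrite divr_ge0 ?(ltW zx)// subr_ge0 ltW.
  by rewrite /s ler_pdivrMr// mul1r lerD2l lerN2 ltW.
move=> /(_ s01 (lt_trans xy (lt_trans yz z0)) z0) => k.
have {k} : H y * (z - x) <= (s * H x + (1 - s) * H z) * (z - x) by rewrite ler_wpM2r// ltW.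
have -> : (s * H x + (1 - s) * H z) * (z - x) =
  (s * (z - x)) * H x + (z - x - s * (z - x)) * H z by ring.
rewrite E; lra.
Qed.

(* The logarithm of the mean of [z^n] for [l = n - beta], in the variable [w = 2 log r]. *)
Definition lmean al l w : R := ln (pF al l (expR w)) - ln (pF al 0 (expR w)).

Lemma exp01 w : w < 0 -> 0 < expR w < 1.
Proof. by move=> w0; rewrite expR_gt0 expR_lt1. Qed.

Lemma pF_exp2 al l u : pF al l (expR (2 * u)) = pint al l (expR u).
Proof.
by rewrite /pF expRM_natl sqrtr_sqr ger0_norm ?expR_ge0.
Qed.

Lemma pint_gt0 al l r : 0 <= l -> 0 < r < 1 -> 0 < pint al l r.
Proof.
move=> l0 /andP[r0 r1]; have := @pF_gt0 R al l (r ^+ 2) l0.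
rewrite /pF sqrtr_sqr ger0_norm ?ltW//; apply.
by rewrite exprn_gt0//= expr_lt1// ltW.
Qed.

Lemma pint0E al r : \int[leb]_(t in `]0, r[) mu_density al t = pint al 0 r.
Proof. by apply: eq_Rintegral => t _; rewrite /pdens powRr0 mul1r. Qed.

Lemma area_mean_monomial al beta (a : R[i]) n : a != 0 -> (0 < n)%N -> 0 <= beta <= 1 ->
  exists2 c, 0 < c & forall r, 0 < r < 1 ->
    area_mean al beta (fun z => a * z ^+ n) r = c * (pint al (n%:R - beta) r / pint al 0 r).
Proof.
move=> a0 n0 /andP[b0 b1]; have l0 : 0 <= n%:R - beta by rewrite subr_ge0 (le_trans b1)// ler1n.
have pi0 := pi_gt0 R.
have na0 : 0 < normc a ^+ 2.
  by rewrite exprn_gt0// lt_neqAle eq_sym normc_ge0 andbT normc_eq0.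
exists (pi * normc a ^+ 2 / pi `^ beta); first by rewrite divr_gt0 ?powR_gt0// mulr_gt0.
move=> r r01; case/andP: (r01) => r0 r1; rewrite /area_mean pint0E mulrA; congr (_ / _).
rewrite /pint -RintegralZl//; last first.
  by apply: integrableS (pdens_integrable al l0 r01) => //; apply: subset_itvl; rewrite bnd_simp.
apply: eq_Rintegral => t; rewrite inE /= in_itv /= => /andP[t0 tr].
have t1 := lt_trans tr r1; have t2 : 0 < t ^+ 2 by rewrite exprn_gt0.
rewrite /Phi_A monomial_area ?t0// powRM ?(ltW pi0) ?(ltW t2)// /pdens.
have -> : t ^+ (2 * n) = (t ^+ 2) `^ (n%:R - beta) * (t ^+ 2) `^ beta.
  rewrite -powRD; last by rewrite (gt_eqF t2) implybT.
  by rewrite subrK powR_mulrn ?(ltW t2)// exprM.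
field.
by rewrite !gt_eqF ?powR_gt0.
Qed.

Lemma monomial_cvx al beta (a : R[i]) n : a != 0 -> (0 < n)%N -> 0 <= beta <= 1 ->
  [/\ positive_on01 (area_mean al beta (fun z => a * z ^+ n)),
     loglog_convex (area_mean al beta (fun z => a * z ^+ n)) <-> cvx (lmean al (n%:R - beta)) &
     loglog_concave (area_mean al beta (fun z => a * z ^+ n)) <-> cvx (fun w => - lmean al (n%:R - beta) w)].
Proof.
move=> a0 n0 b01; have [c c0 E] := area_mean_monomial al a0 n0 b01.
have l0 : 0 <= n%:R - beta by case/andP: b01 => _ b1; rewrite subr_ge0 (le_trans b1)// ler1n.
have H u : u < 0 -> ln (area_mean al beta (fun z => a * z ^+ n) (expR u)) = ln c + lmean al (n%:R - beta) (2 * u).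
  move=> u0; have r01 := exp01 u0; rewrite E// /lmean !pF_exp2.
  by rewrite lnM ?ln_div ?posrE ?divr_gt0 ?pint_gt0.
split.
- by move=> r r01; rewrite E// mulr_gt0// divr_gt0// pint_gt0.
- by rewrite /loglog_convex convex_function_cvx; apply: cvx_scale2 H.
- rewrite /loglog_concave convex_function_cvx; apply: (@cvx_scale2 _ _ (- ln c)) => u /H ->.
  by rewrite opprD.
Qed.

End Convexity.

(** * Log-convexity of consecutive ratios for exponents in [[-3, 0]] *)

Section Ratios.
Context {R : realType}.
Local Open Scope classical_set_scope.
Local Open Scope ring_scope.
Implicit Types (f g : R -> R) (x y al l w : R).

Lemma derB f g x df dg : is_derive x 1 f df -> is_derive x 1 g dg ->
  is_derive x 1 (fun y => f y - g y) (df - dg).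
Proof. by move=> h1 h2; exact: (is_derive_eq (is_deriveB h1 h2)). Qed.

Lemma derD f g x df dg : is_derive x 1 f df -> is_derive x 1 g dg ->
  is_derive x 1 (fun y => f y + g y) (df + dg).
Proof. by move=> h1 h2; exact: (is_derive_eq (is_deriveD h1 h2)). Qed.

Lemma derM f g x df dg : is_derive x 1 f df -> is_derive x 1 g dg ->
  is_derive x 1 (fun y => f y * g y) (df * g x + f x * dg).
Proof.
move=> h1 h2; apply: (is_derive_eq (is_deriveM h1 h2)).
by rewrite /GRing.scale /= addrC [g x * df]mulrC.
Qed.

Lemma derC (c : R) x : is_derive x 1 (fun=> c) 0.
Proof. exact: is_derive_cst. Qed.

Lemma derI x : is_derive x 1 (fun y : R => y) 1.
Proof. exact: is_derive_id. Qed.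

Lemma derV f x df : f x != 0 -> is_derive x 1 f df -> is_derive x 1 (fun y => (f y)^-1) (- df / f x ^+ 2).
Proof.
move=> f0 h; apply: (is_derive_eq (is_deriveV f0 h)).
by rewrite /GRing.scale /= mulrC mulrN mulNr.
Qed.

Lemma derX f x df n : is_derive x 1 f df -> is_derive x 1 (fun y => f y ^+ n) (n%:R * f x ^+ n.-1 * df).
Proof.
move=> h; elim: n => [|n IH]; first by rewrite !mul0r; exact: derC.
have -> : (fun y => f y ^+ n.+1) = (fun y => f y * f y ^+ n) by apply: funext => y; rewrite exprS.
apply: (is_derive_eq (derM h IH)); case: n {IH} => [|n] /=; first by rewrite !expr0; ring.
rewrite -[n.+2]addn1 natrD exprS; move: (f x ^+ n) => p; ring.
Qed.

Lemma powers_derive l al x : 0 < x < 1 -> is_derive x 1 (fun y => y `^ l * (1 - y) `^ al)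
  (l * x `^ (l - 1) * (1 - x) `^ al - x `^ l * (al * (1 - x) `^ (al - 1))).
Proof.
move=> /andP[x0 x1]; have h1 := is_derive1_powR l x0.
have x10 : 0 < 1 - x by rewrite subr_gt0.
have h2 := @is_derive1_comp R (fun y => y `^ al) (fun y => 1 - y) x _ _ (is_derive1_powR al x10) (derB (derC 1 x) (derI x)).
by apply: (is_derive_eq (derM h1 h2)); rewrite /= sub0r mulrN1 mulrN.
Qed.

Lemma powR_shift x l : 0 < x -> x `^ (l + 1) = x `^ l * x.
Proof. by move=> x0; rewrite powRD ?(gt_eqF x0) ?implybT// powRr1// ltW. Qed.

Lemma powR_vanish l : 0 < l -> vanish0 (fun x : R => x `^ l).
Proof.
move=> l0 e e0; exists (e `^ l^-1); first exact: powR_gt0.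
move=> x /andP[x0 xe] x1; rewrite ger0_norm ?powR_ge0//.
have -> : e = (e `^ l^-1) `^ l by rewrite -powRrM mulVf ?gt_eqF// powRr1// ltW.
by apply: ge0_ler_powR => //; rewrite ?nnegrE ?powR_ge0// ltW.
Qed.

Lemma vanish0_le f g K : (forall x, 0 < x < 1/2 -> `|g x| <= K * `|f x|) -> 0 < K -> vanish0 f -> vanish0 g.
Proof.
move=> h K0 hf e e0; have eK : 0 < e / K by rewrite divr_gt0.
have [d d0 Hd] := hf _ eK; exists (Num.min d (1/2)) => [|x].
  by rewrite lt_min d0 divr_gt0.
rewrite lt_min => /and3P[x0 x1 x2] x3; apply: le_trans (h x _) _; first by rewrite x0.
by rewrite mulrC -ler_pdivlMr// Hd// x0.
Qed.

Lemma powR_half_bound c y : 1/2 <= y <= 1 -> y `^ c <= 1 + (1/2) `^ c.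
Proof.
move=> /andP[y2 y1]; have h0 : 0 < 1/2 :> R by rewrite divr_gt0.
have y0 := lt_le_trans h0 y2.
have [c0|c0] := leP 0 c.
  rewrite -[leLHS]addr0 lerD ?powR_ge0// -[leRHS](one_powR c).
  by rewrite ge0_ler_powR ?nnegrE ?(ltW y0).
rewrite -[leLHS]add0r lerD// -[c]opprK ![_ `^ - - c]powRN lef_pV2 ?posrE ?powR_gt0//.
by rewrite ge0_ler_powR ?nnegrE ?oppr_ge0 ?(ltW c0) ?(ltW y0) ?(ltW h0).
Qed.

Lemma powers_vanish l al : 0 < l -> vanish0 (fun x : R => x `^ l * (1 - x) `^ al).
Proof.
move=> l0; apply: (vanish0_le (K := 1 + (1/2) `^ al)) (powR_vanish l0).
  move=> x /andP[x0 x2]; rewrite normrM mulrC [`|(1 - x) `^ _|]ger0_norm ?powR_ge0//.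
  by rewrite ler_wpM2r// powR_half_bound//; lra.
by rewrite ltr_pwDl// powR_ge0.
Qed.

(** Write [B = a - 1 - A]. For [B >= 0] the constant term is [A - B = 2 A + 1 - a >= 3 - a], where
    [a <= 3] is used. For [B < 0] the expression decreases in [t], and at the endpoint
    [t = 1 / (A + 1)] it is [A a / (A + 1) >= 0]. *)
Lemma S_nonneg (A a t : R) : 1 <= A -> 0 <= a <= 3 -> 0 <= t -> t * (A + 1) <= 1 ->
  0 <= (A - (a - 1 - A)) + (a - 1 - A) * (2 * A + 1) * t.
Proof.
move=> A1 /andP[a0 a3] t0 tA; have [B0|B0] := leP 0 (a - 1 - A).
  by rewrite addr_ge0//; [lra|rewrite !mulr_ge0//; lra].
have A10 : 0 < A + 1 by lra.
rewrite -(pmulr_lge0 _ A10).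
have h : (2 * A + 1) * (1 - t * (A + 1)) * (a - 1 - A) <= 0.
  rewrite mulr_ge0_le0 ?(ltW B0)//; apply: mulr_ge0; lra.
have h2 : 0 <= A * a by apply: mulr_ge0; lra.
nra.
Qed.

(** Bounds the factor of [g] in [dgE]: its only term without a factor [x] is [- (A + 1)], which may
    be dropped. *)
Lemma Lam_le (A B s x : R) : 0 <= s <= 1 -> 0 <= x <= 1 -> 0 <= A ->
  x * (1 - s) * (1 + 2 * B * (1 - s)) - (A + 1) + x * s * (1 + B * (1 - s)) - B * x * s ^+ 2
    <= (2 + 4 * `|B|) * x.
Proof.
move=> /andP[s0 s1] /andP[x0 x1] A0; set b := `|B|.
have bB : B <= b by exact: ler_norm.
have bB' : - B <= b by rewrite /b -normrN; exact: ler_norm.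
have b0 : 0 <= b by exact: normr_ge0.
have t0 : 0 <= 1 - s by lra.
have st : 0 <= s * (1 - s) by exact: mulr_ge0.
have tt : 0 <= (1 - s) ^+ 2 by exact: sqr_ge0.
have ss : 0 <= s ^+ 2 by exact: sqr_ge0.
have h : (1 - s) * (1 + 2 * B * (1 - s)) + s * (1 + B * (1 - s)) - B * s ^+ 2 <= 2 + 4 * b.
  have k1 : 0 <= (b - B) * (1 - s) ^+ 2 by rewrite mulr_ge0// subr_ge0.
  have k2 : 0 <= (b - B) * (s * (1 - s)) by rewrite mulr_ge0// subr_ge0.
  have k3 : 0 <= (b + B) * s ^+ 2 by rewrite mulr_ge0//; lra.
  have e1 : (1 - s) ^+ 2 + s * (1 - s) + s ^+ 2 <= 1 by nra.
  have e2 : 0 <= b * (1 - ((1 - s) ^+ 2 + s * (1 - s) + s ^+ 2)) by rewrite mulr_ge0// subr_ge0.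
  have e3 : 0 <= b * (1 - (1 - s) ^+ 2) by rewrite mulr_ge0//; nra.
  nra.
have := ler_wpM2l x0 h; nra.
Qed.

Section Fixed.
Variables (al l : R).
Hypotheses (l0 : 0 <= l) (al0 : - 3 <= al <= 0).
Let A := l + 1.
Let B := - al - 1 - A.
Let F := pF al l.
Let G := pF al (l + 1).
Let p x := x `^ l * (1 - x) `^ al.

Let l10 : 0 <= l + 1. Proof. by rewrite addr_ge0. Qed.
Let A1 : 1 <= A. Proof. by rewrite lerDr. Qed.
Let lp : 0 < l + 1. Proof. by rewrite ltr_wpDl. Qed.

Let dF x : 0 < x < 1 -> is_derive x 1 F (p x).
Proof. by move=> x01; exact: pF_derive. Qed.

Let dG x : 0 < x < 1 -> is_derive x 1 G (p x * x).
Proof.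
move=> x01; have := pF_derive al l10 x01; rewrite powR_shift; last by case/andP: x01.
by rewrite /p mulrAC.
Qed.

Let F0 x : 0 < x < 1 -> 0 < F x. Proof. by move=> x01; exact: pF_gt0. Qed.
Let G0 x : 0 < x < 1 -> 0 < G x. Proof. by move=> x01; exact: pF_gt0. Qed.

Let vF : vanish0 F. Proof. by case: (pF_vanish al l0). Qed.
Let vG : vanish0 G. Proof. by case: (pF_vanish al l10). Qed.
Let vlin (f g : R -> R) (c d : R) : vanish0 f -> vanish0 g -> vanish0 (fun x => c * f x + d * g x).
Proof.
move=> hf hg e e0; pose k := 1 + `|c| + `|d|.
have k0 : 0 < k by rewrite /k -addrA ltr_pwDl// addr_ge0.
have ek : 0 < e / k by rewrite divr_gt0.
have [d1 d10 H1] := hf _ ek; have [d2 d20 H2] := hg _ ek.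
exists (Num.min d1 d2) => [|x]; first by rewrite lt_min d10.
rewrite lt_min => /and3P[x0 x1 x2] x3; have h1 := H1 x; have h2 := H2 x.
rewrite x0 x1 in h1; rewrite x0 x2 in h2; have {}h1 := h1 isT x3; have {}h2 := h2 isT x3.
apply: le_trans (ler_normD _ _) _; rewrite !normrM.
apply: le_trans (_ : `|c| * (e / k) + `|d| * (e / k) <= _); first by rewrite lerD// ler_wpM2l.
by rewrite -mulrDl mulrA ler_pdivrMr// mulrC ler_wpM2l ?(ltW e0)// /k; lra.
Qed.
Let vxF : vanish0 (fun x => x * F x).
Proof.
apply: (vanish0_le (K := 1)) vF => // x /andP[x0 x2]; rewrite mul1r normrM ler_piMl//.
by rewrite ger0_norm; lra.
Qed.

Let p0 x : 0 < x < 1 -> 0 < p x.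
Proof. by move=> /andP[x0 x1]; rewrite mulr_gt0 ?powR_gt0// subr_gt0. Qed.

(** Integration by parts: the derivative of [x^(l+1) (1 - x)^(al+1)] is [p x (A + B x)]. *)
Let identity x : 0 < x < 1 -> A * F x + B * G x = p x * x * (1 - x).
Proof.
move=> x01; have -> : p x * x * (1 - x) = x `^ (l + 1) * (1 - x) `^ (al + 1).
  by case/andP: x01 => x0 x1; rewrite !powR_shift ?subr_gt0// /p; ring.
move: x x01; apply: (@eq_of_derive _ _ _ (fun x => A * p x + B * (p x * x))).
- move=> x x01; apply: (is_derive_eq (derD (derM (derC A x) (dF x01)) (derM (derC B x) (dG x01)))).
  by rewrite !mul0r !add0r.
- move=> x x01; apply: (is_derive_eq (powers_derive (l + 1) (al + 1) x01)).
  case/andP: x01 => x0 x1; rewrite !addrK !powR_shift ?subr_gt0// /p /B /A; ring.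
- exact: vlin.
- exact: powers_vanish.
Qed.

Let upper x : 0 < x < 1 -> G x <= x * F x.
Proof.
move=> x01; rewrite -subr_ge0.
apply: (@nonneg_of_derive _ (fun x => x * F x - G x) F) x01 => [y y01|y /F0/ltW//|].
  apply: (is_derive_eq (derB (derM (derI y) (dF y01)) (dG y01))); ring.
by have := vlin 1 (-1) vxF vG; under eq_fun do rewrite mul1r mulN1r.
Qed.

(** Since [al <= 0], the weight [(1 - x)^al] is nondecreasing, which gives [A F <= x p]; integrating
    once more gives the claim. For [al = 0] it is an equality. *)
Let lower x : 0 < x < 1 -> A * (x * F x) <= (A + 1) * G x.
Proof.
have H : forall y, 0 < y < 1 -> 0 <= y `^ (l + 1) * (1 - y) `^ al - A * F y.
  apply: (@nonneg_of_derive _ _ (fun x => - al * (x `^ (l + 1) * (1 - x) `^ (al - 1)))) => [y y01|y /andP[y0 y1]|].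
  - apply: (is_derive_eq (derB (powers_derive (l + 1) al y01) (derM (derC A y) (dF y01)))).
    rewrite addrK /p /A; ring.
  - by rewrite !mulr_ge0 ?powR_ge0// oppr_ge0; case/andP: al0.
  - by have := vlin 1 (- A) (powers_vanish al lp) vF; under eq_fun do rewrite mul1r mulNr.
move=> x01; rewrite -subr_ge0.
apply: (@nonneg_of_derive _ (fun x => (A + 1) * G x - A * (x * F x)) (fun y => y `^ (l + 1) * (1 - y) `^ al - A * F y)) x01; last first.
- by have := vlin (A + 1) (- A) vG vxF; under eq_fun do rewrite mulNr.
- exact: H.
- move=> y y01; apply: (is_derive_eq (derB (derM (derC (A + 1) y) (dG y01)) (derM (derC A y) (derM (derI y) (dF y01))))).
  case/andP: y01 => y0 y1; rewrite powR_shift// /p; ring.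
Qed.

(** The [p]-weighted average of the variable over [[0, x]], divided by [x]. By [identity], [p / F]
    is rational in [x] and [s], so [s] solves the Riccati equation with right-hand side [ds], and
    the convexity question becomes algebra in [x] and [s]. *)
Let s x := G x / (x * F x).
Let ds x := ((1 - s x) * (A + B * x * s x) / (1 - x) - s x) / x.

Let sE x : 0 < x < 1 -> G x = s x * x * F x.
Proof. by move=> x01; rewrite /s -mulrA divfK// mulf_neq0// gt_eqF ?F0//; case/andP: x01. Qed.

Let pE x : 0 < x < 1 -> p x = F x * (A + B * x * s x) / (x * (1 - x)).
Proof.
move=> x01; case/andP: (x01) => x0 x1; apply: (canRL (mulfK _)).
  by rewrite mulf_neq0// ?subr_eq0 gt_eqF.
by rewrite mulrA -identity// sE//; ring.
Qed.

Let s_bounds x : 0 < x < 1 -> [/\ 0 < s x, s x <= 1 & (1 - s x) * (A + 1) <= 1].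
Proof.
move=> x01; have xF : 0 < x * F x by rewrite mulr_gt0 ?F0//; case/andP: x01.
split; first by rewrite divr_gt0 ?G0.
  by rewrite ler_pdivrMr// mul1r upper.
have := lower x01; rewrite sE// (_ : (A + 1) * _ = (A + 1) * s x * (x * F x)); last by ring.
by rewrite ler_pM2r//; lra.
Qed.

Let s_derive x : 0 < x < 1 -> is_derive x 1 s (ds x).
Proof.
move=> x01; have fx := F0 x01; case/andP: (x01) => x0 x1.
have n0 : x * F x != 0 by rewrite mulf_neq0// gt_eqF.
apply: (is_derive_eq (derM (dG x01) (@derV (fun y => y * F y) x _ n0 (derM (derI x) (dF x01))))).
rewrite sE// pE// /ds; move: (s x) (F x) fx => t f f0; field.
by rewrite subr_eq0 !gt_eqF.
Qed.

(* Up to positive factors, [g] is the derivative of [kap] below, and [kap] is [x d/dx] of [log (G x / F x)].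
   By [dgE], [x (1 - x) g'] is [g] times a factor that is [O(x)] from above, plus a nonnegative term;
   so [g (1 - x)^M] cannot decrease where it is negative. *)
Let g x := 1 - (A + 1) * (1 - s x) - x * s x ^+ 2 * (1 + B * (1 - s x)).
Let dg x := (A + 1) * ds x - (s x ^+ 2 * (1 + B * (1 - s x))
   + x * (2 * s x * ds x) * (1 + B * (1 - s x)) - x * s x ^+ 2 * (B * ds x)).

Let g_derive x : 0 < x < 1 -> is_derive x 1 g (dg x).
Proof.
move=> x01; have h := s_derive x01; have h1 := derB (derC 1 x) h.
apply: (is_derive_eq (derB (derB (derC 1 x) (derM (derC (A + 1) x) h1))
  (derM (derM (derI x) (derX 2 h)) (derD (derC 1 x) (derM (derC B x) h1))))).
rewrite /dg; ring.
Qed.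

Let dgE x : 0 < x < 1 -> x * (1 - x) * dg x =
  g x * (x * (1 - s x) * (1 + 2 * B * (1 - s x)) - (A + 1) + x * s x * (1 + B * (1 - s x)) - B * x * s x ^+ 2)
  + x * (1 - s x) ^+ 2 * ((A - B) + B * (2 * A + 1) * (1 - s x)).
Proof.
move=> /andP[x0 x1]; rewrite /dg /g /ds; move: (s x) => t; field.
by rewrite subr_eq0 !gt_eqF.
Qed.

Let g_ge0 x : 0 < x < 1 -> 0 <= g x.
Proof.
(* [M.+1] dominates the constant of [Lam_le], so where [g < 0] the derivative of [(1 - x)^(M+1)]
   outweighs the term containing [g] in [dgE]. *)
have [M HM] : exists M, 2 + 4 * `|B| <= M.+1%:R.
  exists (Num.truncn (2 + 4 * `|B|)); exact/ltW/truncnS_gt.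
move=> x01; have x10 : 0 < (1 - x) ^+ M.+1 by rewrite exprn_gt0// subr_gt0; case/andP: x01.
rewrite -(pmulr_lge0 _ x10).
apply: (@barrier _ (fun x => g x * (1 - x) ^+ M.+1) (fun x => dg x * (1 - x) ^+ M.+1 + g x * (M.+1%:R * (1 - x) ^+ M * (- 1)))) x01 => [y y01|y y01|e e0].
- by apply: (is_derive_eq (derM (g_derive y01) (derX M.+1 (derB (derC 1 y) (derI y))))); rewrite sub0r.
- case/andP: (y01) => y0 y1; have y10 : 0 < 1 - y by rewrite subr_gt0.
  rewrite pmulr_llt0 ?exprn_gt0// => gy.
  rewrite -(pmulr_rge0 _ (mulr_gt0 y0 y10)).
  have -> : y * (1 - y) * (dg y * (1 - y) ^+ M.+1 + g y * (M.+1%:R * (1 - y) ^+ M * -1)) =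
    (1 - y) ^+ M.+1 * (y * (1 - y) * dg y - M.+1%:R * y * g y).
    rewrite exprS; move: ((1 - y) ^+ M) (M.+1%:R) => u v; ring.
  rewrite mulr_ge0 ?exprn_ge0 ?(ltW y10)// dgE//.
  have [s0 s1 sA] := s_bounds y01.
  have h1 := @S_nonneg A (- al) (1 - s y) A1.
  have {}h1 : 0 <= A - B + B * (2 * A + 1) * (1 - s y).
    by apply: h1 => //; [case/andP: al0 => *; apply/andP; split; lra|rewrite subr_ge0].
  have h2 := @Lam_le A B (s y) y; set Lam := (X in g y * X) in h2 *.
  have {}h2 : Lam <= (2 + 4 * `|B|) * y.
    by apply: h2; rewrite ?(ltW s0) ?(ltW y0) ?(ltW y1)//; apply: le_trans A1.
  have h3 : Lam <= M.+1%:R * y by apply: le_trans h2 _; rewrite ler_wpM2r// ltW.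
  have h4 : 0 <= y * (1 - s y) ^+ 2 * (A - B + B * (2 * A + 1) * (1 - s y)).
    by rewrite mulr_ge0// mulr_ge0 ?sqr_ge0// ltW.
  have h5 : 0 <= (M.+1%:R * y - Lam) * (- g y) by rewrite mulr_ge0 ?subr_ge0// oppr_ge0 ltW.
  move: h4 h5; set T := _ * (_ + _); lra.
(* Near 0: [(A + 1) (1 - s) <= 1] by [lower], so the only negative part of [g] carries a factor
   [y]. *)
- have K0 : 0 < 1 + `|B| by rewrite ltr_pwDl.
  exists (e / (1 + `|B|)) => [|y /andP[y0 ye] y1]; first by rewrite divr_gt0.
  have y01 : 0 < y < 1 by rewrite y0.
  have [s0 s1 sA] := s_bounds y01; have y10 : 0 < 1 - y by rewrite subr_gt0.
  rewrite ltr_pdivlMr// in ye.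
  have h1 : - (y * (1 + `|B|)) <= g y.
    have k1 : 0 <= 1 - (A + 1) * (1 - s y) by rewrite subr_ge0 mulrC.
    have k2 : s y ^+ 2 * (1 + B * (1 - s y)) <= 1 + `|B|.
      apply: le_trans (ler_norm _) _; rewrite normrM -[leRHS]mul1r ler_pM//.
        by rewrite normrX expr_le1// ger0_norm// ltW.
      apply: le_trans (ler_normD _ _) _; rewrite normr1 lerD2l normrM ler_piMr//.
      by rewrite ger0_norm; lra.
    have := ler_wpM2l (ltW y0) k2; rewrite mulrA /g; lra.
  have y1e : (1 - y) ^+ M.+1 <= 1 by rewrite exprn_ile1//; lra.
  have [gy|gy] := leP 0 (g y).
    by apply: le_trans (_ : 0 <= _); [rewrite oppr_le0 ltW|rewrite mulr_ge0 ?exprn_ge0 ?(ltW y10)].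
  apply: le_trans (_ : g y <= _); first by apply: le_trans h1; rewrite lerN2 ltW.
  by rewrite -[leLHS]mulr1 ler_wnM2l// ltW.
Qed.

Let kap x := (1 - s x) * (A + B * x * s x) / (s x * (1 - x)).

Let kap_mono x y : 0 < x -> x <= y -> y < 1 -> kap x <= kap y.
Proof.
apply: (@nondecreasing01 _ _ (fun x => (A + B * x * s x) * g x / (x * s x ^+ 2 * (1 - x) ^+ 2))).
- move=> z z01; have h := s_derive z01; have [s0 _ _] := s_bounds z01; case/andP: (z01) => z0 z1.
  have n0 : s z * (1 - z) != 0 by rewrite mulf_neq0 ?subr_eq0 ?gt_eqF.
  apply: (is_derive_eq (derM (derM (derB (derC 1 z) h) (derD (derC A z) (derM (derM (derC B z) (derI z)) h)))
    (@derV (fun y => s y * (1 - y)) z _ n0 (derM h (derB (derC 1 z) (derI z)))))).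
  rewrite /g /ds; move: (s z) s0 => t t0; field.
  by rewrite subr_eq0 !gt_eqF.
- move=> z z01; have [s0 _ _] := s_bounds z01; case/andP: (z01) => z0 z1.
  have z10 : 0 < 1 - z by rewrite subr_gt0.
  (* [B] may be negative; positivity is read off from [p > 0] through [pE]. *)
  have h : 0 < A + B * z * s z.
    have := p0 z01; rewrite pE// => hh; have := F0 z01 => f0.
    have d0 : 0 < (z * (1 - z))^-1 by rewrite invr_gt0 mulr_gt0.
    by move: hh; rewrite (pmulr_lgt0 _ d0) pmulr_rgt0.
  have d0 : 0 <= z * s z ^+ 2 * (1 - z) ^+ 2 by exact: mulr_ge0 (mulr_ge0 (ltW z0) (sqr_ge0 _)) (sqr_ge0 _).
  exact: divr_ge0 (mulr_ge0 (ltW h) (g_ge0 z01)) d0.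
Qed.

Lemma log_ratio_cvx : cvx (fun w => ln (pF al (l + 1) (expR w)) - ln (pF al l (expR w))).
Proof.
apply: (@cvx_derive _ _ (fun w => kap (expR w))) => [w w0|v w vw w0].
  have x01 := exp01 w0; have [s0 _ _] := s_bounds x01.
  have dE := is_derive_expR w.
  have h1 := @is_derive1_comp R _ expR w _ _ (@is_derive1_comp R (@ln R) G _ _ _ (is_derive1_ln (G0 x01)) (dG x01)) dE.
  have h2 := @is_derive1_comp R _ expR w _ _ (@is_derive1_comp R (@ln R) F _ _ _ (is_derive1_ln (F0 x01)) (dF x01)) dE.
  apply: (is_derive_eq (derB h1 h2)).
  have := F0 x01; case/andP: (x01); rewrite sE// pE// /kap.
  move: s0; set t := s _; set f := F _; set x := expR w; move: t f x => t f x t0 x0 x1 f0; field.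
  by rewrite subr_eq0 !gt_eqF.
apply: kap_mono; [exact: expR_gt0|by rewrite ler_expR|by rewrite expR_lt1].
Qed.

End Fixed.

Lemma cvx_add f g : cvx f -> cvx g -> cvx (fun w => f w + g w).
Proof. by move=> hf hg s x y s01 x0 y0; have := hf s x y s01 x0 y0; have := hg s x y s01 x0 y0; lra. Qed.

Lemma lmean_cvx al n : - 3 <= al <= 0 -> cvx (lmean al n%:R).
Proof.
move=> al0; elim: n => [|n IH].
  have -> : lmean al 0%:R = (fun=> 0) by apply: funext => w; rewrite /lmean mulr0n subrr.
  by move=> s x y _ _ _; rewrite !mulr0 addr0.
have := cvx_add IH (log_ratio_cvx (ler0n R n) al0).
have -> // : (fun w => lmean al n%:R w + (ln (pF al (n%:R + 1) (expR w)) - ln (pF al n%:R (expR w)))) = lmean al n.+1%:R.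
by apply: funext => w; rewrite /lmean -natr1 addrC addrA subrK.
Qed.

Lemma monomial_mean_convex al (a : R[i]) n : - 3 <= al <= 0 -> a != 0 -> (0 < n)%N ->
  loglog_convex (area_mean al 1 (fun z => a * z ^+ n)).
Proof.
move=> al0 a0 n0; have b01 : 0 <= (1 : R) <= 1 by rewrite ler01 lexx.
have [_ [_ h] _] := monomial_cvx al a0 n0 b01; apply: h.
by case: n n0 => // n _; rewrite -natr1 addrK; exact: lmean_cvx.
Qed.

End Ratios.

(** * Failure of convexity for positive exponents *)

Section PositiveExponent.
Context {R : realType}.
Local Open Scope classical_set_scope.
Local Open Scope ring_scope.
Implicit Types (x y al l w : R).

Lemma lmean_derive al l w : 0 <= l -> w < 0 -> is_derive w 1 (lmean al l)
  (expR w * (1 - expR w) `^ al * (expR w `^ l / pF al l (expR w) - (pF al 0 (expR w))^-1)).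
Proof.
move=> l0 w0; have x01 := exp01 w0; have dE := is_derive_expR w.
have f1 := pF_gt0 al l0 x01; have f2 := pF_gt0 al (lexx 0) x01.
have h1 := @is_derive1_comp R _ expR w _ _ (@is_derive1_comp R (@ln R) (pF al l) _ _ _ (is_derive1_ln f1) (pF_derive al l0 x01)) dE.
have h2 := @is_derive1_comp R _ expR w _ _ (@is_derive1_comp R (@ln R) (pF al 0) _ _ _ (is_derive1_ln f2) (pF_derive al (lexx 0) x01)) dE.
apply: (is_derive_eq (derB h1 h2)); rewrite powRr0.
by move: (pF al l _) (pF al 0 _) (_ `^ al) (_ `^ l) => a b c d; ring.
Qed.

Lemma pF_le_powR al l x : 0 < l -> 0 < x < 1 -> pF al l x <= x `^ l * pF al 0 x.
Proof.
move=> l0 x01; have l1 := ltW l0; rewrite -subr_ge0.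
apply: (@nonneg_of_derive R (fun x => x `^ l * pF al 0 x - pF al l x)
  (fun x => l * x `^ (l - 1) * pF al 0 x)) x01 => [y y01|y y01|].
- case/andP: (y01) => y0 y1.
  apply: (is_derive_eq (derB (derM (is_derive1_powR l y0) (pF_derive al (lexx 0) y01)) (pF_derive al l1 y01))).
  by rewrite powRr0 mul1r addrK.
- by rewrite !mulr_ge0 ?powR_ge0// ltW// pF_gt0.
- move=> e e0; have e2 : 0 < e / 2 by rewrite divr_gt0.
  have [d1 d10 H1] := (pF_vanish al (lexx 0)).1 _ e2; have [d2 d20 H2] := (pF_vanish al l1).1 _ e2.
  exists (Num.min d1 d2) => [|y]; first by rewrite lt_min d10.
  rewrite lt_min => /and3P[y0 y1 y2] y3; apply: le_trans (ler_normB _ _) _.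
  rewrite [leRHS]splitr lerD ?H2 ?y0//; apply: le_trans (H1 y _ y3); last by rewrite y0.
  rewrite normrM ler_piMl// ger0_norm ?powR_ge0// -[leRHS](one_powR l).
  by rewrite ge0_ler_powR// ?nnegrE ltW.
Qed.

Lemma lmean_le al l w : 0 < l -> w < 0 -> lmean al l w <= l * w.
Proof.
move=> l0 w0; have x01 := exp01 w0; rewrite /lmean lerBlDr.
have f1 := pF_gt0 al (ltW l0) x01; have f2 := pF_gt0 al (lexx 0) x01.
have := pF_le_powR al l0 x01; rewrite -ler_ln ?posrE// ?mulr_gt0 ?powR_gt0 ?expR_gt0//.
by rewrite lnM ?posrE ?powR_gt0 ?expR_gt0// ln_powR expRK.
Qed.

Lemma pF_mono al l x y : 0 <= l -> 0 < x -> x <= y -> y < 1 -> pF al l x <= pF al l y.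
Proof.
move=> l0; apply: nondecreasing01 => [z z01|z _]; first exact: pF_derive.
by rewrite mulr_ge0 ?powR_ge0.
Qed.

Lemma lmean_not_cvx al l : 0 < al -> 0 < l -> ~ cvx (lmean al l).
Proof.
move=> al0 l0 cv; have l1 := ltW l0.
have LD w := @lmean_derive al l w l1; have Lle w := @lmean_le al l w l0.
have fp x := @pF_gt0 R al l x l1; have gp x := @pF_gt0 R al 0 x (lexx 0).
have fm x y := @pF_mono al l x y l1.
move: (lmean al l) cv LD Lle => L cv LD Lle.
move: (pF al l) (pF al 0) LD fp gp fm => F G LD fp gp fm.
have h0 : 0 < 1/2 :> R by rewrite divr_gt0.
have h1 : 1/2 < 1 :> R by lra.
pose v : R := ln (1/2); have v0 : v < 0 by rewrite ln_lt0// h0.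
(* Far enough to the left that [l w < L v]; since [L w <= l w], the chord from [w] to [v] has
   positive slope [s]. *)
pose w := Num.min (v - 1) (L v / l - 1).
have wv : w < v by rewrite gt_min; apply/orP; left; lra.
have w0 := lt_trans wv v0.
have LL : L w < L v.
  apply: le_lt_trans (Lle _ w0) _; rewrite mulrC -ltr_pdivlMr//.
  by rewrite gt_min; apply/orP; right; lra.
pose s := (L v - L w) / (v - w).
have s0 : 0 < s by rewrite divr_gt0 ?subr_gt0.
pose K := (F (1/2))^-1; have K0 : 0 < K by rewrite invr_gt0 fp ?h0.
have sK : 0 < s / (2 * K) by rewrite divr_gt0// mulr_gt0.
have [d d0 Hd] := powR_vanish al0 sK.
(* Close enough to 1 that the derivative of [L] beyond [ln x] is at most [s / 2], while 3/4 keeps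
   [ln x] to the right of [v]; convexity would require chords there of slope at least [s]. *)
pose x := Num.max (3/4) (1 - d / 2).
have x34 : 3/4 <= x by rewrite le_max lexx.
have x0 : 0 < x by apply: lt_le_trans x34; rewrite divr_gt0.
have xd : 1 - x < d by rewrite ltrBlDr -ltrBlDl lt_max; apply/orP; right; lra.
have x1 : x < 1 by rewrite gt_max; apply/andP; split; lra.
pose z := ln x; have z0 : z < 0 by rewrite ln_lt0// x0.
have vz : v < z by rewrite ltr_ln ?posrE//; lra.
pose y := z / 2; have zy : z < y by rewrite /y; lra.
have y0 : y < 0 by rewrite /y; lra.
have [c /andP[c0 c1] E] := @mvt R L _ z y zy (fun c hc => LD _ (le_lt_trans (andP hc).2 y0)).
have Hs : s * (y - z) <= L y - L z.
  have zv : 0 < z - v by rewrite subr_gt0.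
  have k1 := cvx_slope cv wv vz z0.
  have k2 := cvx_slope cv vz zy y0.
  have yz : 0 < y - z by rewrite subr_gt0.
  have vw : 0 < v - w by rewrite subr_gt0.
  have k1' : s * (z - v) <= L z - L v by rewrite /s mulrAC ler_pdivrMr.
  rewrite -(ler_pM2r zv); apply: le_trans k2; rewrite mulrAC.
  by rewrite ler_wpM2r// ltW.
move: Hs; rewrite E ler_pM2r ?subr_gt0//; apply/negP; rewrite -ltNge.
have c00 : c < 0 by rewrite (lt_trans c1).
have ec := exp01 c00; have xc : x < expR c by rewrite -[x]lnK ?posrE// ltr_expR.
have f1 := fp _ ec; have f2 := gp _ ec.
case/andP: (ec) => ec0 ec1.
have hp : (1 - expR c) `^ al <= s / (2 * K).
  have := Hd (1 - expR c); rewrite ger0_norm ?powR_ge0//; apply; last by lra.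
  by apply/andP; split; lra.
have fK : expR c `^ l / F (expR c) <= K.
  rewrite -[leRHS]mul1r ler_pM ?powR_ge0 ?invr_ge0 ?(ltW f1)//.
    by rewrite -[leRHS](one_powR l) ge0_ler_powR ?nnegrE ?(ltW ec0) ?(ltW ec1).
  by rewrite lef_pV2 ?posrE ?fp ?h0// fm//; lra.
apply: le_lt_trans (_ : s / (2 * K) * K < s); last first.
  by rewrite invfM mulrA mulfVK ?gt_eqF// ltr_pdivrMr// ltr_pMr// ltr1n.
apply: le_trans (_ : (1 - expR c) `^ al * (expR c `^ l / F (expR c)) <= _).
  rewrite -mulrA -[leRHS]mul1r; apply: le_trans (_ : expR c * ((1 - expR c) `^ al * (expR c `^ l / F (expR c))) <= _).
    rewrite ler_wpM2l ?(ltW ec0)// ler_wpM2l ?powR_ge0// gerBl invr_ge0 ltW//.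
  by rewrite ler_wpM2r ?(ltW ec1)// mulr_ge0 ?powR_ge0// divr_ge0 ?powR_ge0 ?(ltW f1).
apply: ler_pM hp fK; first exact: powR_ge0.
by rewrite divr_ge0 ?powR_ge0 ?(ltW f1).
Qed.

(** The excluded pair is the case [l = 0], in which the mean does not depend on [r] and is therefore
    log-convex. *)
Lemma monomial_mean_not_convex al beta (a : R[i]) n : 0 < al -> 0 <= beta <= 1 -> a != 0 -> (0 < n)%N ->
  ~ (n = 1%N /\ beta = 1) -> ~ loglog_convex (area_mean al beta (fun z => a * z ^+ n)).
Proof.
move=> al0 b01 a0 n0 nb; have [_ h _] := monomial_cvx al a0 n0 b01; rewrite h.
apply: lmean_not_cvx => //; rewrite subr_gt0 lt_neqAle; case/andP: b01 => _ b1.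
rewrite (le_trans b1) ?ler1n// andbT; apply/eqP => E; apply: nb.
clear h; case: n n0 E => [|[|n]] // _ E.
by exfalso; move: b1; rewrite E leNgt ltr1n.
Qed.

End PositiveExponent.

(** * Failure of convexity and of concavity for exponents below -3 *)

Section NegativeExponent.
Context {R : realType}.
Local Open Scope classical_set_scope.
Local Open Scope ring_scope.
Implicit Types (f : R -> R) (x y al b c k l q w : R).

(** The derivative is at least [c / (1 - x)], so [D + c ln (1 - x)] is nondecreasing. *)
Lemma diverge_right (D dD : R -> R) x0 c : 0 < c -> 0 < x0 < 1 ->
  (forall x, 0 < x < 1 -> is_derive x 1 D (dD x)) ->
  (forall x, x0 <= x < 1 -> c <= dD x * (1 - x)) ->
  forall K, exists2 x, x0 < x < 1 & K < D x.
Proof.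
move=> c0 /andP[x00 x01] dDx Dc K.
pose E x := D x + c * ln (1 - x).
have Em x : x0 < x < 1 -> E x0 <= E x.
  move=> /andP[x0x x1].
  have [z /andP[z0 z1]|z /andP[z0 z1] eq] := @mvt R E (fun z => dD z + c * ((1 - z)^-1 * -1)) x0 x x0x.
    have z01 : 0 < z < 1 by rewrite (lt_le_trans x00 z0) (le_lt_trans z1 x1).
    have z10 : 0 < 1 - z by rewrite subr_gt0; case/andP: z01.
    have h := @is_derive1_comp R (@ln R) (fun z => 1 - z) z _ _ (is_derive1_ln z10) (derB (derC 1 z) (derI z)).
    by apply: (is_derive_eq (derD (dDx z z01) (derM (derC c z) h))); rewrite mul0r add0r sub0r.
  rewrite -subr_ge0 eq mulr_ge0 ?subr_ge0 ?(ltW x0x)//.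
  have z10 : 0 < 1 - z by rewrite subr_gt0 (lt_trans z1).
  rewrite -(pmulr_lge0 _ z10) mulrDl -mulrA mulrN1 mulNr mulVf ?gt_eqF// mulrN1 subr_ge0.
  by apply: Dc; rewrite (ltW z0) (lt_trans z1).
pose T := Num.max ((K - E x0) / c + 1) (1 - ln (1 - x0)).
have T1 : (K - E x0) / c < T by rewrite lt_max ltrDl ltr01.
have T2 : - ln (1 - x0) < T by rewrite lt_max; apply/orP; right; lra.
have xx : x0 < 1 - expR (- T).
  rewrite ltrBrDl -ltrBrDr -[ltRHS]lnK ?posrE ?subr_gt0// ltr_expR; lra.
have x1 : 1 - expR (- T) < 1 by rewrite gtrBl expR_gt0.
exists (1 - expR (- T)); first by rewrite xx.
have := Em (1 - expR (- T)); rewrite xx x1 => /(_ isT).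
rewrite {2}/E subKr expRK; move: T1; rewrite ltr_pdivrMr//; lra.
Qed.

Lemma cont_vanish0 f (d : R) : is_derive (0 : R) 1 f d -> f 0 = 0 -> vanish0 f.
Proof.
move=> h f0 e e0; have cf := is_derive_continuous h.
have /nbhs_ballP[r /= r0 Hr] : \forall y \near 0, `|f y| < e.
  move/cvgr_dist_lt: cf => /(_ e e0); rewrite f0; apply: filterS => y.
  by rewrite sub0r normrN.
by exists r => // x /andP[x0 xr] _; apply/ltW/Hr; rewrite /ball /= sub0r normrN gtr0_norm.
Qed.

Lemma pF0E al x : al + 1 != 0 -> 0 < x < 1 -> pF al 0 x = ((1 - x) `^ (al + 1) - 1) / (- al - 1).
Proof.
move=> b0 x01.
have bn : - al - 1 != 0 by rewrite -opprD oppr_eq0.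
have gd y : y < 1 -> is_derive y 1 (fun x => ((1 - x) `^ (al + 1) - 1) / (- al - 1)) ((1 - y) `^ al).
  move=> y1; have y10 : 0 < 1 - y by rewrite subr_gt0.
  have h := @is_derive1_comp R (fun z => z `^ (al + 1)) (fun y => 1 - y) y _ _ (is_derive1_powR (al + 1) y10) (derB (derC 1 y) (derI y)).
  apply: (is_derive_eq (derM (derB h (derC 1 y)) (derC (- al - 1)^-1 y))).
  by rewrite addrK; move: (_ `^ al) => p; field.
apply: (@eq_of_derive R (pF al 0) (fun x => ((1 - x) `^ (al + 1) - 1) / (- al - 1)) (fun x => (1 - x) `^ al)) x01 => [y y01|y /andP[_ y1]||].
- by apply: (is_derive_eq (pF_derive al (lexx 0) y01)); rewrite powRr0 mul1r.
- exact: gd.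
- by case: (pF_vanish al (lexx 0)).
- by apply: (cont_vanish0 (gd 0 ltr01)); rewrite subr0 one_powR subrr mul0r.
Qed.

(** [x^q >= 1 + q ln x], and [ln x] lies between [- (1 - x) - 2 (1 - x)^2] and [- (1 - x)] for
    [x >= 1/2]; the sign of [q] decides which bound applies. *)
Lemma powR_expansion_ge q x : 1/2 <= x < 1 ->
  1 - q * (1 - x) - 2 * `|q| * (1 - x) ^+ 2 <= x `^ q.
Proof.
move=> /andP[x2 x1]; have x0 : 0 < x by apply: lt_le_trans x2; rewrite divr_gt0.
rewrite -[x `^ q]lnK ?posrE ?powR_gt0// ln_powR.
apply: le_trans (expR_ge1Dx _).
have h1 : ln x <= - (1 - x) by have := @ln_sublinear R x x0; have := le_ln1Dx; have := @expR_ge1Dx R (ln x); rewrite lnK ?posrE//; lra.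
have h2 : - (1 - x) - 2 * (1 - x) ^+ 2 <= ln x.
  have : ln x^-1 <= x^-1 - 1 by have := @expR_ge1Dx R (ln x^-1); rewrite lnK ?posrE ?invr_gt0//; lra.
  rewrite lnV ?posrE// => h; have : - (1 - x) - 2 * (1 - x) ^+ 2 <= 1 - x^-1; last by lra.
  rewrite -subr_ge0; have -> : 1 - x^-1 - (- (1 - x) - 2 * (1 - x) ^+ 2) = (1 - x) ^+ 2 * (2 * x - 1) / x by field; rewrite gt_eqF.
  by rewrite divr_ge0 ?(ltW x0)// mulr_ge0 ?sqr_ge0//; lra.
rewrite -addrA -opprD -mulrA; rewrite lerD2l.
have [q0|q0] := leP 0 q.
  rewrite ger0_norm//; have := ler_wpM2l q0 h2; move: (ln x) => L; lra.
rewrite ltr0_norm//; have := ler_wnM2l (ltW q0) h1.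
have : 0 <= - q * (1 - x) ^+ 2 by rewrite mulr_ge0 ?sqr_ge0//; lra.
move: (ln x) => L; lra.
Qed.

(** The second-order term is kept because it alone decides the sign at the critical slope [k1]. The
    difference of the two sides is monotone in [x] and vanishes at 1. *)
Lemma powR_expansion_le q x : 0 < q < 1 -> 0 < x < 1 ->
  x `^ q <= 1 - q * (1 - x) - q * (1 - q) / 2 * (1 - x) ^+ 2.
Proof.
move=> /andP[q0 q1] /andP[x0 x1].
pose h y := y `^ q + q * (1 - y) + q * (1 - q) / 2 * (1 - y) ^+ 2.
suff : h x <= h 1 by rewrite /h one_powR subrr expr0n /= !mulr0; lra.
have [y /andP[y0 y1]|y /andP[y0 y1] E] := @mvt R h (fun y => q * (y `^ (q - 1) - 1 - (1 - q) * (1 - y))) x 1 x1.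
  have d1 := derB (derC 1 y) (derI y).
  apply: (is_derive_eq (derD (derD (is_derive1_powR q (lt_le_trans x0 y0)) (derM (derC q y) d1)) (derM (derC (q * (1 - q) / 2) y) (derX 2 d1)))).
  by rewrite expr1; move: (_ `^ _) => p; field.
rewrite -subr_ge0 E mulr_ge0 ?subr_ge0 ?(ltW x1)// mulr_ge0 ?(ltW q0)//.
have {}y0 := lt_trans x0 y0.
have h1 : ln y <= - (1 - y) by have := @expR_ge1Dx R (ln y); rewrite lnK ?posrE//; lra.
have : 1 + (q - 1) * ln y <= y `^ (q - 1).
  by rewrite -[y `^ _]lnK ?posrE ?powR_gt0// ln_powR expR_ge1Dx.
have q1' : q - 1 <= 0 by lra.
have := ler_wnM2l q1' h1; move: (ln y) (_ `^ _) => L p; lra.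
Qed.

Lemma powR_half_bound_ge c : exists2 m, 0 < m & forall y, 1/2 <= y <= 1 -> m <= y `^ c.
Proof.
exists (1 + (1/2) `^ (- c))^-1; first by rewrite invr_gt0 ltr_pwDl// powR_ge0.
move=> y y2; have y0 : 0 < y by case/andP: y2 => y2 _; apply: lt_le_trans y2; rewrite divr_gt0.
have -> : y `^ c = (y `^ (- c))^-1 by rewrite powRN invrK.
rewrite lef_pV2 ?posrE ?powR_gt0 ?ltr_pwDl ?powR_ge0//.
exact: powR_half_bound.
Qed.

Let bracket_ge l k z aq x X : 1 - (l + 1 - k) * (1 - x) - 2 * aq * (1 - x) ^+ 2 <= X ->
  aq * (1 - x) ^+ 2 <= (k - z - l) / 4 * (1 - x) -> (k - z - l) / 2 * (1 - x) <= X - x - z * (1 - x).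
Proof. by move=> h1 h2; lra. Qed.

Let bracket_le l k z v c x X : l = k - z -> X <= 1 - (l + 1 - k) * (1 - x) - c * v ->
  forall W, W <= c / 2 * v -> c / 2 * v <= - (X - x - z * (1 - x) + W).
Proof. by move=> -> h1 W h2; lra. Qed.

Section Fixed.
Variables (al l : R).
Hypotheses (al3 : al < - 3) (l01 : 0 < l <= 1).
Let b := - al - 1.
(** Its sign at [x = expR w] tells on which side of the line of slope [k] through the origin the
    graph of [lmean] lies. *)
Let D k x := pF al l x - x `^ k * pF al 0 x.
Let dD k x := (1 - x) `^ al * x `^ l - (k * x `^ (k - 1) * pF al 0 x + x `^ k * (1 - x) `^ al).

Let l0 : 0 < l. Proof. by case/andP: l01. Qed.
Let l1 : l <= 1. Proof. by case/andP: l01. Qed.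
Let b2 : 2 < b. Proof. by rewrite /b; move: al3 => h; lra. Qed.

Let b0 : 0 < b. Proof. by rewrite (lt_trans _ b2). Qed.
Let b10 : 0 < b - 1. Proof. by rewrite subr_gt0 (lt_trans _ b2)// ltr1n. Qed.

Let D_derive k x : 0 < x < 1 -> is_derive x 1 (D k) (dD k x).
Proof.
move=> x01; case/andP: (x01) => x0 x1.
apply: (is_derive_eq (derB (pF_derive al (ltW l0) x01) (derM (is_derive1_powR k x0) (pF_derive al (lexx 0) x01)))).
by rewrite powRr0 mul1r /dD [_ * x `^ l]mulrC.
Qed.

(** This is the source of divergence: [(1 - x)^al (1 - x)^2] is at least [1 / (1 - x)]. *)
Let cube x : 0 < x < 1 -> 1 <= (1 - x) `^ al * (1 - x) ^+ 3.
Proof.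
move=> /andP[x0 x1]; have u0 : 0 < 1 - x by rewrite subr_gt0.
have -> : (1 - x) ^+ 3 = (1 - x) `^ 3%:R by rewrite powR_mulrn// ltW.
rewrite -powRD; last by rewrite (gt_eqF u0) implybT.
have -> : al + 3%:R = - (- al - 3) by ring.
have h : 0 <= - al - 3 by move: al3 => h; lra.
rewrite powRN invf_ge1 ?powR_gt0// -[leRHS](one_powR (- al - 3)).
by rewrite ge0_ler_powR ?nnegrE ?(ltW u0)// gerBl ltW.
Qed.

(* With [u = 1 - x], [F_0 = ((1-x)^al u - 1) / b], so [dD k] is [(1-x)^al x^(k-1)] times the bracket below. *)
Let dD_bracket k x : 0 < x < 1 -> dD k x = (1 - x) `^ al * x `^ (k - 1) *
  (x `^ (l + 1 - k) - x - k / b * (1 - x) + k / b * ((1 - x) `^ al)^-1).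
Proof.
move=> x01; have h := al3; rewrite /dD pF0E//; last by rewrite lt_eqF//; lra.
case/andP: x01 => x0 x1; have u0 : 0 < 1 - x by rewrite subr_gt0.
have p0 : 0 < (1 - x) `^ al by exact: powR_gt0.
have -> : x `^ l = x `^ (k - 1) * x `^ (l + 1 - k).
  by rewrite -powRD ?(gt_eqF x0) ?implybT//; congr (_ `^ _); ring.
have -> : x `^ k = x `^ (k - 1) * x by rewrite -powR_shift// subrK.
rewrite powR_shift// -/b; move: (_ `^ al) p0 (x `^ (k - 1)) (x `^ (l + 1 - k)) => p p0 y z.
have bn : b != 0 by rewrite gt_eqF// (lt_trans _ b2).
by move: b bn => c cn; field; rewrite gt_eqF.
Qed.

(** Near [x = 1] the bracket of [dD_bracket] is at least [(c / 2) (1 - x)], where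
    [c = k - k / b - l > 0] is its first-order coefficient; [cube] then gives a derivative of order
    at least [1 / (1 - x)]. *)
Let D_large k : 0 < k -> l < k - k / b -> forall x0 K, x0 < 1 -> exists2 x, x0 < x < 1 & K < D k x.
Proof.
move=> k0 lk x0 K x01; pose q := l + 1 - k; pose c := k - k / b - l.
have c0 : 0 < c by rewrite subr_gt0.
have [m m0 Hm] := powR_half_bound_ge (k - 1).
have kb : 0 < k / b by rewrite divr_gt0.
have Q0 : 0 < 1 + `|q| by rewrite ltr_pwDl.
pose e := c / (4 * (1 + `|q|)); have e0 : 0 < e by rewrite divr_gt0// mulr_gt0.
have eE : 4 * (1 + `|q|) * e = c by rewrite /e mulrC divfK// gt_eqF// mulr_gt0.
pose x1 := Num.max x0 (Num.max (1/2) (1 - e)).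
have x1a : x0 <= x1 by rewrite le_max lexx.
have x1b : 1/2 <= x1 by rewrite !le_max lexx orbT.
have x1c : 1 - e <= x1 by rewrite !le_max lexx !orbT.
have x11 : x1 < 1 by rewrite !gt_max x01 gtrBl e0 andbT /=; lra.
have x10 : 0 < x1 by apply: lt_le_trans x1b; rewrite divr_gt0.
have [|||x /andP[h1 h2] h3] := @diverge_right (D k) (dD k) x1 (m * (c / 2)) _ _ (D_derive k) _ K.
- by rewrite mulr_gt0// divr_gt0.
- by rewrite x10.
- move=> x /andP[xx xlt]; have x0' := lt_le_trans x10 xx; have u0 : 0 < 1 - x by rewrite subr_gt0.
  have x2 : 1/2 <= x by exact: le_trans xx.
  have x01' : 0 < x < 1 by rewrite x0'.
  rewrite dD_bracket//; have hp := cube x01'; have mm := Hm x; rewrite x2 ltW// in mm.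
  have {}mm := mm isT.
  have hq := @powR_expansion_ge q x; rewrite x2 xlt in hq; have {}hq := hq isT.
  have p0 : 0 < (1 - x) `^ al by exact: powR_gt0.
  have ue : 1 - x <= e by lra.
  have br : c / 2 * (1 - x) <= x `^ q - x - k / b * (1 - x).
    have t1 : `|q| * (1 - x) ^+ 2 <= c / 4 * (1 - x).
      rewrite expr2 mulrA ler_wpM2r ?(ltW u0)//; apply: le_trans (_ : `|q| * e <= _); first by rewrite ler_wpM2l.
      by rewrite -eE; lra.
    exact: bracket_ge hq t1.
  rewrite -/q; set Br := x `^ q - x - k / b * (1 - x) + k / b * ((1 - x) `^ al)^-1; have Brc : c / 2 * (1 - x) <= Br.
    by apply: le_trans br _; rewrite /Br lerDl mulr_ge0 ?invr_ge0 ?(ltW p0) ?(ltW kb).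
  have c20 : 0 < c / 2 by rewrite divr_gt0.
  have -> : (1 - x) `^ al * x `^ (k - 1) * Br * (1 - x) = x `^ (k - 1) * ((1 - x) `^ al * (1 - x) * Br) by ring.
  rewrite ler_pM ?(ltW m0) ?(ltW c20)//.
  apply: le_trans (_ : (1 - x) `^ al * (1 - x) * (c / 2 * (1 - x)) <= _); last first.
    by rewrite ler_wpM2l// mulr_ge0// ltW.
  have -> : (1 - x) `^ al * (1 - x) * (c / 2 * (1 - x)) = c / 2 * ((1 - x) `^ al * (1 - x) ^+ 2) by ring.
  rewrite ler_peMr ?(ltW c20)//; apply: le_trans hp _; rewrite ler_wpM2l ?(ltW p0)//.
  by rewrite [leLHS]exprS ler_piMl ?sqr_ge0//; lra.
- by exists x => //; rewrite h2 andbT (le_lt_trans x1a h1).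
Qed.

(** The solution of [k - k / b = l], at which the first-order coefficient of the bracket
    vanishes. *)
Let k1 := l * b / (b - 1).

(** With no first-order term, the bracket is at most [- q (1 - q) / 2] times [(1 - x)^2], up to the
    summand [(k1 / b) (1 - x)^(- al)], which is of order [(1 - x)^3]. Here [q = l + 1 - k1] lies in
    [(0, 1)] because [b > 2] and [l <= 1]. *)
Let D_small : exists2 x, 0 < x < 1 & D k1 x < 0.
Proof.
have kE : k1 * (b - 1) = l * b by rewrite /k1 divfK// gt_eqF.
have k0 : 0 < k1 by rewrite divr_gt0// mulr_gt0.
have kl : l < k1 by rewrite ltr_pdivlMr// mulrBr mulr1 gtrBl.
have klb : k1 - k1 / b = l.
  have bn : b != 0 by rewrite gt_eqF.
  have -> : k1 - k1 / b = k1 * (b - 1) / b by field.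
  by rewrite kE mulfK.
pose q := l + 1 - k1.
have q1 : q < 1 by rewrite /q; lra.
have q0 : 0 < q.
  rewrite /q -(pmulr_lgt0 _ b10); have -> : (l + 1 - k1) * (b - 1) = (l + 1) * (b - 1) - k1 * (b - 1) by ring.
  rewrite kE; have -> : (l + 1) * (b - 1) - l * b = b - 2 + (1 - l) by ring.
  by rewrite ltr_pwDl ?subr_gt0// subr_ge0.
pose c := q * (1 - q) / 2; have c0 : 0 < c by rewrite divr_gt0// mulr_gt0// subr_gt0.
have kb : 0 < k1 / b by rewrite divr_gt0.
have [m m0 Hm] := powR_half_bound_ge (k1 - 1).
pose e := c / (2 * (k1 / b)); have e0 : 0 < e by rewrite divr_gt0// mulr_gt0.
have eE : k1 / b * e = c / 2 by rewrite /e; move: (k1 / b) kb => t t0; field; rewrite gt_eqF.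
pose x1 := Num.max (1/2) (1 - e).
have x1b : 1/2 <= x1 by rewrite !le_max lexx.
have x1c : 1 - e <= x1 by rewrite !le_max lexx !orbT.
have x11 : x1 < 1 by rewrite !gt_max gtrBl e0 andbT /=; lra.
have x10 : 0 < x1 by apply: lt_le_trans x1b; rewrite divr_gt0.
have DN y : 0 < y < 1 -> is_derive y 1 (fun x => 0 - D k1 x) (- dD k1 y).
  by move=> y01; apply: (is_derive_eq (derB (derC 0 y) (D_derive k1 y01))); rewrite sub0r.
have [|||x /andP[h1 h2] h3] := @diverge_right (fun x => 0 - D k1 x) (fun x => - dD k1 x) x1 (m * (c / 2)) _ _ DN _ 0.
- by rewrite mulr_gt0// divr_gt0.
- by rewrite x10.
- move=> x /andP[xx xlt]; have x0' := lt_le_trans x10 xx; have u0 : 0 < 1 - x by rewrite subr_gt0.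
  have x2 : 1/2 <= x by exact: le_trans xx.
  have x01' : 0 < x < 1 by rewrite x0'.
  rewrite dD_bracket//; have hp := cube x01'; have mm := Hm x; rewrite x2 ltW// in mm.
  have {}mm := mm isT.
  have q01 : 0 < q < 1 by rewrite q0.
  have hq := powR_expansion_le q01 x01'.
  have p0 : 0 < (1 - x) `^ al by exact: powR_gt0.
  have ue : 1 - x <= e by lra.
  have pV : ((1 - x) `^ al)^-1 <= (1 - x) ^+ 3 by rewrite -div1r ler_pdivrMr// mulrC.
  rewrite -/q; set Br := x `^ q - x - k1 / b * (1 - x) + k1 / b * ((1 - x) `^ al)^-1; have Brc : c / 2 * (1 - x) ^+ 2 <= - Br.
    have t1 : k1 / b * ((1 - x) `^ al)^-1 <= c / 2 * (1 - x) ^+ 2.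
      apply: le_trans (_ : k1 / b * (1 - x) ^+ 3 <= _); first by rewrite ler_wpM2l// ltW.
      by rewrite exprS mulrA ler_wpM2r ?sqr_ge0// -eE ler_wpM2l// (ltW kb).
    exact: bracket_le (esym klb) hq _ t1.
  have c20 : 0 < c / 2 by rewrite divr_gt0.
  have -> : - ((1 - x) `^ al * x `^ (k1 - 1) * Br) * (1 - x) = x `^ (k1 - 1) * ((1 - x) `^ al * (1 - x) * - Br) by ring.
  rewrite ler_pM ?(ltW m0) ?(ltW c20)//.
  apply: le_trans (_ : (1 - x) `^ al * (1 - x) * (c / 2 * (1 - x) ^+ 2) <= _); last first.
    by rewrite ler_wpM2l// mulr_ge0// ltW.
  have -> : (1 - x) `^ al * (1 - x) * (c / 2 * (1 - x) ^+ 2) = c / 2 * ((1 - x) `^ al * (1 - x) ^+ 3) by ring.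
  by rewrite ler_peMr ?(ltW c20).
- by exists x; [rewrite h2 (lt_trans x10 h1)|move: h3; rewrite sub0r oppr_gt0].
Qed.

Let lmean_lt k w : w < 0 -> (lmean al l w < k * w) = (D k (expR w) < 0).
Proof.
move=> w0; have x01 := exp01 w0; rewrite /lmean ltrBlDr /D subr_lt0.
have f1 := pF_gt0 al (ltW l0) x01; have f2 := pF_gt0 al (lexx 0) x01.
rewrite -[in RHS]ltr_ln ?posrE// ?mulr_gt0 ?powR_gt0 ?expR_gt0//.
by rewrite lnM ?posrE ?powR_gt0 ?expR_gt0// ln_powR expRK.
Qed.

Let lmean_gt k w : w < 0 -> (k * w < lmean al l w) = (0 < D k (expR w)).
Proof.
move=> w0; have x01 := exp01 w0; rewrite /lmean ltrBrDr /D subr_gt0.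
have f1 := pF_gt0 al (ltW l0) x01; have f2 := pF_gt0 al (lexx 0) x01.
rewrite -[in RHS]ltr_ln ?posrE// ?mulr_gt0 ?powR_gt0 ?expR_gt0//.
by rewrite lnM ?posrE ?powR_gt0 ?expR_gt0// ln_powR expRK.
Qed.

Let small_point : exists2 w, w < 0 & lmean al l w < k1 * w.
Proof.
have [x /andP[x0 x1] h] := D_small; exists (ln x); first by rewrite ln_lt0// x0.
have E : expR (ln x) = x by rewrite lnK ?posrE.
by rewrite lmean_lt; [rewrite E|rewrite ln_lt0// x0].
Qed.

Let kl : l < k1.
Proof. by rewrite ltr_pdivlMr// mulrBr mulr1 gtrBl. Qed.

Lemma lmean_not_convex : ~ cvx (lmean al l).
Proof.
move=> cv; have [w w0 hw] := small_point.
(* The slope of the line through the origin and the low point at [w]. *)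
pose k2 := lmean al l w / w.
have w1 : lmean al l w = k2 * w by rewrite /k2 divfK// lt_eqF.
have kk : k1 < k2 by move: hw; rewrite w1 ltr_nM2r.
have k20 : 0 < k2 by exact: lt_trans (lt_trans l0 kl) kk.
have lk : l < k2 - k2 / b.
  have -> : k2 - k2 / b = k2 * (b - 1) / b by field; rewrite gt_eqF.
  by rewrite ltr_pdivlMr// -ltr_pdivrMr.
have [|x /andP[wx x1] Dx] := D_large k20 lk (x0 := expR w) 0; first by rewrite expR_lt1.
have x0 : 0 < x by apply: lt_trans wx; exact: expR_gt0.
pose z := ln x; have z0 : z < 0 by rewrite ln_lt0// x0.
have wz : w < z by rewrite -ltr_expR lnK ?posrE.
have Lz : k2 * z < lmean al l z by rewrite (lmean_gt _ z0) /z lnK ?posrE.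
have Ly y : y < 0 -> lmean al l y <= 0.
  by move=> y0; apply: le_trans (lmean_le al l0 y0) _; rewrite mulr_ge0_le0// ltW.
move: (lmean al l) cv w1 Lz Ly => L cv w1 Lz Ly.
pose e := L z - k2 * z; have e0 : 0 < e by rewrite subr_gt0.
have M0 : 0 < z - w by rewrite subr_gt0.
(* At [y] the line of slope [k2] is less than [e] below 0, where [e] is the height of the graph
   above that line at [z]; with [L y <= 0] the chord slopes then decrease from [w, z] to [z, y]. *)
have [y [zy y0 ye]] : exists y, [/\ z < y, y < 0 & k2 * - y < e].
  exists (Num.max (z / 2) (- (e / (2 * k2)))).
  have e1 : 0 < e / (2 * k2) by rewrite divr_gt0// mulr_gt0.
  have e2 : k2 * (e / (2 * k2)) = e / 2 by field; rewrite gt_eqF.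
  split.
  - by rewrite lt_max; apply/orP; left; rewrite ltr_pdivlMr// mulr_natr mulr2n gtrDl.
  - by rewrite gt_max oppr_lt0 e1 andbT ltr_pdivrMr// mul0r.
  - apply: le_lt_trans (_ : k2 * (e / (2 * k2)) < e).
      by rewrite ler_wpM2l ?(ltW k20)// lerNl le_max lexx orbT.
    by rewrite e2 ltr_pdivrMr// ltr_pMr// ltr1n.
have := cvx_slope cv wz zy y0; apply/negP; rewrite -ltNge.
have := Ly y y0; rewrite w1; have -> : L z = e + k2 * z by rewrite subrK.
move: (L y) => Y Y0; rewrite -subr_gt0.
have -> : (e + k2 * z - k2 * w) * (y - z) - (Y - (e + k2 * z)) * (z - w) =
  (z - w) * (e - k2 * - y) + e * (y - z) + (- Y) * (z - w) by ring.
have h1 : 0 < (z - w) * (e - k2 * - y) by rewrite mulr_gt0// subr_gt0.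
have h2 : 0 <= e * (y - z) by rewrite mulr_ge0 ?subr_ge0 ?ltW.
have h3 : 0 <= - Y * (z - w) by rewrite mulr_ge0 ?oppr_ge0// ltW.
by rewrite -addrA ltr_wpDr// addr_ge0.
Qed.

(** Near [x = 0] one has [F_l >= x^(l+1) / (l + 1)] and [F_0 <= M x], so the graph stays within a
    constant of slope [l]. *)
Let lmean_lower : exists K, forall w, expR w <= 1/2 -> l * w - K <= lmean al l w.
Proof.
have al0 : al <= 0 by rewrite ltW// (lt_trans al3)// oppr_lt0.
pose M := 1 + (1/2 : R) `^ al; have M0 : 0 < M by rewrite ltr_pwDl// powR_ge0.
exists (ln M + ln (l + 1)) => w w2; set x := expR w in w2 *.
have x0 : 0 < x by exact: expR_gt0.
have h1 : 1/2 < 1 :> R by rewrite ltr_pdivrMr// mul1r ltr1n.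
have x1 : x < 1 by exact: le_lt_trans h1.
have x01 : 0 < x < 1 by rewrite x0.
have lp : 0 < l + 1 by rewrite addr_gt0.
have n1 : vanish0 (fun x => x `^ (l + 1) / (l + 1)).
  apply: (vanish0_le (K := (l + 1)^-1)) (powR_vanish lp); last by rewrite invr_gt0.
  by move=> y _; rewrite normrM mulrC ger0_norm ?invr_ge0 ?(ltW lp).
have vsub (f g : R -> R) : vanish0 f -> vanish0 g -> vanish0 (fun x => f x - g x).
  move=> hf hg e e0; have e2 : 0 < e / 2 by rewrite divr_gt0.
  have [d1 d10 H1] := hf _ e2; have [d2 d20 H2] := hg _ e2.
  exists (Num.min d1 d2) => [|y]; first by rewrite lt_min d10.
  rewrite lt_min => /and3P[y0 y1 y2] y3; apply: le_trans (ler_normB _ _) _.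
  by rewrite [leRHS]splitr lerD// ?H1 ?H2 ?y0.
have A1 : x `^ (l + 1) / (l + 1) <= pF al l x.
  rewrite -subr_ge0; apply: (@nonneg_of_derive R (fun x => pF al l x - x `^ (l + 1) / (l + 1))
    (fun x => x `^ l * ((1 - x) `^ al - 1))) x01 => [y y01|y /andP[y0 y1]|].
  - case/andP: (y01) => y0 y1.
    apply: (is_derive_eq (derB (pF_derive al (ltW l0) y01) (derM (is_derive1_powR (l + 1) y0) (derC (l + 1)^-1 y)))).
    by rewrite addrK; move: (_ `^ l) (_ `^ al) => p q; field; rewrite gt_eqF.
  - rewrite mulr_ge0 ?powR_ge0// subr_ge0 -[al]opprK powRN invf_ge1 ?powR_gt0 ?subr_gt0//.
    by rewrite -[leRHS](one_powR (- al)) ge0_ler_powR ?nnegrE ?oppr_ge0 ?subr_ge0 ?(ltW y1)// gerBl ltW.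
  - exact: vsub (pF_vanish al (ltW l0)).1 n1.
have A2 : pF al 0 x <= x * M.
  apply: le_trans (_ : x `^ 1 * (1 - x) `^ al <= _); last first.
    rewrite powRr1 ?(ltW x0)// ler_wpM2l ?(ltW x0)// powR_half_bound//; lra.
  rewrite -subr_ge0; apply: (@nonneg_of_derive R (fun x => x `^ 1 * (1 - x) `^ al - pF al 0 x)
    (fun x => x `^ 1 * (- al * (1 - x) `^ (al - 1)))) x01 => [y y01|y /andP[y0 y1]|].
  - apply: (is_derive_eq (derB (powers_derive 1 al y01) (pF_derive al (lexx 0) y01))).
    by rewrite subrr !powRr0; ring.
  - by rewrite !mulr_ge0 ?powR_ge0// oppr_ge0.
  - by apply: vsub (pF_vanish al (lexx 0)).1; exact: powers_vanish.
have f1 := pF_gt0 al (ltW l0) x01; have f2 := pF_gt0 al (lexx 0) x01.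
have B1 : (l + 1) * w - ln (l + 1) <= ln (pF al l x).
  have -> : (l + 1) * w - ln (l + 1) = ln (x `^ (l + 1) / (l + 1)).
    by rewrite ln_div ?posrE ?powR_gt0// ln_powR expRK.
  by rewrite ler_ln ?posrE ?divr_gt0 ?powR_gt0.
have B2 : ln (pF al 0 x) <= w + ln M.
  have -> : w + ln M = ln (x * M) by rewrite lnM ?posrE// expRK.
  by rewrite ler_ln ?posrE// mulr_gt0.
rewrite /lmean -/x; move: (ln _) (ln _) B1 B2 => a1; move: (ln _) (ln _) => *; lra.
Qed.

(** Put [c = expR (- d) < 1]. Near 1 the integrand [(x^l - c) (1 - x)^al] is positive with divergent
    integral, so [F_l > c F_0] at points arbitrarily close to 1. *)
Let lmean_near0 d w : 0 < d -> w < 0 -> exists2 z, w < z < 0 & - d < lmean al l z.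
Proof.
move=> d0 w0; pose c := expR (- d); have c1 : c < 1 by rewrite expR_lt1 oppr_lt0.
have c00 : 0 < c by exact: expR_gt0.
pose x1 := Num.max (expR w) (Num.max (1/2) ((1 + c) / 2)).
have xw : expR w <= x1 by rewrite le_max lexx.
have xh : 1/2 <= x1 by rewrite !le_max lexx !orbT.
have xc : (1 + c) / 2 <= x1 by rewrite !le_max lexx !orbT.
have x11 : x1 < 1 by rewrite !gt_max expR_lt1 w0 /=; apply/andP; split; lra.
have x10 : 0 < x1 by apply: lt_le_trans xh; rewrite divr_gt0.
have Dd x : 0 < x < 1 -> is_derive x 1 (fun x => pF al l x - c * pF al 0 x) ((x `^ l - c) * (1 - x) `^ al).
  move=> x01; apply: (is_derive_eq (derB (pF_derive al (ltW l0) x01) (derM (derC c x) (pF_derive al (lexx 0) x01)))).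
  by rewrite powRr0; ring.
have [|||x /andP[h1 h2] h3] := @diverge_right _ _ x1 ((1 - c) / 2) _ _ Dd _ 0.
- by rewrite divr_gt0// subr_gt0.
- by rewrite x10.
- move=> x /andP[xx xlt]; have x0' := lt_le_trans x10 xx; have u0 : 0 < 1 - x by rewrite subr_gt0.
  have hp := @cube x; rewrite x0' xlt in hp; have {}hp := hp isT.
  have p0 : 0 < (1 - x) `^ al by exact: powR_gt0.
  rewrite -mulrA -[leLHS]mulr1; apply: ler_pM => //; first by rewrite divr_ge0// subr_ge0 ltW.
    have : x <= x `^ l by apply: ger1_powR => //; rewrite x0' ltW.
    lra.
  apply: le_trans hp _; rewrite ler_wpM2l ?(ltW p0)// exprS ler_piMr ?(ltW u0)// exprn_ile1 ?(ltW u0)//.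
  by rewrite gerBl ltW.
have x0' := lt_trans x10 h1.
exists (ln x).
  by rewrite ln_lt0 ?x0'// andbT -ltr_expR lnK ?posrE// (le_lt_trans xw).
have x01 : 0 < x < 1 by rewrite x0'.
rewrite /lmean lnK ?posrE// ltrBrDr -[- d]expRK -/c.
have f1 := pF_gt0 al (ltW l0) x01; have f2 := pF_gt0 al (lexx 0) x01.
rewrite -lnM ?posrE// ltr_ln ?posrE//; first by rewrite -subr_gt0.
exact: mulr_gt0.
Qed.

(** At [w] the graph is [d] below the line of slope [l], yet at some later [z] it exceeds [- d]; the
    chord from [w] to [z] thus has slope [l + e] with [e > 0]. Concavity would force slopes at least
    [l + e] to the left of [w], against [lmean_lower]. *)
Lemma lmean_not_concave : ~ cvx (fun w => - lmean al l w).
Proof.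
move=> cv; have [w w0 hw] := small_point; have [K HK] := lmean_lower.
have hw2 : lmean al l w < l * w by apply: lt_trans hw _; rewrite ltr_nM2r.
pose d := l * w - lmean al l w; have d0 : 0 < d by rewrite subr_gt0.
have [z /andP[wz z0] hz] := lmean_near0 d0 w0.
move: (lmean al l) cv hw2 @d d0 hz HK => L cv hw2 d d0 hz HK.
have lz : l * z < 0 by rewrite pmulr_rlt0.
pose e := (L z - L w) / (z - w) - l.
have zw : 0 < z - w by rewrite subr_gt0.
have E : L z - L w = (l + e) * (z - w) by rewrite /e [l + _]addrC subrK divfK// gt_eqF.
have e0 : 0 < e.
  rewrite -(pmulr_lgt0 _ zw); have -> : e * (z - w) = L z - L w - l * (z - w) by rewrite E; ring.
  by move: hz; rewrite /d; lra.
(* Makes [e (w - v)] larger than [L w - l w + K], the room left by [lmean_lower], and keeps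
   [expR v <= 1/2]. *)
pose v := Num.min (ln (1/2)) (Num.min (w - 1) (w - (L w - l * w + K) / e - 1)).
have v1 : v <= ln (1/2) by rewrite ge_min lexx.
have v2 : v < w by rewrite !gt_min; apply/orP; right; apply/orP; left; lra.
have v3 : v < w - (L w - l * w + K) / e by rewrite !gt_min; apply/orP; right; apply/orP; right; lra.
have hv : l * v - K <= L v.
  by apply: HK; rewrite -[leRHS]lnK ?ler_expR// posrE divr_gt0.
have := cvx_slope cv v2 wz z0; apply/negP; rewrite -ltNge.
have -> : (- L z - - L w) * (w - v) = - ((l + e) * (w - v)) * (z - w).
  have -> : - L z - - L w = - (L z - L w) by ring.
  by rewrite E; ring.
rewrite ltr_pM2r//.
have : (L w - l * w + K) / e < w - v by lra.
rewrite ltr_pdivrMr//; lra.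
Qed.

End Fixed.

Lemma monomial_holomorphic n (a : R[i]) : holomorphic_on_disk (fun z => a * z ^+ n).
Proof.
move=> z _.
have h : derivable (fun z : R[i]^o => z ^+ n : R[i]^o) z 1.
  elim: n => [|n IH]; first exact: derivable_cst.
  have -> : (fun z : R[i]^o => z ^+ n.+1 : R[i]^o) = (id : R[i]^o -> R[i]^o) * (fun z : R[i]^o => z ^+ n : R[i]^o).
    by apply: funext => y; rewrite exprS.
  exact: (@derivableM R[i] R[i]^o id (fun z : R[i]^o => z ^+ n : R[i]^o) z 1 (@derivable_id _ _ _ _) IH).
have -> : ((fun z => a * z ^+ n) : R[i]^o -> R[i]^o) = (cst a : R[i]^o -> R[i]^o) * (fun z : R[i]^o => z ^+ n : R[i]^o) by apply: funext => y.
exact: (@derivableM R[i] R[i]^o (cst a) (fun z : R[i]^o => z ^+ n : R[i]^o) z 1 (@derivable_cst _ R[i]^o R[i]^o a z 1) h).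
Qed.

Lemma mean_not_convex_not_concave al beta : al < - 3 -> 0 <= beta <= 1 ->
  exists f g : R[i] -> R[i],
       [/\ holomorphic_on_disk f,
           positive_on01 (area_mean al beta f) &
           ~ loglog_convex (area_mean al beta f)] /\
       [/\ holomorphic_on_disk g,
           positive_on01 (area_mean al beta g) &
           ~ loglog_concave (area_mean al beta g)].
Proof.
(* Degree 1 unless [beta = 1], then degree 2: the exponent [l] must be positive and at most 1 for
   [D_small]. One monomial serves as both [f] and [g]. *)
move=> al3 b01; have [n n0 l01] : exists2 n, (0 < n)%N & 0 < n%:R - beta <= 1.
  case/andP: b01 => b0 b1; have [->|bn] := eqVneq beta 1; first by exists 2%N => //; lra.
  exists 1%N => //; rewrite subr_gt0 lt_neqAle bn b1 /=; lra.
have [h1 h2 h3] := monomial_cvx al (oner_neq0 R[i]) n0 b01.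
have hol : holomorphic_on_disk (fun z : R[i] => 1 * z ^+ n) by exact: monomial_holomorphic.
exists (fun z => 1 * z ^+ n), (fun z => 1 * z ^+ n); split; split => //.
  by rewrite h2; exact: lmean_not_convex.
by rewrite h3; exact: lmean_not_concave.
Qed.

End NegativeExponent.

(** * From monomials to univalent functions *)

Section Univalent.
Context {R : realType}.
Local Open Scope classical_set_scope.
Local Open Scope complex_scope.
Local Open Scope ring_scope.
Local Notation leb := (@lebesgue_measure R).
Implicit Types (G H : R -> R) (al k s t u x y r : R).

(* Log-convexity in the form obtained from weighted AM-GM by optimising over [k]: it is linear in [G],
   hence stable under nonnegative combinations and pointwise limits. *)
Definition lcx G := forall s k x y, 0 <= s <= 1 -> x < 0 -> y < 0 ->
  G (s * x + (1 - s) * y) <= s * expR ((1 - s) * k) * G x + (1 - s) * expR (- (s * k)) * G y.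

Lemma expR_convex s x y : 0 <= s <= 1 -> expR (s * x + (1 - s) * y) <= s * expR x + (1 - s) * expR y.
Proof.
move=> /andP[s0 s1]; set m := s * x + _.
have tangent z : expR m * (1 + (z - m)) <= expR z.
  have -> : expR z = expR m * expR (z - m) by rewrite -expRD addrC subrK.
  by rewrite ler_wpM2l ?expR_ge0// expR_ge1Dx.
have h1 := ler_wpM2l s0 (tangent x).
have s1' : 0 <= 1 - s by rewrite subr_ge0.
have h2 := ler_wpM2l s1' (tangent y).
apply: le_trans (lerD h1 h2); rewrite le_eqVlt; apply/orP; left; apply/eqP.
by rewrite /m; move: (expR _) => e; ring.
Qed.

(** In the weighted mean of the exponents [k] cancels, so [lcx] follows from convexity of [ln G] and
    of [expR]. Conversely, one choice of [k] makes the two summands proportional to their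
    weights. *)
Lemma lcx_cvx G : (forall u, u < 0 -> 0 < G u) -> lcx G <-> cvx (fun u => ln (G u)).
Proof.
move=> G0; split=> [h s x y s01 x0 y0|h s k x y s01 x0 y0].
  have z0 := conv_lt0 s01 x0 y0.
  have eG u : u < 0 -> G u = expR (ln (G u)) by move=> u0; rewrite lnK ?posrE ?G0.
  (* The optimal [k]: equality holds in the arithmetic-geometric mean inequality. *)
  have := h s (ln (G y) - ln (G x)) x y s01 x0 y0.
  move: (eG _ x0) (eG _ y0) (eG _ z0); set z := s * x + _; move: (ln (G x)) (ln (G y)) (ln (G z)) => X Y Z -> -> ->.
  rewrite -!mulrA -!expRD.
  have -> : (1 - s) * (Y - X) + X = s * X + (1 - s) * Y by ring.
  have -> : - (s * (Y - X)) + Y = s * X + (1 - s) * Y by ring.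
  by rewrite -mulrDl [s + _]addrC subrK mul1r ler_expR.
have z0 := conv_lt0 s01 x0 y0.
rewrite -[G (_ + _)]lnK ?posrE ?G0//.
apply: le_trans (_ : expR (s * ((1 - s) * k + ln (G x)) + (1 - s) * (- (s * k) + ln (G y))) <= _).
  rewrite ler_expR; apply: le_trans (h s x y s01 x0 y0) _.
  by rewrite le_eqVlt; apply/orP; left; apply/eqP; ring.
apply: le_trans (expR_convex _ _ s01) _.
by rewrite !expRD !lnK ?posrE ?G0// !mulrA.
Qed.

Lemma lcx_sum N (d : nat -> R) (F : nat -> R -> R) :
  (forall n, 0 <= d n) -> (forall n, lcx (F n)) -> lcx (fun u => \sum_(n < N) d n * F n u).
Proof.
move=> d0 hF s k x y s01 x0 y0; rewrite !mulr_sumr -big_split /=; apply: ler_sum => n _.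
have := ler_wpM2l (d0 n) (hF n s k x y s01 x0 y0).
rewrite mulrDr.
by rewrite ![d n * (_ * F n _)]mulrCA.
Qed.

Definition tends (S : nat -> R) (L : R) := forall e, 0 < e -> exists N0, forall N, (N0 <= N)%N -> `|L - S N| <= e.

Lemma lcx_limit (S : nat -> R -> R) G : (forall N, lcx (S N)) ->
  (forall u, u < 0 -> tends (fun N => S N u) (G u)) -> lcx G.
Proof.
move=> hS hl s k x y s01 x0 y0; have z0 := conv_lt0 s01 x0 y0.
have h N := hS N s k x y s01 x0 y0; move: h.
set a := s * expR _; set b := (1 - s) * expR _; set z := s * x + _ => h.
have a0 : 0 <= a by case/andP: s01 => ? _; rewrite mulr_ge0 ?expR_ge0.
have b0 : 0 <= b by case/andP: s01 => _ ?; rewrite mulr_ge0 ?expR_ge0 ?subr_ge0.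
apply/ler_addgt0Pr => e e0; pose K := 1 + a + b.
have K0 : 0 < K by rewrite /K -addrA ltr_pwDl// addr_ge0.
have eK : 0 < e / K by rewrite divr_gt0.
have [N1 H1] := hl x x0 _ eK; have [N2 H2] := hl y y0 _ eK; have [N3 H3] := hl z z0 _ eK.
pose N := maxn N1 (maxn N2 N3).
have n1 : (N1 <= N)%N by exact: leq_maxl.
have n2 : (N2 <= N)%N by rewrite /N !leq_max leqnn orbT.
have n3 : (N3 <= N)%N by rewrite /N !leq_max leqnn !orbT.
have := H1 N n1; have := H2 N n2; have := H3 N n3.
rewrite !ler_norml => /andP[_ h3] /andP[h2 _] /andP[h1 _]; have := h N.
have E : e = K * (e / K) by rewrite mulrC divfK// gt_eqF.
have k1 := ler_wpM2l a0 h1; have k2 := ler_wpM2l b0 h2.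
rewrite [in X in _ -> X]E /K; move: (e / K) h3 k1 k2 => q.
move: (S _ x) (S _ y) (S _ z) => A B D; lra.
Qed.

Variables (f : R[i] -> R[i]) (fU : univalent_on_disk f) (al : R).

Let series : exists d : nat -> R, (forall n, 0 <= d n) /\
  forall t, 0 < t < 1 -> tends (fun N => \sum_(n < N) d n * (t ^+ 2) ^+ n) (Phi_A 1 f t).
Proof.
have [d [d0 hd]] := univalent_area_series fU; exists d; split=> // t t01 e e0.
have t0 : 0 < t by case/andP: t01.
have c0 : 0 < pi * t ^+ 2 by rewrite mulr_gt0 ?pi_gt0// exprn_gt0.
have [N0 H] := hd t t01 (e * (pi * t ^+ 2)) (mulr_gt0 e0 c0).
exists N0 => N /H; rewrite /Phi_A powRr1 ?(ltW c0)//.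
have -> : area f t = area f t / (pi * t ^+ 2) * (pi * t ^+ 2) by rewrite divfK// gt_eqF.
set A := area f t / _; rewrite mulfK ?gt_eqF//.
rewrite [A * _]mulrC -mulrBr normrM gtr0_norm// mulrC ler_pM2r//.
Qed.

Lemma univalent_mean_convex : -3 <= al <= 0 -> loglog_convex (area_mean al 1 f).
Proof.
move=> al0; have [d [d0 hd]] := series.
pose P N t : R := \sum_(n < N) d n * (t ^+ 2) ^+ n.
(* Nonnegative coefficients make tails increase with the radius, so the error at [r] controls the
   error at every [t <= r], and with it the error of the integral. *)
have P_tail N M t r : (N <= M)%N -> 0 < t -> t <= r -> 0 <= P M t - P N t <= P M r - P N r.
  move=> NM t0 tr; have PE u : P M u - P N u = \sum_(N <= n < M) d n * (u ^+ 2) ^+ n.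
    rewrite /P -!(big_mkord xpredT (fun n => d n * (u ^+ 2) ^+ n)) (big_cat_nat (leq0n N) NM) /=.
    by rewrite addrAC subrr add0r.
  rewrite !PE.
  have tr2 n : (t ^+ 2) ^+ n <= (r ^+ 2) ^+ n.
    have r0 := lt_le_trans t0 tr.
    by rewrite !lerXn2r ?nnegrE ?exprn_ge0 ?(ltW t0) ?(ltW r0).
  rewrite sumr_ge0 /=; last by move=> n _; rewrite mulr_ge0 ?exprn_ge0 ?(ltW t0).
  by apply: ler_sum => n _; rewrite ler_wpM2l.
have P_bound N t r : 0 < t -> t <= r -> r < 1 -> 0 <= Phi_A 1 f t - P N t <= Phi_A 1 f r - P N r.
  move=> t0 tr r1; have r0 := lt_le_trans t0 tr; have t1 := le_lt_trans tr r1.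
  have t01 : 0 < t < 1 by rewrite t0.
  have r01 : 0 < r < 1 by rewrite r0.
  have core e : 0 < e -> - e <= Phi_A 1 f t - P N t <= Phi_A 1 f r - P N r + e.
    move=> e0; have e2 : 0 < e / 2 by rewrite divr_gt0.
    have [N1 H1] := hd t t01 _ e2; have [N2 H2] := hd r r01 _ e2.
    pose M := maxn N (maxn N1 N2).
    have NM : (N <= M)%N by rewrite leq_maxl.
    have n1 : (N1 <= M)%N by rewrite /M !leq_max leqnn orbT.
    have n2 : (N2 <= M)%N by rewrite /M !leq_max leqnn !orbT.
    have := H1 M n1; have := H2 M n2.
    have := P_tail N M t r NM t0 tr; rewrite -/(P M t) -/(P M r) !ler_norml.
    move: (Phi_A _ _ _) (Phi_A _ _ _) (P M t) (P M r) (P N t) (P N r) => a b c g h i.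
    by move=> /andP[? ?] /andP[? ?] /andP[? ?]; apply/andP; split; lra.
  apply/andP; split.
    by rewrite -oppr_le0; apply/ler_addgt0Pr => e /core/andP[h _]; rewrite add0r lerNl.
  by apply/ler_addgt0Pr => e /core/andP[].
have mD (r : R) : measurable (`]0, r[ : set (measurableTypeR R)) by exact: measurable_itv.
have int_pdens n r : 0 < r < 1 -> leb.-integrable `]0, r[ (EFin \o pdens al n%:R).
  move=> r01; apply: integrableS (pdens_integrable al (ler0n R n) r01) => //.
  by apply: subset_itvl; rewrite bnd_simp.
have pdens0 t : pdens al 0%:R t = mu_density al t by rewrite /pdens mulr0n powRr0 mul1r.
have Pint N r : 0 < r < 1 -> leb.-integrable `]0, r[ (EFin \o (fun t => P N t * mu_density al t)) /\
    \int[leb]_(t in `]0, r[) (P N t * mu_density al t) = \sum_(n < N) d n * pint al n%:R r.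
  move=> r01; pose Q N t : R := \sum_(n < N) d n * pdens al n%:R t.
  have PQ t : t \in `]0, r[%classic -> P N t * mu_density al t = Q N t.
    rewrite inE /= in_itv /= => /andP[t0 _]; rewrite /P /Q mulr_suml; apply: eq_bigr => n _.
    by rewrite /pdens powR_mulrn ?sqr_ge0// mulrA.
  have [h1 h2] : leb.-integrable `]0, r[ (EFin \o Q N) /\
      \int[leb]_(t in `]0, r[) Q N t = \sum_(n < N) d n * pint al n%:R r.
    elim: (N) => [|K [IH1 IH2]].
      have -> : Q 0%N = cst 0 by apply: funext => t; rewrite /Q big_ord0.
      rewrite big_ord0; split; first exact: integrable0.
      by rewrite Rintegral_cst// mul0r.
    have QS : Q K.+1 = (fun t => Q K t + d K * pdens al K%:R t).
      by apply: funext => t; rewrite /Q big_ord_recr.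
    have ik : leb.-integrable `]0, r[ (EFin \o (fun t => d K * pdens al K%:R t)).
      by apply: (@eq_integrable _ _ _ _ _ (mD r) _ _ _ (integrableZl (mD r) (d K) (int_pdens K r r01))) => // t _ /=; rewrite EFinM.
    rewrite QS big_ord_recr /= -IH2; split; first exact: (integrableD (mD r) IH1 ik).
    by rewrite RintegralD// RintegralZl//; exact: int_pdens.
  split; last by rewrite -h2; apply: eq_Rintegral => t /PQ.
  by apply: (@eq_integrable _ _ _ _ _ (mD r) _ _ _ h1) => // t /PQ h /=; rewrite h.
have main r : 0 < r < 1 -> tends (fun N => \sum_(n < N) d n * (pint al n%:R r / pint al 0 r)) (area_mean al 1 f r).
  move=> r01; case/andP: (r01) => r0 r1.
  have m0 : leb.-integrable `]0, r[ (EFin \o mu_density al).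
    by apply: (@eq_integrable _ _ _ _ _ (mD r) _ _ _ (int_pdens 0%N r r01)) => // t _ /=; rewrite pdens0.
  have mpos t : 0 < t -> 0 <= mu_density al t by move=> t0; rewrite /mu_density !mulr_ge0 ?powR_ge0// ltW.
  have Fi : leb.-integrable `]0, r[ (EFin \o (fun t => Phi_A 1 f t * mu_density al t)).
    apply: (@le_integrable _ _ _ _ _ (mD r) _ (EFin \o (fun t => Phi_A 1 f r * mu_density al t))).
    (* [Phi_A] is measurable as a pointwise limit of polynomials. *)
    - apply/measurable_EFinP; apply: (@measurable_fun_cvg _ _ _ _ (fun N t => P N t * mu_density al t)) => [N|t].
        by have [/measurable_int/measurable_EFinP h _] := Pint N r r01.
      rewrite /= in_itv /= => /andP[t0 tr].
      have t01 : 0 < t < 1 by rewrite t0 (lt_trans tr).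
      apply: cvgM; last exact: cvg_cst.
      apply/cvgrPdist_le => e e0; have [N0 H] := hd t t01 e e0.
      by exists N0 => // N /= hN; exact: H.
    - move=> t /=; rewrite in_itv /= => /andP[t0 tr]; rewrite lee_fin normrM [leRHS]normrM ler_wpM2r//.
      have := P_bound 0%N t r t0 (ltW tr) r1; rewrite /P !big_ord0 !subr0 => /andP[p0 p1].
      by rewrite (ger0_norm p0) (ger0_norm (le_trans p0 p1)).
    - by apply: (@eq_integrable _ _ _ _ _ (mD r) _ _ _ (integrableZl (mD r) (Phi_A 1 f r) m0)) => // t _ /=; rewrite EFinM.
  move=> e e0; have [N0 H] := hd r r01 e e0; exists N0 => N /H hN.
  have p0 := pint_gt0 al (lexx 0) r01; have [i1 i2] := Pint N r r01.
  have -> : \sum_(n < N) d n * (pint al n%:R r / pint al 0 r) = (\sum_(n < N) d n * pint al n%:R r) / pint al 0 r.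
    by rewrite mulr_suml; apply: eq_bigr => n _; rewrite mulrA.
  rewrite -i2 /area_mean pint0E -mulrBl -RintegralB// normrM [`|_^-1|]gtr0_norm ?invr_gt0// ler_pdivrMr//.
  have iB : leb.-integrable `]0, r[ (EFin \o (fun t => Phi_A 1 f t * mu_density al t - P N t * mu_density al t)).
    exact: (integrableB (mD r) Fi i1).
  have nn t : `]0, r[%classic t -> 0 <= Phi_A 1 f t * mu_density al t - P N t * mu_density al t.
    rewrite /= in_itv /= => /andP[t0 tr]; rewrite -mulrBl mulr_ge0 ?mpos//.
    by have /andP[] := P_bound N t r t0 (ltW tr) r1.
  rewrite ger0_norm; last exact: Rintegral_ge0.
  rewrite -pint0E -RintegralZl//; apply: le_Rintegral => //.
    by apply: (@eq_integrable _ _ _ _ _ (mD r) _ _ _ (integrableZl (mD r) e m0)) => // t _ /=; rewrite EFinM.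
  move=> t; rewrite /= in_itv /= => /andP[t0 tr]; rewrite -mulrBl ler_wpM2r ?mpos//.
  have /andP[_ h] := P_bound N t r t0 (ltW tr) r1.
  by apply: le_trans h (le_trans (ler_norm _) hN).
pose M n u := pint al n%:R (expR u) / pint al 0 (expR u).
have M0 n u : u < 0 -> 0 < M n u by move=> u0; rewrite divr_gt0// pint_gt0// exp01.
have Mlcx n : lcx (M n).
  apply/lcx_cvx; first exact: M0.
  apply/(@cvx_scale2 R (lmean al n%:R) (fun u => ln (M n u)) 0); last exact: lmean_cvx.
  move=> u u0; have r01 := exp01 u0; rewrite /lmean !pF_exp2 add0r.
  by rewrite ln_div ?posrE ?pint_gt0.
have Glcx : lcx (fun u => area_mean al 1 f (expR u)).
  apply: (@lcx_limit (fun N u => \sum_(n < N) d n * M n u)) => [N|u u0]; first exact: lcx_sum.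
  by apply: main; exact: exp01.
rewrite /loglog_convex convex_function_cvx.
have [[m dm]|dz] := pselect (exists m, 0 < d m).
  apply/lcx_cvx => // u u0; pose c := d m * M m u.
  have c0 : 0 < c by rewrite mulr_gt0// M0.
  have c2 : 0 < c / 2 by rewrite divr_gt0.
  have [N0 /(_ (maxn N0 m.+1) (leq_maxl _ _))] := main _ (exp01 u0) _ c2.
  rewrite ler_norml => /andP[h _].
  have : c <= \sum_(n < maxn N0 m.+1) d n * M n u.
    have lm : (m < maxn N0 m.+1)%N by rewrite leq_max leqnn orbT.
    rewrite (bigD1 (Ordinal lm)) //= lerDl sumr_ge0// => n _.
    by rewrite mulr_ge0 ?d0// ltW// M0.
  move: h; rewrite /M; move: (\sum_(_ < _) _) (area_mean _ _ _ _) => S A; lra.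
(* If all coefficients vanish, the mean is 0 throughout and [ln 0 = 0], so convexity is trivial. *)
have dz0 n : d n = 0.
  by apply/eqP; rewrite eq_le d0 andbT leNgt; apply/negP => h; apply: dz; exists n.
have az u : u < 0 -> area_mean al 1 f (expR u) = 0.
  move=> u0; apply/eqP; rewrite -normr_le0; apply/ler_addgt0Pr => e e0; rewrite add0r.
  have [N0 /(_ N0 (leqnn _))] := main _ (exp01 u0) _ e0.
  by rewrite big1 ?subr0// => n _; rewrite dz0 mul0r.
by move=> s x y s01 x0 y0; rewrite !az ?conv_lt0// ln0// !mulr0 addr0.
Qed.

End Univalent.

Local Open Scope ring_scope.

Theorem theorem3 (R : realType) (beta : R) (hbeta : 0 <= beta <= 1) :
  (forall alpha : R, alpha < - 3%:R ->
     exists f g : R[i] -> R[i],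
       [/\ holomorphic_on_disk f,
           positive_on01 (area_mean alpha beta f) &
           ~ loglog_convex (area_mean alpha beta f)] /\
       [/\ holomorphic_on_disk g,
           positive_on01 (area_mean alpha beta g) &
           ~ loglog_concave (area_mean alpha beta g)])
  /\
  (forall alpha : R, - 3%:R <= alpha <= 0 ->
     (forall (n : nat) (a : R[i]), (1 <= n)%N -> a <> 0 ->
        loglog_convex (area_mean alpha 1 (fun z => a * z ^+ n))) /\
     (forall f : R[i] -> R[i], univalent_on_disk f ->
        loglog_convex (area_mean alpha 1 f)))
  /\
  (forall alpha : R, 0 < alpha ->
     forall (n : nat) (a : R[i]), (1 <= n)%N -> a <> 0 ->
       ~ (n = 1%N /\ beta = 1) ->
       ~ loglog_convex (area_mean alpha beta (fun z => a * z ^+ n))).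
Proof.
split; first by move=> alpha h; exact: mean_not_convex_not_concave.
split=> alpha.
  move=> h; split=> [n a n0 /eqP a0|f fU]; last exact: univalent_mean_convex.
  exact: monomial_mean_convex.
by move=> al0 n a n0 /eqP a0 nb; exact: monomial_mean_not_convex.
Qed.
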